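(* Let $\psi_i:\mathbb{R}\to\mathbb{R}$ ($i\in\mathbb{Z}$) be functions with a splitting $\psi_i=\psi_i^c+\psi_i^b$, where $\psi_i^c$ is twice differentiable, $\psi_i^b$ is differentiable, and for some constant $C_1<\infty$ and all $i\in\mathbb{Z}$, $z\in\mathbb{R}$, $$(\psi_i^c)''(z)\ge 0,\qquad |\psi_i^b(z)|+|(\psi_i^b)'(z)|\le C_1 .$$ Let $M=(M_{ij})_{i,j\in\mathbb{Z}}$ be a real matrix such that $M_{ij}=M_{ji}$ for all $i,j\in\mathbb{Z}$, such that for some $\delta>0$ $$\sum_{j\in\mathbb{Z},\,j\ne i}|M_{ij}|+\delta\le M_{ii}\qquad\text{for all } i\in\mathbb{Z},$$ and such that for some $\alpha>0$ and $C_0<\infty$ $$|M_{ij}|\le \frac{C_0}{|i-j|^{2+\alpha}+1}\qquad\text{for all } i,j\in\mathbb{Z}.$$ Let $H(x)=\sum_{i\in\mathbb{Z}}\psi_i(x_i)+\frac12\sum_{i,j\in\mathbb{Z}}M_{ij}x_ix_j$ be the associated formal Hamiltonian. Then there exist constants $0<\tilde\alpha<\alpha$ and $C<\infty$, depending only on $\delta,C_1,C_0,\alpha$, such that for every finite $\Lambda\subset\mathbb{Z}$, every tempered $x^{\mathbb{Z}\setminus\Lambda}$ and all $i,j\in\Lambda$, $$|\operatorname{cov}_{\mu_\Lambda}(x_i,x_j)|\le \frac{C}{|i-j|^{2+\tilde\alpha}+1},$$ where $\mu_\Lambda$ is the finite-volume Gibbs measure associated to $H$ with boundary values $x^{\m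athbb{Z}\setminus\Lambda}$.
   Context: For $S\subset\mathbb{Z}$ write $x^S=(x_i)_{i\in S}$. For a finite $\Lambda\subset\mathbb{Z}$, spin values $x^{\mathbb{Z}\setminus\Lambda}\in\mathbb{R}^{\mathbb{Z}\setminus\Lambda}$ are called tempered if $\sum_{j\in\mathbb{Z}\setminus\Lambda}|M_{ij}|\,|x_j|<\infty$ for all $i\in\Lambda$. The finite-volume Gibbs measure with boundary values $x^{\mathbb{Z}\setminus\Lambda}$ (tempered) is the probability measure on $\mathbb{R}^\Lambda$ with density $$\mu_\Lambda(dx^\Lambda)=\frac1{Z_{\mu_\Lambda}}e^{-H(x^\Lambda,x^{\mathbb{Z}\setminus\Lambda})}\,dx^\Lambda,$$ $Z_{\mu_\Lambda}$ being the normalization constant, where in the formal Hamiltonian only the terms depending on $x^\Lambda$ matter, i.e. $H(x^\Lambda,x^{\mathbb{Z}\setminus\Lambda})$ is understood as $\sum_{i\in\Lambda}\psi_i(x_i)+\frac12\sum_{i,j\in\Lambda}M_{ij}x_ix_j+\sum_{i\in\Lambda,\,j\in\mathbb{Z}\setminus\Lambda}M_{ij}x_ix_j$. Here $\operatorname{cov}_{\mu}$ denotes covariance under $\mu$. *)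

(* Defs.v *)
From HB Require Import structures.
From mathcomp Require Import all_boot all_order all_algebra finmap.
From mathcomp Require Import all_classical all_reals all_analysis.

Set Implicit Arguments.
Unset Strict Implicit.
Unset Printing Implicit Defensive.

Import Order.TTheory GRing.Theory Num.Theory.
Import numFieldNormedType.Exports.

Local Open Scope classical_set_scope.
Local Open Scope ring_scope.

(* R^n with its Borel sigma-algebra, which for tuples the library takes to be
   the one generated by the coordinate maps. *)
Notation "'Rn[ R ]_ n" := (n.-tuple (measurableTypeR R))
  (at level 8, n at level 2, format "''Rn[' R ]_ n") : type_scope.

(* The library has binary products of measures only, so that Lebesgue measure
   on R^n is built by recursion, transporting lebesgue_measure \x lambda_n
   along R x R^n ~ R^(n+1). *)
Section lebesgue_cons.
Context {R : realType} (n : nat).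
Variable mu : {sigma_finite_measure set 'Rn[R]_n -> \bar R}.

Definition tuple_cons (p : measurableTypeR R * 'Rn[R]_n) : 'Rn[R]_n.+1 :=
  [tuple of p.1 :: p.2].

Definition lebesgue_cons : set 'Rn[R]_n.+1 -> \bar R :=
  pushforward (lebesgue_measure \x mu)%E tuple_cons.

Let tuple_uncons (t : 'Rn[R]_n.+1) : measurableTypeR R * 'Rn[R]_n :=
  (thead t, [tuple of behead t]).

Let measurable_tuple_cons : measurable_fun [set: _] tuple_cons.
Proof.
by apply: measurable_cons; [exact: measurable_fst|exact: measurable_snd].
Qed.

Let measurable_tuple_uncons : measurable_fun [set: _] tuple_uncons.
Proof.
apply: measurable_fun_pair => /=.
- exact: measurable_tnth.
- exact: measurable_behead.
Qed.

Let tuple_consK : cancel tuple_cons tuple_uncons.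
Proof.
by move=> -[a t]; rewrite /tuple_uncons theadE; congr (_, _); exact: val_inj.
Qed.

Let lebesgue_cons0 : lebesgue_cons set0 = 0%E.
Proof. by rewrite /lebesgue_cons /pushforward preimage_set0 measure0. Qed.

Let lebesgue_cons_ge0 A : (0 <= lebesgue_cons A)%E.
Proof. exact: measure_ge0. Qed.

Let lebesgue_cons_sigma_additive : semi_sigma_additive lebesgue_cons.
Proof.
move=> F mF tF mUF; apply: (measure_semi_sigma_additive (s :=
  measure_function_pushforward__canonical__measure_function_Measure _
    measurable_tuple_cons)) => //.
Qed.

HB.instance Definition _ := isMeasure.Build _ _ _ lebesgue_cons
  lebesgue_cons0 lebesgue_cons_ge0 lebesgue_cons_sigma_additive.

Let lebesgue_cons_sigma_finite : sigma_finite setT lebesgue_cons.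
Proof.
have /sigma_finiteP[F [TF ndF Foo]] := sigma_finiteT (@lebesgue_measure R).
have /sigma_finiteP[G [TG ndG Goo]] := sigma_finiteT mu.
exists (fun k => tuple_uncons @^-1` (F k `*` G k)).
  rewrite -preimage_bigcup -[LHS](preimage_setT tuple_uncons); congr (_ @^-1` _).
  apply/esym; rewrite -subTset => -[x y] _.
  have [k _ Fkx] : (\bigcup_i F i) x by rewrite -TF.
  have [l _ Gly] : (\bigcup_i G i) y by rewrite -TG.
  exists (maxn k l) => //; split.
  - by move: x Fkx; exact/subsetPset/ndF/leq_maxl.
  - by move: y Gly; exact/subsetPset/ndG/leq_maxr.
move=> k; have [mF Fk] := Foo k; have [mG Gk] := Goo k; split.
  rewrite -[X in measurable X]setTI; apply: measurable_tuple_uncons => //.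
  exact: measurableX.
rewrite /lebesgue_cons /pushforward -comp_preimage (_ : _ \o _ = id); last first.
  exact/funext/tuple_consK.
by rewrite preimage_id product_measure1E// lte_mul_pinfty// ge0_fin_numE.
Qed.

HB.instance Definition _ :=
  Measure_isSigmaFinite.Build _ _ _ lebesgue_cons lebesgue_cons_sigma_finite.

End lebesgue_cons.

Fixpoint lebesgue_Rn {R : realType} (n : nat) :
    {sigma_finite_measure set 'Rn[R]_n -> \bar R} :=
  if n is n'.+1 then lebesgue_cons (lebesgue_Rn n') else \d_([tuple]).
Arguments lebesgue_Rn : clear implicits.

Lemma lebesgue_Rn_box {R : realType} n (A : nat -> set (measurableTypeR R)) :
  (forall i, measurable (A i)) ->
  lebesgue_Rn R n [set t | forall i : 'I_n, A i (tnth t i)] =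
    (\prod_(i < n) lebesgue_measure (A i))%E.
Proof.
elim: n A => [|n IH] A mA.
  by rewrite big_ord0 /= diracE mem_set//=; case.
rewrite big_ord_recl /= /lebesgue_cons /pushforward.
have -> : @tuple_cons R n @^-1` [set t | forall i : 'I_n.+1, A i (tnth t i)] =
  A 0 `*` [set t | forall i : 'I_n, A i.+1 (tnth t i)].
  apply/seteqP; split => -[a t] /=.
    move=> H; split; first by have := H ord0; rewrite tnth0.
    by move=> i; have := H (lift ord0 i); rewrite tnthS.
  move=> [Aa At] i; case: (unliftP ord0 i) => [j ->|->]; rewrite ?tnthS ?tnth0//.
  exact: At.
rewrite product_measure1E//; first by rewrite (IH (fun i => A i.+1)).
rewrite (_ : [set _ | _] = \bigcap_(i in [set: 'I_n])
    ((fun t => tnth t i) @^-1` A i.+1)); last first.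
  by apply/seteqP; split => t /= H i; [move=> _|]; exact: H.
apply: fin_bigcap_measurable; first exact: finite_finset.
move=> i _.
by rewrite -[X in measurable X]setTI; exact: (@measurable_tnth _ _ _ i).
Qed.

Section gibbs.
Context {R : realType}.

(* Sum over D of a real family, as the difference of the sums of its positive
   and negative parts; meaningful when the family is absolutely summable. *)
Definition sum_over (D : set int) (f : int -> R) : R :=
  fine (\esum_(j in D) (f^\+ j)%:E)%E - fine (\esum_(j in D) (f^\- j)%:E)%E.

(* R^L is encoded as R^#|L| through the enumeration of L (Lebesgue measure
   does not depend on it); [spin i] is the coordinate x_i. *)
Definition spin (L : {fset int}) (i : L) (x : 'Rn[R]_#|{: L}|) : R :=
  tnth x (enum_rank i).

(* Boundary values outside L are given by a function on all of int, whose
   values on L are never used. *)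
Definition tempered (M : int -> int -> R) (L : {fset int}) (y : int -> R) :=
  forall i, i \in L ->
    (\esum_(j in ~` [set` L]) (`|M i j| * `|y j|)%:E < +oo)%E.

Definition hamiltonian (psi : int -> R -> R) (M : int -> int -> R)
    (L : {fset int}) (y : int -> R) (x : 'Rn[R]_#|{: L}|) : R :=
  \sum_(i : L) psi (val i) (spin i x)
  + 2^-1 * (\sum_(i : L) \sum_(j : L) M (val i) (val j) * spin i x * spin j x)
  + \sum_(i : L) sum_over (~` [set` L]) (fun j => M (val i) j * spin i x * y j).

Definition partition_function (psi : int -> R -> R) (M : int -> int -> R)
    (L : {fset int}) (y : int -> R) : R :=
  fine (\int[lebesgue_Rn R #|{: L}|]_x (expR (- hamiltonian psi M y x))%:E)%E.

(* [mu] is the probability measure on R^L with Lebesgue density exp(-H)/Z; if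
   the integral of exp(-H) were infinite, [partition_function] would be 0 and
   the density would vanish, so that no probability measure would qualify. *)
Definition gibbs_measure (psi : int -> R -> R) (M : int -> int -> R)
    (L : {fset int}) (y : int -> R) (mu : probability 'Rn[R]_#|{: L}| R) :=
  forall A, measurable A ->
    mu A = (\int[lebesgue_Rn R #|{: L}|]_(x in A)
      (expR (- hamiltonian psi M y x) / partition_function psi M L y)%:E)%E.

End gibbs.

(* Main.v *)
Require Import Defs.
From HB Require Import structures.
From mathcomp Require Import all_boot all_order all_algebra finmap.
From mathcomp Require Import all_classical all_reals all_analysis.
From mathcomp Require Import measurable_realfun.
From mathcomp Require Import zify ring lra.

Import Order.TTheory GRing.Theory Num.Theory.
Import numFieldNormedType.Exports.

Local Open Scope classical_set_scope.
Local Open Scope ring_scope.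

(** Let [u] and [v] be two independent copies of the spins.
    The covariance of [u_i] and [u_j] is half the mean of
    [(u_i - v_i) (u_j - v_j)], and conditionally on the midpoint [(u + v) / 2] the
    half-differences [z = (u - v) / 2] form a system with couplings [M] and even
    one-site potentials, in which neither the boundary values nor the midpoint
    appear as a field ([doubling], [boltzmann_reflect]). Each potential is the sum
    of a function that is nondecreasing in [|z_k|], by convexity, and of a
    perturbation that is bounded and Lipschitz, uniformly in the midpoint. It
    remains to bound the mean of [z_i z_j], uniformly in all such systems.

    Ginibre's method compares two systems. If at each site all the integrals of
    [(x + y) ^ m (x - y) ^ n r1(x) r2(y)] are nonnegative, then a system with
    densities [r2] and couplings [J'] has smaller correlations, in absolute value,
    than one with densities [r1] and couplings [J >= |J'|]
    ([ginibre_comparison]). The density [r1(x) = cosh (c x) exp (- a x ^ 2)], with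
    [c] large, dominates in this sense all the densities that occur
    ([one_site_ge0]), because [cosh (c x)] grows faster than a bounded Lipschitz
    perturbation can vary. Diagonal dominance of [M] leaves room for [a] to exceed
    the sum of [|M_kl|] over [l], so that the dominating system is integrable.

    Since [cosh (c x)] is the mean of [exp (c s x)] over the two values of a spin
    [s], integrating out the Gaussian variables turns the dominating system into
    an Ising model, with couplings proportional to the Green function of a
    diagonally dominant matrix ([isum_gaussJ], [hi_decay]). The Green function
    inherits the decay of [M] ([green_decay]).

    Finally, a one-dimensional Ising model with couplings that decay faster than
    the square of the distance has no phase transition: the total coupling across
    a cut is bounded, so that each of many distant cuts reduces the correlation by
    a fixed factor, up to the contribution of a few long edges ([corr_cuts]).
    Simon's inequality, a consequence of the inequalities of Griffiths and
    Lebowitz ([simon_ineq]), turns this into decay at the rate of the couplings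
    ([ising_decay]). *)

(** * Sums of power-law weights over finite subsets of the line *)

Definition gap (m n : nat) : nat := (m - n + (n - m))%N.

Lemma gapC m n : gap m n = gap n m.
Proof. by rewrite /gap addnC. Qed.

Lemma gap_triangle m n k : (gap m k <= gap m n + gap n k)%N.
Proof. rewrite /gap; lia. Qed.

Section decay.
Context {R : realType}.
Implicit Types p e : R.

(** The shift by one makes the weight submultiplicative in the distance, see
    [decayM_le]; it is comparable to [1 / (d ^ p + 1)]. *)
Definition decay p (d : nat) : R := d.+1%:R `^ (- p).

Lemma decay_gt0 p d : 0 < decay p d.
Proof. by rewrite powR_gt0 ?ltr0n. Qed.

Lemma decay_ge0 p d : 0 <= decay p d. Proof. exact/ltW/decay_gt0. Qed.

Lemma decay0 p : decay p 0 = 1. Proof. by rewrite /decay powR1. Qed.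

Lemma decay_anti p d d' : 0 <= p -> (d <= d')%N -> decay p d' <= decay p d.
Proof.
move=> p0 dd'; rewrite /decay !powRN lef_pV2 ?posrE ?powR_gt0 ?ltr0n//.
by apply: ge0_ler_powR => //; rewrite ?nnegrE ?ler0n// ler_nat.
Qed.

Lemma decayM_le p d d' : 0 <= p -> decay p d * decay p d' <= decay p (d + d').
Proof.
move=> p0; rewrite /decay -powRM ?ler0n// !powRN.
rewrite lef_pV2 ?posrE ?powR_gt0 ?mulr_gt0 ?ltr0n//.
apply: ge0_ler_powR => //; rewrite ?nnegrE ?mulr_ge0 ?ler0n//.
by rewrite -natrM ler_nat mulSn mulnS; lia.
Qed.

Lemma zeta_step e n : 0 < e ->
  e * n.+2%:R `^ (- (1 + e)) <= n.+1%:R `^ (- e) - n.+2%:R `^ (- e).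
Proof.
move=> e0.
have x0 : 0 < n.+2%:R :> R by rewrite ltr0n.
have y0 : 0 < n.+1%:R :> R by rewrite ltr0n.
have -> : n.+2%:R `^ (- (1 + e)) = n.+2%:R^-1 * n.+2%:R `^ (- e).
  by rewrite opprD powRD ?(gt_eqF x0) ?implybT// powR_inv1// ltW.
have -> : n.+1%:R `^ (- e) = n.+2%:R `^ (- e) * (n.+1%:R / n.+2%:R) `^ (- e).
  rewrite -powRM ?divr_ge0 ?ler0n//; congr (_ `^ _).
  by rewrite mulrCA divff ?mulr1// gt_eqF.
suff : e / n.+2%:R <= (n.+1%:R / n.+2%:R) `^ (- e) - 1.
  move=> /(ler_wpM2l (powR_ge0 n.+2%:R (- e))).
  rewrite mulrBr mulr1; apply: le_trans.
  by rewrite le_eqVlt (_ : e * _ = n.+2%:R `^ (- e) * (e / n.+2%:R)) ?eqxx//; ring.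
set q := _ / _; have q0 : 0 < q by rewrite divr_gt0.
rewrite /powR gt_eqF// lerBrDl (le_trans _ (expR_ge1Dx _))// lerD2l.
rewrite mulNr -mulrN ler_pM2l//.
have h : ln q <= q - 1.
  by have := @le_ln1Dx R (q - 1); rewrite [1 + _]addrC subrK; apply; lra.
suff -> : n.+2%:R^-1 = 1 - q by lra.
rewrite /q -(natr1 n.+1); move: y0; move: (n.+1%:R) => y y0.
by field; rewrite gt_eqF// addr_gt0.
Qed.

(** Compare with the telescoping sum of [n ^ (- e)]. *)
Lemma zeta_sum e n : 0 < e -> \sum_(m < n) decay (1 + e) m <= 1 + e^-1.
Proof.
move=> e0; case: n => [|n]; first by rewrite big_ord0 addr_ge0 ?invr_ge0 ?ltW.
suff : \sum_(m < n.+1) decay (1 + e) m <= 1 + e^-1 * (1 - n.+1%:R `^ (- e)).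
  move/le_trans; apply; rewrite lerD2l ler_piMr ?invr_ge0 ?(ltW e0)//.
elim: n => [|n IH].
  by rewrite big_ord_recl big_ord0 decay0 powR1 subrr mulr0.
rewrite big_ord_recr /= (le_trans (lerD IH (lexx _)))// -addrA lerD2l.
have : decay (1 + e) n.+1 <= e^-1 * (n.+1%:R `^ (- e) - n.+2%:R `^ (- e)).
  by rewrite ler_pdivlMl// zeta_step.
by rewrite !mulrBr; lra.
Qed.

Lemma fibre_sum (T : finType) (P : pred T) (f : T -> nat) (F : nat -> R)
    (k : nat) (z : R) :
  (forall m, 0 <= F m) ->
  (forall m : nat, (#|[pred a | P a & f a == m]| <= k)%N) ->
  (forall n, \sum_(m < n) F m <= z) ->
  \sum_(a | P a) F (f a) <= k%:R * z.
Proof.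
move=> F0 fk Fz; pose N := \max_a f a.
have fN a : (f a < N.+1)%N by rewrite ltnS leq_bigmax.
rewrite (partition_big (fun a => Ordinal (fN a)) xpredT)//=.
apply: (@le_trans _ _ (\sum_(m < N.+1) k%:R * F m)); last first.
  by rewrite -mulr_sumr ler_wpM2l ?ler0n.
apply: ler_sum => m _.
rewrite (eq_bigr (fun=> F m)); last by move=> a /andP[_ /eqP <-].
rewrite sumr_const -[leLHS]mulr_natl ler_wpM2r// ler_nat.
apply: leq_trans (fk m); apply: subset_leq_card; apply/fintype.subsetP => a.
by rewrite !inE => /andP[-> /eqP <-] /=.
Qed.

Section positions.
Context (T : finType) (pos : T -> nat).
Hypothesis pos3 : forall m : nat, (#|[pred a | pos a == m]| <= 3)%N.

Let fibre3 (P : pred T) (f : T -> nat) (h : nat -> nat) :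
  (forall a, P a -> pos a = h (f a)) ->
  forall m : nat, (#|[pred a | P a & f a == m]| <= 3)%N.
Proof.
move=> fh m; apply: leq_trans (pos3 (h m)); apply: subset_leq_card.
by apply/fintype.subsetP => a; rewrite !inE => /andP[Pa /eqP <-]; rewrite fh.
Qed.

Lemma decay_sum e x : 0 < e ->
  \sum_b decay (1 + e) (gap x (pos b)) <= 6 * (1 + e^-1).
Proof.
move=> e0; rewrite (bigID (fun b => pos b <= x)%N)/=.
have -> : 6 * (1 + e^-1) = 3%:R * (1 + e^-1) + 3%:R * (1 + e^-1) by lra.
apply: lerD; apply: fibre_sum => [m|m|n]; rewrite ?decay_ge0 ?zeta_sum//.
- by apply: (fibre3 _ _ (fun d => x - d)%N) => a; rewrite /gap; lia.
- by apply: (fibre3 _ _ (fun d => x + d)%N) => a; rewrite /gap; lia.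
Qed.

Lemma ball_card (x D : nat) : (#|[pred a | gap x (pos a) <= D]| <= 6 * D.+1)%N.
Proof.
rewrite -sum1_card -(ler_nat R) natr_sum.
rewrite (bigID (fun b => pos b <= x)%N)/=.
have -> : (6 * D.+1)%:R = 3%:R * D.+1%:R + 3%:R * D.+1%:R :> R.
  by rewrite -natrM -natrD; congr (_%:R); lia.
pose F d : R := (d <= D)%N%:R.
have Fs n : \sum_(m < n) F m <= D.+1%:R.
  have -> : \sum_(m < n) F m = (minn n D.+1)%:R.
    elim: n => [|n IH]; first by rewrite big_ord0 min0n.
    by rewrite big_ord_recr /= IH /F -natrD; congr (_%:R); case: (leqP n D); lia.
  by rewrite ler_nat geq_minr.
have H (P : pred T) h : (forall a, P a -> pos a = h (gap x (pos a))) ->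
    \sum_(i | (i \in [pred a | (gap x (pos a) <= D)%N]) && P i) 1%:R
      <= 3%:R * D.+1%:R :> R.
  move=> Ph; rewrite [leLHS](_ : _ = \sum_(i | P i) F (gap x (pos i))).
    by apply: fibre_sum => [m|m|n]; rewrite ?ler0n ?Fs//; exact: (fibre3 _ _ h).
  rewrite big_mkcondl/=; apply: eq_bigr => i _.
  by rewrite inE /F; case: leqP.
apply: lerD.
- by apply: (H _ (fun d => x - d)%N) => a; rewrite /gap; lia.
- by apply: (H _ (fun d => x + d)%N) => a; rewrite /gap; lia.
Qed.

(** Across a cut, with [m] and [n] the distances of the end points to the cut,
    [(m + n) ^ 2 >= m n] separates the double sum into a product; the exponent
    that is spared pays for the length [l]. *)
Lemma cut_sum e z l : 0 < e ->
  \sum_(a | (pos a <= z)%N)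
    \sum_(b | (z < pos b)%N && (l <= gap (pos a) (pos b))%N)
      decay (2 + 4 * e) (gap (pos a) (pos b))
  <= (3 * (1 + e^-1)) ^+ 2 * decay (2 * e) l.
Proof.
move=> e0; pose F (m : nat) := decay (1 + e) m.
pose zt : R := 3%:R * (1 + e^-1).
apply: (@le_trans _ _ (\sum_(a | (pos a <= z)%N) F (z - pos a)%N *
    (\sum_(b | (z < pos b)%N) F (pos b - z.+1)%N) * decay (2 * e) l)).
  apply: ler_sum => a az; rewrite -mulrA mulr_suml mulr_sumr big_mkcondr/=.
  apply: ler_sum => b zb; case: ifP => [lab|_]; last first.
    by rewrite !mulr_ge0 ?decay_ge0.
  set d := gap _ _ in lab *.
  have -> : decay (2 + 4 * e) d = decay (2 * (1 + e)) d * decay (2 * e) d.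
    rewrite /decay -powRD ?pnatr_eq0 ?implybT//; congr (_ `^ _); ring.
  rewrite [leRHS]mulrA; apply: ler_pM; rewrite ?decay_ge0//; last first.
    by rewrite decay_anti// mulr_ge0// ltW.
  rewrite /F /decay -powRM ?ler0n// !powRN.
  rewrite lef_pV2 ?posrE ?powR_gt0 ?mulr_gt0 ?ltr0n//.
  rewrite [leRHS]powRrM powR_mulrn ?ler0n//.
  apply: ge0_ler_powR; rewrite ?nnegrE ?mulr_ge0 ?exprn_ge0 ?ler0n//; first by lra.
  by rewrite -natrM -natrX ler_nat /d /gap; nia.
rewrite -mulr_suml ler_wpM2r ?decay_ge0// -mulr_suml expr2.
have zs : forall n, \sum_(m < n) F m <= 1 + e^-1 by move=> n; exact: zeta_sum.
have F0 m : 0 <= F m by exact: decay_ge0.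
apply: ler_pM; rewrite ?sumr_ge0//.
- by apply: fibre_sum => //; apply: (fibre3 _ _ (fun d => z - d)%N) => a; lia.
- by apply: fibre_sum => //; apply: (fibre3 _ _ (fun d => z.+1 + d)%N) => a; lia.
Qed.

End positions.
End decay.

Lemma gap_triangleR (R : numDomainType) m n k :
  (gap m k).+1%:R <= (gap m n).+1%:R + (gap n k).+1%:R - 1 :> R.
Proof.
by rewrite lerBrDr natr1 -natrD ler_nat; have := gap_triangle m n k; lia.
Qed.

(** A sub-Markovian kernel with power-law tails has a resolvent with the same
    tails. Summability of [u] comes first, from the contraction alone. For the
    decay, jumps [i -> k] much shorter than the distance from [i] to [j] lose
    only a factor [q ^ (- p)] close to one, which the contraction absorbs;
    longer ones carry the decay themselves. *)
Lemma resolvent_decay (R : realType) (theta p Ka Kk z : R) :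
  0 < theta -> theta < 1 -> 0 < p -> 0 <= Ka -> 0 <= Kk -> 0 <= z ->
  exists2 C : R, 0 <= C &
  forall (T : finType) (pos : T -> nat) (u a K : T -> T -> R),
    let h i j := decay p (gap (pos i) (pos j)) in
    (forall i, \sum_j h i j <= z) ->
    (forall i j, 0 <= u i j) -> (forall i j, u i j = u j i) ->
    (forall i j, 0 <= K i j) -> (forall i, \sum_k K i k <= theta) ->
    (forall i j, K i j <= Kk * h i j) -> (forall i j, a i j <= Ka * h i j) ->
    (forall i j, u i j <= a i j + \sum_k K i k * u k j) ->
    forall i j, u i j <= C * h i j.
Proof.
move=> th0 th1 p0 Ka0 Kk0 z0.
(* Any [r > 1] with [theta * r < 1] would do; [decay] grows by the factor [r] when
   distances shrink by the factor [q]. *)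
pose r := (1 + theta) / (2 * theta).
have r1 : 1 < r by rewrite ltr_pdivlMr ?mulr_gt0//; lra.
have r0 : 0 < r by lra.
have thr : theta * r = (1 + theta) / 2.
  by rewrite /r; field; rewrite gt_eqF.
clearbody r.
pose q := r `^ (- p^-1).
have q0 : 0 < q by rewrite powR_gt0.
have q1 : q < 1.
  rewrite /q /powR gt_eqF// expR_lt1 mulNr oppr_lt0 mulr_gt0 ?invr_gt0 ?ln_gt0//.
have qp : q `^ (- p) = r.
  by rewrite /q -powRrM mulNr mulrN opprK mulVf ?gt_eqF// powRr1// ltW.
pose chi := Ka * z / (1 - theta).
have chi0 : 0 <= chi by rewrite divr_ge0 ?mulr_ge0//; lra.
pose C := 2 / (1 - theta) * (Ka + Kk * (1 - q) `^ (- p) * chi).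
exists C; first by rewrite !mulr_ge0 ?addr_ge0 ?mulr_ge0 ?powR_ge0//; rewrite ?invr_ge0; lra.
move=> T pos u a K h hz u0 uC K0 Kth Kh ah uK.
have h0 i j : 0 < h i j by exact: decay_gt0.
have uchi i : \sum_j u i j <= chi.
  pose X := \big[Num.max/0]_i \sum_j u i j.
  have X0 : 0 <= X by apply: bigmax_ge_id.
  have uX k : \sum_j u k j <= X by apply: le_bigmax.
  apply: le_trans (uX i) _; rewrite ler_pdivlMr; last lra.
  suff : X <= Ka * z + theta * X by rewrite mulrBr mulr1 [X * _]mulrC; lra.
  apply: bigmax_le => [|k _]; first by rewrite addr_ge0 ?mulr_ge0// ltW.
  apply: (@le_trans _ _ (\sum_j (Ka * h k j + \sum_l K k l * u l j))).
    by apply: ler_sum => j _; apply: le_trans (uK k j) _; rewrite lerD2r.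
  rewrite big_split/= -mulr_sumr; apply: lerD; first by rewrite ler_wpM2l.
  rewrite exchange_big/= (@le_trans _ _ (\sum_l K k l * X))//.
    by apply: ler_sum => l _; rewrite -mulr_sumr ler_wpM2l.
  by rewrite -mulr_suml ler_wpM2r.
(* The best constant for this particular set, finite because the set is; [step]
   bounds it uniformly. *)
pose m := \big[Num.max/0]_ij (u ij.1 ij.2 / h ij.1 ij.2).
have m0 : 0 <= m by apply: bigmax_ge_id.
have um i j : u i j <= m * h i j.
  rewrite -ler_pdivrMr//.
  exact: (@le_bigmax _ _ _ 0 (fun ij => u ij.1 ij.2 / h ij.1 ij.2) (i, j)).
suff mC : m <= C by move=> i j; apply: le_trans (um i j) _; rewrite ler_wpM2r// ltW.
suff step i j : u i j <= (Ka + Kk * (1 - q) `^ (- p) * chi + theta * r * m) * h i j.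
  suff : m <= Ka + Kk * (1 - q) `^ (- p) * chi + theta * r * m.
    rewrite thr => hm; rewrite /C mulrAC ler_pdivlMr; last lra.
    by move: hm; set A := Ka + _; lra.
  apply: bigmax_le => [|[i j] _]/=; last by rewrite ler_pdivrMr.
  apply: addr_ge0; last by apply: mulr_ge0 => //; apply: mulr_ge0; exact: ltW.
  by apply: addr_ge0 => //; apply: mulr_ge0 => //; apply: mulr_ge0 => //; exact: powR_ge0.
apply: le_trans (uK i j) _; rewrite mulrDl mulrDl -addrA; apply: lerD => //.
pose D : R := (gap (pos i) (pos j)).+1%:R.
have D0 : 0 < D by rewrite ltr0n.
rewrite (bigID (fun k => (gap (pos i) (pos k)).+1%:R <= (1 - q) * D))/= addrC.
apply: lerD.
- apply: (@le_trans _ _ (\sum_k Kk * (1 - q) `^ (- p) * h i j * u k j)).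
    rewrite big_mkcond; apply: ler_sum => k _; case: ifPn => [|_]; last first.
      by rewrite !mulr_ge0 ?powR_ge0 ?decay_ge0.
    rewrite -ltNge => far; rewrite ler_wpM2r// (le_trans (Kh i k))//.
    rewrite -mulrA ler_wpM2l// /h /decay -powRM ?ler0n//; last lra.
    rewrite !powRN lef_pV2 ?posrE ?powR_gt0 ?mulr_gt0 ?ltr0n//; last lra.
    by rewrite ge0_ler_powR ?nnegrE ?mulr_ge0// ?ltW//; lra.
  rewrite -mulr_sumr mulrAC ler_wpM2r ?decay_ge0//.
  rewrite ler_wpM2l ?mulr_ge0 ?powR_ge0//.
  by under eq_bigr do rewrite uC.
- apply: (@le_trans _ _ (\sum_k K i k * (r * m * h i j))); last first.
    rewrite -mulr_suml -!mulrA ler_wpM2r// !mulr_ge0 ?decay_ge0// ltW//.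
  rewrite big_mkcond; apply: ler_sum => k _; case: ifPn => [near|_]; last first.
    by rewrite !mulr_ge0 ?decay_ge0// ltW.
  rewrite ler_wpM2l// (le_trans (um k j))// [r * m]mulrC -mulrA ler_wpM2l//.
  rewrite /h /decay -qp -powRM ?ler0n ?(ltW q0)//.
  rewrite !powRN lef_pV2 ?posrE ?powR_gt0 ?mulr_gt0 ?ltr0n//.
  rewrite ge0_ler_powR ?nnegrE ?mulr_ge0 ?ler0n ?(ltW p0) ?(ltW q0)//.
  have : D <= (gap (pos i) (pos k)).+1%:R + (gap (pos k) (pos j)).+1%:R - 1.
    exact: gap_triangleR.
  rewrite -/D; move: near; rewrite mulrBl mul1r.
  set x := _.+1%:R; set y := _.+1%:R; lra.
Qed.

(** * Power series with nonnegative coefficients and Ginibre positivity *)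

Definition exp_partial {R : realType} n (x : R) := \sum_(k < n) x ^+ k / k`!%:R.

Section exp_partial.
Context {R : realType}.
Implicit Type x : R.

Lemma exp_partial_cvg x : exp_partial^~ x @ \oo --> expR x.
Proof.
rewrite (_ : exp_partial^~ x = series (exp_coeff x)).
  exact: is_cvg_series_exp_coeff.
by apply/funext => n; rewrite /series/= big_mkord.
Qed.

Lemma exp_partial_le x n : 0 <= x -> exp_partial n x <= expR x.
Proof.
move=> x0; apply: (cvgr_to_ge (exp_partial_cvg x)); near=> m.
have nm : (n <= m)%N by near: m; exists n.
rewrite /exp_partial -(subnKC nm) big_split_ord/= lerDl sumr_ge0// => i _.
by rewrite divr_ge0 ?exprn_ge0.
Unshelve. all: by end_near. Qed.

Lemma norm_exp_partial_le x n : `|exp_partial n x| <= expR `|x|.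
Proof.
apply: le_trans (@exp_partial_le _ n (normr_ge0 x)).
apply: le_trans (ler_norm_sum _ _ _) _; apply: ler_sum => i _.
by rewrite normrM normrX (ger0_norm (_ : 0 <= _^-1)) ?invr_ge0.
Qed.

End exp_partial.

Section poscone.
Context {R : realType} {W : Type} {S : finType} (phi : S -> W -> R).

Definition monom (e : {ffun S -> nat}) (w : W) := \prod_s phi s w ^+ e s.

(** A class closed under sums, products and exponentials, whose members have
    nonnegative integrals as soon as all moments of the generators [phi] do. *)
Definition poscone (F : W -> R) := exists r : seq (R * {ffun S -> nat}),
  all (fun t => (0 : R) <= t.1) r /\ forall w, F w = \sum_(t <- r) t.1 * monom t.2 w.

Lemma poscone_ext F G : (forall w, F w = G w) -> poscone F -> poscone G.
Proof. by move=> FG [r [r0 Fr]]; exists r; split=> // w; rewrite -FG. Qed.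

Lemma poscone0 : poscone (fun=> 0).
Proof. by exists [::]; split=> // w; rewrite big_nil. Qed.

Lemma posconeD F G : poscone F -> poscone G -> poscone (fun w => F w + G w).
Proof.
move=> [r [r0 Fr]] [s [s0 Gs]]; exists (r ++ s); rewrite all_cat r0; split=> // w.
by rewrite big_cat/= -Fr -Gs.
Qed.

Lemma poscone_sum I (r : seq I) (P : pred I) (F : I -> W -> R) :
  (forall i, P i -> poscone (F i)) ->
  poscone (fun w => \sum_(i <- r | P i) F i w).
Proof.
move=> FP; elim: r => [|i r IH].
  by apply: poscone_ext poscone0 => w; rewrite big_nil.
case Pi : (P i); last by apply: poscone_ext IH => w; rewrite big_cons Pi.
by apply: poscone_ext (posconeD _ _ (FP i Pi) IH) => w; rewrite big_cons Pi.
Qed.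

Lemma monomM e f w :
  monom e w * monom f w = monom [ffun s => (e s + f s)%N] w.
Proof.
by rewrite /monom -big_split/=; apply: eq_bigr => s _; rewrite ffunE exprD.
Qed.

Lemma posconeM F G : poscone F -> poscone G -> poscone (fun w => F w * G w).
Proof.
move=> [r [r0 Fr]] [s [s0 Gs]].
exists [seq (t.1 * u.1, [ffun x => (t.2 x + u.2 x)%N])
  | t : R * {ffun S -> nat} <- r, u : R * {ffun S -> nat} <- s].
split=> [|w].
  apply/allP => _ /allpairsP[[t u] [/= tr us ->]]/=.
  by rewrite mulr_ge0//; [exact: (allP r0)|exact: (allP s0)].
rewrite Fr Gs big_allpairs_dep/= mulr_suml; apply: eq_bigr => t _.
by rewrite mulr_sumr; apply: eq_bigr => u _; rewrite mulrACA monomM.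
Qed.

Lemma poscone_cst c : 0 <= c -> poscone (fun=> c).
Proof.
move=> c0; exists [:: (c, [ffun=> 0%N])]; rewrite /= c0; split=> // w.
by rewrite big_seq1 /monom big1 ?mulr1// => s _; rewrite ffunE.
Qed.

Lemma poscone_gen s : poscone (phi s).
Proof.
exists [:: (1, [ffun t => (t == s : nat)])]; rewrite /= ler01; split=> // w.
rewrite big_seq1 /monom mul1r (bigD1 s)//= ffunE eqxx expr1 big1 ?mulr1// => t ts.
by rewrite ffunE (negbTE ts).
Qed.

Lemma posconeX F n : poscone F -> poscone (fun w => F w ^+ n).
Proof.
move=> PF; elim: n => [|n IH]; first exact: poscone_cst.
by apply: poscone_ext (posconeM _ _ PF IH) => w; rewrite exprS.
Qed.

Lemma poscone_exp_partial F n : poscone F ->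
  poscone (fun w => exp_partial n (F w)).
Proof.
move=> PF; apply: poscone_sum => k _; apply: posconeM; first exact: posconeX.
by apply: poscone_cst; rewrite invr_ge0.
Qed.

End poscone.

Lemma cvgn_sum {R : realType} (I : Type) (r : seq I) (f : I -> R^nat) (l : I -> R) :
  (forall i, f i @ \oo --> l i) ->
  (fun n => \sum_(i <- r) f i n) @ \oo --> \sum_(i <- r) l i.
Proof.
move=> fl; elim: r => [|i r IH].
  rewrite big_nil (_ : (fun n => _) = fun=> 0); first exact: cvg_cst.
  by apply/funext => n; rewrite big_nil.
rewrite big_cons (_ : (fun n => _) = (fun n => f i n + \sum_(j <- r) f j n)).
  exact: cvgD.
by apply/funext => n; rewrite big_cons.
Qed.

(** Since [exp Q] is a power series with nonnegative coefficients, positivity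
    reduces to monomials, and there the sum factorizes over the sites. *)
Lemma ginibre_fin {R : realType} (T X C : finType) (phi0 : C -> X -> R) :
  (forall e : {ffun C -> nat}, 0 <= \sum_x \prod_c phi0 c x ^+ e c) ->
  let phi (s : T * C) (w : {ffun T -> X}) := phi0 s.2 (w s.1) in
  forall F Q, poscone phi F -> poscone phi Q ->
  0 <= \sum_w F w * expR (Q w).
Proof.
move=> phi0_ge0 phi F Q PF PQ.
suff H n : 0 <= \sum_w F w * exp_partial n (Q w).
  have: (fun n => \sum_w F w * exp_partial n (Q w)) @ \oo -->
      \sum_w F w * expR (Q w).
    by apply: cvgn_sum => w; apply: cvgMr; exact: exp_partial_cvg.
  by move/cvgr_to_ge; apply; near=> n.
have /posconeM/(_ (poscone_exp_partial _ _ n PQ)) [r [r0 Fr]] := PF.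
under eq_bigr do rewrite Fr.
rewrite exchange_big/= big_seq sumr_ge0// => t tr.
rewrite -mulr_sumr mulr_ge0//; first exact: (allP r0).
rewrite (eq_bigr (fun w : {ffun T -> X} =>
    \prod_i \prod_c phi0 c (w i) ^+ t.2 (i, c))); last first.
  move=> w _; rewrite /monom pair_bigA/=.
  by apply: eq_bigr => -[].
rewrite -(bigA_distr_bigA (fun i x => \prod_c phi0 c x ^+ t.2 (i, c))).
apply: prodr_ge0 => i _.
apply: le_trans (phi0_ge0 [ffun c => t.2 (i, c)]) _; apply: ler_sum => x _.
by rewrite le_eqVlt; apply/orP; left; apply/eqP/eq_bigr => c _; rewrite ffunE.
Unshelve. all: by end_near. Qed.

(** * Correlation inequalities for ferromagnetic Ising models *)

Section spin_values.
Context {R : realType}.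

Definition sg (b : bool) : R := (-1) ^+ b.

Lemma sgN b : sg (~~ b) = - sg b.
Proof. by case: b; rewrite /sg/= ?expr0 ?expr1 ?opprK. Qed.

Lemma sg_sqr b : sg b * sg b = 1.
Proof. by case: b; rewrite /sg/= ?expr0 ?expr1 ?mulrNN mulr1. Qed.

Lemma norm_sg b : `|sg b| = 1.
Proof. by rewrite /sg normrX normrN1 expr1n. Qed.

End spin_values.

Lemma sum_ffun_pair {R : nmodType} (T A B : finType)
    (G : {ffun T -> A} -> {ffun T -> B} -> R) :
  \sum_(w : {ffun T -> A * B}) G [ffun t => (w t).1] [ffun t => (w t).2] =
  \sum_x \sum_y G x y.
Proof.
rewrite pair_bigA/=.
rewrite (reindex (fun p : {ffun T -> A} * {ffun T -> B} =>
    [ffun t => (p.1 t, p.2 t)])) /=.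
  apply: eq_bigr => -[x y] _ /=.
  by congr G; apply/ffunP => t; rewrite !ffunE.
exists (fun w : {ffun T -> A * B} => ([ffun t => (w t).1], [ffun t => (w t).2])).
  by move=> [x y] _; congr (_, _); apply/ffunP => t; rewrite !ffunE.
by move=> w _; apply/ffunP => t; rewrite !ffunE -surjective_pairing.
Qed.

Lemma sum_bilin {R : comPzRingType} (A B : finType) (wA : A -> R) (wB : B -> R)
    (ms : seq ((A -> R) * (B -> R))) (F : A -> B -> R) :
  (forall a b, F a b = \sum_(m <- ms) m.1 a * m.2 b) ->
  \sum_a \sum_b F a b * (wA a * wB b) =
  \sum_(m <- ms) (\sum_a m.1 a * wA a) * (\sum_b m.2 b * wB b).
Proof.
move=> FE; transitivity (\sum_a \sum_b \sum_(m <- ms) (m.1 a * wA a) * (m.2 b * wB b)).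
  apply: eq_bigr => a _; apply: eq_bigr => b _; rewrite FE mulr_suml.
  by apply: eq_bigr => m _; rewrite mulrACA.
under eq_bigr do rewrite exchange_big/=.
rewrite exchange_big/=; apply: eq_bigr => m _; rewrite mulr_suml.
by apply: eq_bigr => a _; rewrite mulr_sumr.
Qed.

Section ising.
Context {R : realType} {T : finType}.
Implicit Types (J : T -> T -> R) (s : seq (T * T)) (v : T -> R).
Local Notation conf := {ffun T -> bool}.
Local Notation conf2 := {ffun T -> bool * bool}.

(** The couplings sit on a list of edges, so that an interaction can be built
    up one edge at a time. *)
Definition energy J s v := \sum_(e <- s) J e.1 e.2 * (v e.1 * v e.2).

Definition spins (x : conf) (t : T) : R := sg (x t).

Definition isum J s (f : (T -> R) -> R) :=
  \sum_(x : conf) f (spins x) * expR (energy J s (spins x)).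

Definition corr J s i j := isum J s (fun v => v i * v j) / isum J s (fun=> 1).

Lemma isum1_gt0 J s : 0 < isum J s (fun=> 1).
Proof.
rewrite /isum (bigD1 [ffun=> true])//= ltr_wpDr//; last by rewrite mul1r expR_gt0.
by apply: sumr_ge0 => x _; rewrite mul1r expR_ge0.
Qed.

Lemma energyN J s v : energy J s (fun t => - v t) = energy J s v.
Proof. by apply: eq_bigr => e _; rewrite mulrNN. Qed.

Lemma corrC J s i j : corr J s i j = corr J s j i.
Proof.
by rewrite /corr; congr (_ / _); apply: eq_bigr => x _; rewrite [X in X * _]mulrC.
Qed.

Lemma corr_le1 J s i j : `|corr J s i j| <= 1.
Proof.
have Z0 := isum1_gt0 J s.
rewrite normrM normfV (gtr0_norm Z0) ler_pdivrMr// mul1r.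
apply: le_trans (ler_norm_sum _ _ _) _; apply: ler_sum => x _.
by rewrite !normrM !norm_sg !mul1r ger0_norm ?expR_ge0.
Qed.

Lemma gks1 J s i j : (forall a b, 0 <= J a b) ->
  0 <= isum J s (fun v => v i * v j).
Proof.
move=> J0.
apply: (@ginibre_fin R T bool unit (fun=> sg) _
  (fun x => spins x i * spins x j) (fun x => energy J s (spins x))).
- move=> e; have E x : \prod_c (sg x : R) ^+ e c = sg x ^+ e tt.
    by rewrite (bigD1 tt)//= big1 ?mulr1// => -[].
  rewrite big_bool/= !E /sg expr1 expr0 expr1n -signr_odd.
  by case: (odd _); rewrite ?expr1 ?expr0; lra.
- by apply: posconeM; exact: (@poscone_gen _ _ _ _ (_, tt)).
- apply: poscone_sum => e _; apply: posconeM; first exact: poscone_cst.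
  by apply: posconeM; exact: (@poscone_gen _ _ _ _ (_, tt)).
Qed.

Lemma corr_ge0 J s i j : (forall a b, 0 <= J a b) -> 0 <= corr J s i j.
Proof. by move=> J0; rewrite divr_ge0 ?gks1// ltW ?isum1_gt0. Qed.

(** ** Two copies *)

Definition copy1 (p : conf2) (t : T) : R := sg (p t).1.
Definition copy2 (p : conf2) (t : T) : R := sg (p t).2.

Definition weight2 J s (p : conf2) :=
  expR (energy J s (copy1 p)) * expR (energy J s (copy2 p)).

Definition isum2 J s (f : (T -> R) -> (T -> R) -> R) :=
  \sum_p f (copy1 p) (copy2 p) * weight2 J s p.

Lemma isum2_bilin J s (ms : seq (((T -> R) -> R) * ((T -> R) -> R))) f :
  (forall v w, f v w = \sum_(m <- ms) m.1 v * m.2 w) ->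
  isum2 J s f = \sum_(m <- ms) isum J s m.1 * isum J s m.2.
Proof.
move=> fE; rewrite /isum2.
pose G (x y : conf) := f (spins x) (spins y) *
  (expR (energy J s (spins x)) * expR (energy J s (spins y))).
transitivity (\sum_(p : conf2) G [ffun t => (p t).1] [ffun t => (p t).2]).
  apply: eq_bigr => p _; rewrite /G /weight2.
  by congr (f _ _ * (expR (energy J s _) * expR (energy J s _)));
    apply/funext => t; rewrite /spins ffunE.
rewrite sum_ffun_pair /G.
rewrite (@sum_bilin _ _ _ _ _ [seq (m.1 \o spins, m.2 \o spins) | m <- ms])/=.
  by rewrite big_map.
by move=> x y; rewrite big_map fE.
Qed.

Lemma isum2_flip1 J s f : isum2 J s f = isum2 J s (fun v w => f (fun t => - v t) w).
Proof.
rewrite /isum2 (reindex_inj (h := fun p : conf2 => [ffun t => (~~ (p t).1, (p t).2)])).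
  apply: eq_bigr => p _; rewrite /weight2 -(energyN J s (copy1 p)).
  congr (f _ _ * (expR (energy J s _) * expR (energy J s _)));
    by apply/funext => t; rewrite /copy1 /copy2 ffunE/= ?sgN.
by apply: (can_inj (g := fun p : conf2 => [ffun t => (~~ (p t).1, (p t).2)])) => p;
  apply/ffunP => t; rewrite !ffunE/= negbK -surjective_pairing.
Qed.

Lemma isum2_swap J s f : isum2 J s f = isum2 J s (fun v w => f w v).
Proof.
rewrite /isum2 (reindex_inj (h := fun p : conf2 => [ffun t => ((p t).2, (p t).1)])).
  apply: eq_bigr => p _; rewrite /weight2 [X in _ * X = _]mulrC.
  by congr (f _ _ * (expR (energy J s _) * expR (energy J s _)));
    apply/funext => t; rewrite /copy1 /copy2 ffunE.
by apply: (can_inj (g := fun p : conf2 => [ffun t => ((p t).2, (p t).1)])) => p;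
  apply/ffunP => t; rewrite !ffunE/= -surjective_pairing.
Qed.

Lemma isum2_flip2 J s f : isum2 J s f = isum2 J s (fun v w => f v (fun t => - w t)).
Proof. by rewrite isum2_swap isum2_flip1 isum2_swap. Qed.

Lemma isum2D J s f g :
  isum2 J s (fun v w => f v w + g v w) = isum2 J s f + isum2 J s g.
Proof. by rewrite -big_split/=; apply: eq_bigr => p _; rewrite mulrDl. Qed.

Lemma isum2_ext J s f g : (forall v w, f v w = g v w) -> isum2 J s f = isum2 J s g.
Proof. by move=> fg; apply: eq_bigr => p _; rewrite fg. Qed.

(** In the variables [v + w] and [v - w] the weight of two independent copies is
    again ferromagnetic, and at each site one of them vanishes. *)
Lemma gks2 J s i j a b : (forall a b, 0 <= J a b) ->
  isum J s (fun v => v i * v j) * isum J s (fun v => v a * v b) <=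
  isum J s (fun v => (v i * v j) * (v a * v b)) * isum J s (fun=> 1).
Proof.
move=> J0.
pose phi (c : bool) (x : bool * bool) : R := sg x.1 + sg c * sg x.2.
pose F (p : conf2) := (copy1 p i * copy1 p j - copy2 p i * copy2 p j) *
  (copy1 p a * copy1 p b - copy2 p a * copy2 p b).
pose Q (p : conf2) := energy J s (copy1 p) + energy J s (copy2 p).
pose Phi (k : T * bool) (w : conf2) := phi k.2 (w k.1).
have PhiE c t (p : conf2) : Phi (t, c) p = copy1 p t + sg c * copy2 p t by [].
have sgf : sg false = 1 :> R by rewrite /sg expr0.
have sgt : sg true = - 1 :> R by rewrite /sg expr1.
have half0 : 0 <= 2^-1 :> R by rewrite invr_ge0.
have Pdiff t u : poscone Phi (fun p => copy1 p t * copy1 p u - copy2 p t * copy2 p u).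
  have P1 := posconeM _ _ _ (@poscone_gen R _ _ Phi (t, false)) (@poscone_gen R _ _ Phi (u, true)).
  have P2 := posconeM _ _ _ (@poscone_gen R _ _ Phi (t, true)) (@poscone_gen R _ _ Phi (u, false)).
  apply: poscone_ext (posconeM _ _ _ (poscone_cst _ _ half0) (posconeD _ _ _ P1 P2)).
  by move=> p; rewrite !PhiE sgf sgt; field.
have Psum t u : poscone Phi (fun p => copy1 p t * copy1 p u + copy2 p t * copy2 p u).
  have P1 := posconeM _ _ _ (@poscone_gen R _ _ Phi (t, false)) (@poscone_gen R _ _ Phi (u, false)).
  have P2 := posconeM _ _ _ (@poscone_gen R _ _ Phi (t, true)) (@poscone_gen R _ _ Phi (u, true)).
  apply: poscone_ext (posconeM _ _ _ (poscone_cst _ _ half0) (posconeD _ _ _ P1 P2)).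
  by move=> p; rewrite !PhiE sgf sgt; field.
have : 0 <= \sum_p F p * expR (Q p).
  apply: (@ginibre_fin R T (bool * bool)%type bool phi).
  - move=> e; rewrite -(pair_bigA _ (fun x y => \prod_c phi c (x, y) ^+ e c))/=.
    rewrite !big_bool /phi/= !sgf !sgt !mulN1r !mul1r opprK !subrr !addNr.
    have par (n : nat) : 0 <= ((-1 - 1) ^+ n + (1 + 1) ^+ n : R).
      rewrite (_ : -1 - 1 = -1 * (1 + 1) :> R); last by ring.
      rewrite exprMn -signr_odd; case: (odd n); first by rewrite expr1 mulN1r addNr.
      by rewrite expr0 mul1r; apply: addr_ge0; apply: exprn_ge0; lra.
    have z0 (n : nat) : 0 <= (0 : R) ^+ n by rewrite exprn_ge0.
    have := mulr_ge0 (z0 (e true)) (par (e false)).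
    have := mulr_ge0 (z0 (e false)) (par (e true)).
    rewrite !mulrDr; rewrite !(addrC 1) -?opprD; lra.
  - exact: posconeM (Pdiff i j) (Pdiff a b).
  - apply: (@poscone_ext _ _ _ _ (fun p => \sum_(e <- s) J e.1 e.2 *
        (copy1 p e.1 * copy1 p e.2 + copy2 p e.1 * copy2 p e.2))).
      by move=> p; rewrite /Q /energy -big_split/=; apply: eq_bigr => e _; rewrite mulrDr.
    by apply: poscone_sum => e _; apply: posconeM (Psum _ _); exact: poscone_cst.
pose f v := v i * v j; pose g v := v a * v b.
have -> : \sum_p F p * expR (Q p) =
    isum2 J s (fun v w : T -> R => (f v - f w) * (g v - g w)).
  by apply: eq_bigr => p _; rewrite /Q expRD.
rewrite (@isum2_bilin J s [:: (fun v => f v * g v, fun=> 1);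
   (fun=> 1, fun v => f v * g v); (fun v => - f v, g); (fun v => - g v, f)]).
  rewrite !big_cons big_nil /= -/f -/g.
  have N h : isum J s (fun v => - h v) = - isum J s h.
    by rewrite /isum -sumrN; apply: eq_bigr => x _; rewrite mulNr.
  rewrite !N; lra.
by move=> v w; rewrite !big_cons big_nil /=; ring.
Qed.

End ising.

(** ** Four copies *)

Lemma big_pair {R : Type} {idx : R} {op : Monoid.com_law idx} (A B : finType)
    (F : A * B -> R) :
  \big[op/idx]_p F p = \big[op/idx]_a \big[op/idx]_b F (a, b).
Proof. by rewrite pair_bigA/=; apply: eq_bigr => -[]. Qed.

(** The four orthogonal combinations of Ellis, Monroe and Newman, doubled. *)
Definition emn {R : realType} (c : bool * bool) (x : (bool * bool) * (bool * bool)) : R :=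
  match c with
  | (true, true) => sg x.1.1 + sg x.1.2 + sg x.2.1 + sg x.2.2
  | (true, false) => sg x.1.1 + sg x.1.2 - sg x.2.1 - sg x.2.2
  | (false, true) => sg x.1.1 - sg x.1.2 + sg x.2.1 - sg x.2.2
  | (false, false) => - sg x.1.1 + sg x.1.2 + sg x.2.1 - sg x.2.2
  end.

(** For spins [-1], [1] either one of the four combinations is [4] or [-4] and
    the others vanish, or all are [2] or [-2] with a positive product. *)
Lemma emn_moment_ge0 {R : realType} (e : {ffun bool * bool -> nat}) :
  0 <= \sum_x \prod_c (emn c x : R) ^+ e c.
Proof.
rewrite !(big_pair, big_bool)/= /sg expr1 expr0 !opprK.
have [u u1] : exists u : R, u = 1 by exists 1.
rewrite -!u1.
rewrite (_ : - u - u - u - u = -1 * 4); last by rewrite u1; lra.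
rewrite (_ : - u - u - u + u = -1 * 2); last by rewrite u1; lra.
rewrite (_ : - u - u + u - u = -1 * 2); last by rewrite u1; lra.
rewrite (_ : - u - u + u + u = 0); last by rewrite u1; lra.
rewrite (_ : - u + u - u - u = -1 * 2); last by rewrite u1; lra.
rewrite (_ : - u + u - u + u = 0); last by rewrite u1; lra.
rewrite (_ : - u + u + u - u = 0); last by rewrite u1; lra.
rewrite (_ : - u + u + u + u = 2); last by rewrite u1; lra.
rewrite (_ : u - u - u - u = -1 * 2); last by rewrite u1; lra.
rewrite (_ : u - u - u + u = 0); last by rewrite u1; lra.
rewrite (_ : u - u + u - u = 0); last by rewrite u1; lra.
rewrite (_ : u - u + u + u = 2); last by rewrite u1; lra.
rewrite (_ : u + u - u - u = 0); last by rewrite u1; lra.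
rewrite (_ : u + u - u + u = 2); last by rewrite u1; lra.
rewrite (_ : u + u + u - u = 2); last by rewrite u1; lra.
rewrite (_ : u + u + u + u = 4); last by rewrite u1; lra.
move: (e (true, true)) (e (true, false)) (e (false, true)) (e (false, false)).
move=> n1 n2 n3 n4; rewrite !exprMn.
have s_pm (n : nat) : (-1 : R) ^+ n = 1 \/ (-1 : R) ^+ n = -1.
  by rewrite -signr_odd; case: odd; rewrite ?expr1 ?expr0; [right|left].
have nng (x : R) n : 0 <= x -> 0 <= x ^+ n by move=> x0; exact: exprn_ge0.
have R4 : 0 <= 4 :> R by lra.
have R2 : 0 <= 2 :> R by lra.
have p (x y z t : R) a b c d : 0 <= x -> 0 <= y -> 0 <= z -> 0 <= t ->
    0 <= x ^+ a * y ^+ b * (z ^+ c * t ^+ d).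
  by move=> *; rewrite !mulr_ge0// nng.
have H4 := p 4 0 0 0 n1 n2 n3 n4 R4 (lexx 0) (lexx 0) (lexx 0).
have H3 := p 0 4 0 0 n1 n2 n3 n4 (lexx 0) R4 (lexx 0) (lexx 0).
have H2 := p 0 0 4 0 n1 n2 n3 n4 (lexx 0) (lexx 0) R4 (lexx 0).
have H1 := p 0 0 0 4 n1 n2 n3 n4 (lexx 0) (lexx 0) (lexx 0) R4.
have H0 := p 2 2 2 2 n1 n2 n3 n4 R2 R2 R2 R2.
have := s_pm n4; have := s_pm n3; have := s_pm n2; have := s_pm n1; clear p nng s_pm R4 R2.
move: H4 H3 H2 H1 H0.
move: (4 ^+ n1) (4 ^+ n2) (4 ^+ n3) (4 ^+ n4) (0 ^+ n1) (0 ^+ n2) (0 ^+ n3) (0 ^+ n4).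
move: (2 ^+ n1) (2 ^+ n2) (2 ^+ n3) (2 ^+ n4).
move: ((-1) ^+ n1) ((-1) ^+ n2) ((-1) ^+ n3) ((-1) ^+ n4).
move=> s1 s2 s3 s4 t1 t2 t3 t4 f1 f2 f3 f4 z1 z2 z3 z4 H4 H3 H2 H1 H0 S1 S2 S3 S4.
have pm (x : R) : x = 1 \/ x = -1 -> 0 <= 1 + x by case=> ->; lra.
have even8 : 0 <= 1 + s1 * s2 + s1 * s3 + s1 * s4 + s2 * s3 + s2 * s4 + s3 * s4 +
    s1 * s2 * s3 * s4.
  by case: S1 => ->; case: S2 => ->; case: S3 => ->; case: S4 => ->; lra.
have := addr_ge0 (addr_ge0 (addr_ge0 (addr_ge0 (mulr_ge0 H4 (pm _ S1))
  (mulr_ge0 H3 (pm _ S2))) (mulr_ge0 H2 (pm _ S3))) (mulr_ge0 H1 (pm _ S4)))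
  (mulr_ge0 H0 even8).
move=> /le_trans; apply; rewrite le_eqVlt; apply/orP; left; apply/eqP; ring.
Qed.

Section lebowitz.
Context {R : realType} {T : finType}.
Implicit Types (J : T -> T -> R) (s : seq (T * T)) (v : T -> R).
Local Notation conf := {ffun T -> bool}.
Local Notation conf2 := {ffun T -> bool * bool}.
Local Notation conf4 := {ffun T -> (bool * bool) * (bool * bool)}.

Lemma isum2_comb J s f1 f2 f3 f4 (a b c d : R) :
  isum2 J s (fun v w => a * f1 v w + b * f2 v w + c * f3 v w + d * f4 v w) =
  a * isum2 J s f1 + b * isum2 J s f2 + c * isum2 J s f3 + d * isum2 J s f4.
Proof.
rewrite /isum2 !mulr_sumr -!big_split/=; apply: eq_bigr => p _.
by rewrite !mulrDl !mulrA.
Qed.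

Lemma isum2Z J s c f : isum2 J s (fun v w => c * f v w) = c * isum2 J s f.
Proof. by rewrite /isum2 mulr_sumr; apply: eq_bigr => p _; rewrite mulrA. Qed.

(** Two pairs of independent copies, with combinations [v + w] and [v - w] within
    a pair, and again sums and differences across the pairs: these are the
    combinations [emn], for which the weight is ferromagnetic. The product of four
    of them, one of each kind, has nonnegative mean. *)
Lemma isum2_le_lebowitz J s i j k l : (forall a b, 0 <= J a b) ->
  isum2 J s (fun v w => (v i + w i) * (v j + w j) * ((v k - w k) * (v l - w l))) *
    isum2 J s (fun _ _ => 1) <=
  isum2 J s (fun v w => (v i + w i) * (v j + w j)) *
    isum2 J s (fun v w => (v k - w k) * (v l - w l)).
Proof.
move=> J0.
pose Phi (h : T * (bool * bool)) (w : conf4) : R := emn h.2 (w h.1).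
pose A (w : conf4) : conf2 := [ffun t => (w t).1].
pose B (w : conf4) : conf2 := [ffun t => (w t).2].
pose S (p : conf2) t := copy1 p t + copy2 p t : R.
pose D (p : conf2) t := copy1 p t - copy2 p t : R.
have P1 t : poscone Phi (fun w => S (A w) t + S (B w) t).
  apply: poscone_ext (@poscone_gen _ _ _ Phi (t, (true, true))) => w.
  by rewrite /Phi /S /copy1 /copy2 !ffunE /=; ring.
have P2 t : poscone Phi (fun w => S (A w) t - S (B w) t).
  apply: poscone_ext (@poscone_gen _ _ _ Phi (t, (true, false))) => w.
  by rewrite /Phi /S /copy1 /copy2 !ffunE /=; ring.
have P3 t : poscone Phi (fun w => D (A w) t + D (B w) t).
  apply: poscone_ext (@poscone_gen _ _ _ Phi (t, (false, true))) => w.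
  by rewrite /Phi /D /copy1 /copy2 !ffunE /=; ring.
have P4 t : poscone Phi (fun w => D (B w) t - D (A w) t).
  apply: poscone_ext (@poscone_gen _ _ _ Phi (t, (false, false))) => w.
  by rewrite /Phi /D /copy1 /copy2 !ffunE /=; ring.
pose G (p q : conf2) := (S p i + S q i) * (S p j - S q j) *
   ((D p k + D q k) * (D q l - D p l)).
pose Q (w : conf4) := energy J s (copy1 (A w)) + energy J s (copy2 (A w)) +
   (energy J s (copy1 (B w)) + energy J s (copy2 (B w))).
have pos : 0 <= \sum_w G (A w) (B w) * expR (Q w).
  apply: (@ginibre_fin R T _ _ emn emn_moment_ge0 (fun w => G (A w) (B w)) Q).
    by do 2?apply: posconeM; [exact: P1|exact: P2|exact: P3|exact: P4].
  apply: (@poscone_ext _ _ _ _ (fun w => \sum_(e <- s) J e.1 e.2 * (4^-1 *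
     ((S (A w) e.1 + S (B w) e.1) * (S (A w) e.2 + S (B w) e.2) +
      (S (A w) e.1 - S (B w) e.1) * (S (A w) e.2 - S (B w) e.2) +
      ((D (A w) e.1 + D (B w) e.1) * (D (A w) e.2 + D (B w) e.2) +
       (D (B w) e.1 - D (A w) e.1) * (D (B w) e.2 - D (A w) e.2)))))).
    move=> w; rewrite /Q /energy -!big_split/=; apply: eq_bigr => e _.
    by rewrite /S /D; field.
  apply: poscone_sum => e _; apply: posconeM; first exact: poscone_cst.
  apply: posconeM; first by apply: poscone_cst; rewrite invr_ge0.
  by apply: posconeD; apply: posconeD; apply: posconeM;
    (exact: P1 || exact: P2 || exact: P3 || exact: P4).
pose wt := weight2 J s.
have E : \sum_w G (A w) (B w) * expR (Q w) = \sum_p \sum_q G p q * (wt p * wt q).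
  rewrite -(@sum_ffun_pair _ T _ _ (fun p q => G p q * (wt p * wt q))).
  by apply: eq_bigr => w _; rewrite /Q !expRD.
pose H v w v' w' := ((v i + w i) + (v' i + w' i)) * ((v j + w j) - (v' j + w' j)) *
   (((v k - w k) + (v' k - w' k)) * ((v' l - w' l) - (v l - w l))) : R.
have {}E : \sum_w G (A w) (B w) * expR (Q w) =
   \sum_q isum2 J s (fun v w => H v w (copy1 q) (copy2 q)) * wt q.
  rewrite E exchange_big/=; apply: eq_bigr => q _; rewrite /isum2 mulr_suml.
  by apply: eq_bigr => p _; rewrite mulrA.
(* Averaging over the two flips and their composition removes from the first pair
   of copies the terms of odd degree in [v + w] or in [v - w]. *)
have avg (v' w' : T -> R) : isum2 J s (fun v w => H v w v' w') =
     (v' k - w' k) * (v' l - w' l) * isum2 J s (fun v w => (v i + w i) * (v j + w j))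
     + (v' i + w' i) * (v' j + w' j) * isum2 J s (fun v w => (v k - w k) * (v l - w l))
     + (- 1) * isum2 J s (fun v w => (v i + w i) * (v j + w j) * ((v k - w k) * (v l - w l)))
     + (- ((v' i + w' i) * (v' j + w' j) * ((v' k - w' k) * (v' l - w' l)))) *
        isum2 J s (fun _ _ => 1).
  rewrite -isum2_comb; set h := fun v w => H v w v' w'.
  have F1 : isum2 J s h = isum2 J s (fun v w => h (fun t => - v t) (fun t => - w t)).
    by rewrite isum2_flip1 isum2_flip2.
  have F2 : isum2 J s h = isum2 J s (fun v w => h w v) by rewrite isum2_swap.
  have F3 : isum2 J s h = isum2 J s (fun v w => h (fun t => - w t) (fun t => - v t)).
    by rewrite F2 isum2_flip1 isum2_flip2.
  have : 4 * isum2 J s h = isum2 J s h + isum2 J s h + isum2 J s h + isum2 J s h by ring.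
  rewrite {2}F1 {2}F2 {3}F3 -!isum2D => e4.
  apply: (@mulfI _ 4); first by rewrite pnatr_eq0.
  rewrite e4 -isum2Z.
  by apply: isum2_ext => v w; rewrite /h /H; ring.
have : 0 <= 2 * (isum2 J s (fun v w => (v i + w i) * (v j + w j)) *
    isum2 J s (fun v w => (v k - w k) * (v l - w l)) -
  isum2 J s (fun v w => (v i + w i) * (v j + w j) * ((v k - w k) * (v l - w l))) *
    isum2 J s (fun _ _ => 1)).
  rewrite (le_trans pos)// E le_eqVlt; apply/orP; left; apply/eqP.
  under eq_bigr do rewrite avg.
  set a := isum2 J s (fun v w => (v i + w i) * (v j + w j)).
  set b := isum2 J s (fun v w => (v k - w k) * (v l - w l)).
  set c := isum2 J s (fun v w => (v i + w i) * (v j + w j) * ((v k - w k) * (v l - w l))).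
  set d := isum2 J s (fun _ _ => 1).
  transitivity (a * b + b * a + (- c) * d + (- d) * c); last by ring.
  rewrite -isum2_comb; apply: eq_bigr => q _; congr (_ * _); ring.
by rewrite pmulr_rge0 ?ltr0n// subr_ge0.
Qed.

(** In terms of a single copy this is the negativity of the fourth Ursell
    function. *)
Lemma lebowitz J s i j k l : (forall a b, 0 <= J a b) ->
  isum J s (fun v => v i * v j * (v k * v l)) * isum J s (fun=> 1) <=
  isum J s (fun v => v i * v j) * isum J s (fun v => v k * v l) +
  isum J s (fun v => v i * v k) * isum J s (fun v => v j * v l) +
  isum J s (fun v => v i * v l) * isum J s (fun v => v j * v k).
Proof.
move=> J0; set Z := isum J s (fun=> 1).
have Z0 : 0 < Z by exact: isum1_gt0.
pose f a b (v : T -> R) := v a * v b.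
pose c a b := isum J s (f a b).
have half h : 2 * isum2 J s h = isum2 J s (fun v w => h v w + h (fun t => - v t) w).
  by rewrite isum2D -isum2_flip1; ring.
have E0 : isum2 J s (fun _ _ => 1) = Z * Z.
  by rewrite (@isum2_bilin _ _ _ _ [:: (fun=> 1, fun=> 1)])
    => [|v w]; rewrite big_seq1 ?mulr1.
have E1 a b : isum2 J s (fun v w => (v a + w a) * (v b + w b)) = 2 * (c a b * Z).
  apply: (@mulfI _ 2); first by rewrite pnatr_eq0.
  rewrite half (@isum2_bilin _ _ _ _ [:: (f a b, fun=> 1); (f a b, fun=> 1);
     (fun=> 1, f a b); (fun=> 1, f a b)]) => [|v w].
    by rewrite !big_cons big_nil/= -/(c a b) -/Z; ring.
  by rewrite !big_cons big_nil/= /f; ring.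
have E2 a b : isum2 J s (fun v w => (v a - w a) * (v b - w b)) = 2 * (c a b * Z).
  by rewrite isum2_flip2 -E1; apply: isum2_ext => v w; rewrite !opprK.
pose g v : R := f i j v * f k l v.
have E3 : isum2 J s (fun v w => (v i + w i) * (v j + w j) * ((v k - w k) * (v l - w l)))
    = 2 * (isum J s g * Z) + 2 * (c i j * c k l) - 2 * (c i k * c j l) - 2 * (c i l * c j k).
  apply: (@mulfI _ 2); first by rewrite pnatr_eq0.
  have N (h : (T -> R) -> R) : isum J s (fun v => - h v) = - isum J s h.
    by rewrite /isum -sumrN; apply: eq_bigr => x _; rewrite mulNr.
  rewrite half (@isum2_bilin _ _ _ _ (let r := [:: (g, fun=> 1); (fun=> 1, g);
     (f i j, f k l); (f k l, f i j); (fun v => - f i k v, f j l); (fun v => - f j l v, f i k);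
     (fun v => - f i l v, f j k); (fun v => - f j k v, f i l)] in r ++ r)) => [|v w].
    by rewrite !big_cons big_nil/= !N -!/(c _ _) -/Z; ring.
  by rewrite !big_cons big_nil/= /g /f; ring.
have := @isum2_le_lebowitz J s i j k l J0.
rewrite E0 E1 E2 E3 -subr_ge0 => h.
rewrite -/g -!/(f _ _) -!/(c _ _) -subr_ge0.
have ZZ : 0 < 2 * (Z * Z) by rewrite !mulr_gt0.
rewrite -(pmulr_rge0 _ ZZ) (le_trans h)// le_eqVlt; apply/orP; left; apply/eqP.
ring.
Qed.

End lebowitz.

Lemma sinh_le_cosh {R : realType} (c : R) : 0 <= c ->
  expR c - expR (- c) <= 2 * c * (expR c + expR (- c)).
Proof.
move=> c0; apply: (@le_trans _ _ (2 * c * expR c)); last first.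
  by rewrite mulrDr lerDl !mulr_ge0// expR_ge0.
have : 1 - 2 * c <= expR (- (2 * c)) by have := expR_ge1Dx (- (2 * c)).
have -> : expR (- c) = expR c * expR (- (2 * c)) by rewrite -expRD; congr expR; ring.
by have := expR_gt0 c; nra.
Qed.

Lemma expR_sg {R : realType} (c u : R) : u * u = 1 ->
  expR (c * u) = (expR c + expR (- c)) / 2 + (expR c - expR (- c)) / 2 * u.
Proof.
move=> uu; have /eqP : (u - 1) * (u + 1) = 0 by rewrite mulrDr mulrBl uu; ring.
rewrite mulf_eq0 => /orP[]; rewrite ?subr_eq0 ?addr_eq0 => /eqP ->.
  by rewrite !mulr1; field.
by rewrite mulrN mulr1; field.
Qed.

Section simon.
Context {R : realType} {T : finType}.
Implicit Types (J : T -> T -> R) (s : seq (T * T)) (v : T -> R).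

Lemma isum_cons J e s f : isum J (e :: s) f =
  (expR (J e.1 e.2) + expR (- J e.1 e.2)) / 2 * isum J s f +
  (expR (J e.1 e.2) - expR (- J e.1 e.2)) / 2 *
    isum J s (fun v => f v * (v e.1 * v e.2)).
Proof.
rewrite /isum !mulr_sumr -big_split/=; apply: eq_bigr => x _.
rewrite /energy big_cons expRD expR_sg; first by ring.
by rewrite mulrACA !sg_sqr mulr1.
Qed.

(** A new edge contributes a truncated four-point function, which is nonnegative
    by Griffiths' second inequality and bounded by products of two-point functions
    by Lebowitz' inequality. *)
Lemma corr_cons J e s i j : (forall a b, 0 <= J a b) ->
  corr J s i j <= corr J (e :: s) i j /\
  corr J (e :: s) i j <= corr J s i j + 2 * J e.1 e.2 *
    (corr J s i e.1 * corr J s j e.2 + corr J s i e.2 * corr J s j e.1).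
Proof.
case: e => a b J0 /=; set c := J a b; have c0 : 0 <= c by exact: J0.
have Z0 := isum1_gt0 J s; have Ze0 := isum1_gt0 J ((a, b) :: s).
have := gks2 J s i j a b J0; have := lebowitz J s i j a b J0.
have := gks1 J s a b J0.
rewrite /corr isum_cons /= -/c; move: Ze0; rewrite isum_cons /= -/c.
have -> : isum J s (fun v => 1 * (v a * v b)) = isum J s (fun v => v a * v b).
  by apply: eq_bigr => x _; rewrite mul1r.
have := sinh_le_cosh c c0; have : expR (- c) <= expR c by rewrite ler_expR; lra.
have := expR_gt0 c; have := expR_gt0 (- c).
move: (expR c) (expR (- c)) => p q q0 p0 qp pq.
move: (isum J s (fun=> 1)) Z0 => Z Z0.
move: (isum J s (fun v => v a * v b)) => E.
move: (isum J s (fun v => v i * v j)) => F.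
move: (isum J s (fun v => v i * v j * (v a * v b))) => FE.
set A1 := isum J s _; set A2 := isum J s _; set A3 := isum J s _; set A4 := isum J s _.
set ch := (p + q) / 2; set sh := (p - q) / 2.
have sh0 : 0 <= sh by rewrite /sh; lra.
have ch0 : 0 < ch by rewrite /ch; lra.
have shch : sh <= 2 * c * ch by rewrite /sh /ch; lra.
move=> D0 E0 leb g2.
have g0 : 0 <= FE * Z - F * E by lra.
have -> : (ch * F + sh * FE) / (ch * Z + sh * E) =
    F / Z + sh * (FE * Z - F * E) / ((ch * Z + sh * E) * Z).
  by field; rewrite !gt_eqF.
clearbody ch sh.
have DZ0 : 0 < (ch * Z + sh * E) * Z by rewrite mulr_gt0.
split; first by rewrite lerDl divr_ge0 ?(mulr_ge0 sh0 g0)// ltW.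
rewrite lerD2l ler_pdivrMr//.
have -> : 2 * c * (A1 / Z * (A2 / Z) + A3 / Z * (A4 / Z)) * ((ch * Z + sh * E) * Z) =
   2 * c * (A1 * A2 + A3 * A4) * (ch + sh * E / Z).
  by field; rewrite gt_eqF.
apply: (@le_trans _ _ (2 * c * ch * (FE * Z - F * E))); first by rewrite ler_wpM2r.
have le1 : FE * Z - F * E <= A1 * A2 + A3 * A4 by lra.
rewrite [leRHS]mulrAC.
apply: ler_pM => //; first by rewrite !mulr_ge0// ltW.
by rewrite ler_wpM2l ?mulr_ge0// lerDl !mulr_ge0// invr_ge0 ltW.
Qed.

Lemma isum_odd_flip J s (B : pred T) f :
  {in s, forall e, B e.1 = B e.2} ->
  (forall v, f (fun t => (if B t then -1 else 1) * v t) = - f v) ->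
  isum J s f = 0.
Proof.
move=> sB fN.
pose h (x : {ffun T -> bool}) := [ffun t => if B t then ~~ x t else x t].
have hh : involutive h.
  by move=> x; apply/ffunP => t; rewrite !ffunE; case: (B t) => //; rewrite negbK.
have hE x : spins (h x) = (fun t => (if B t then -1 else 1) * spins x t) :> (T -> R).
  apply/funext => t; rewrite /spins ffunE; case: (B t); rewrite ?mul1r//.
  by rewrite sgN mulN1r.
suff : isum J s f = - isum J s f by lra.
rewrite {1}/isum (reindex_inj (inv_inj hh)) -sumrN; apply: eq_bigr => x _.
rewrite hE fN mulNr; congr (- (_ * expR _)).
rewrite /energy !big_seq; apply: eq_bigr => e es; rewrite mulrACA sB//.
by case: (B _); rewrite ?mulrNN mulr1 mul1r.
Qed.

(** Simon's inequality: without the edges that leave [B] the correlation from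
    inside to outside vanishes, and each of these edges adds at most what
    Lebowitz allows. *)
Lemma simon_ineq J s (B : pred T) i j : (forall a b, 0 <= J a b) -> B i -> ~~ B j ->
  corr J s i j <= \sum_(e <- s | B e.1 != B e.2) 2 * J e.1 e.2 *
    (corr J s i e.1 * corr J s j e.2 + corr J s i e.2 * corr J s j e.1).
Proof.
move=> J0 Bi Bj.
pose F := [seq e <- s | B e.1 != B e.2]; pose r := [seq e <- s | B e.1 == B e.2].
have Fr f : isum J s f = isum J (F ++ r) f.
  apply: eq_bigr => x _; congr (_ * expR _); rewrite /energy big_cat/= !big_filter.
  rewrite (bigID (fun e => B e.1 != B e.2))/=; congr (_ + _).
  by apply: eq_bigl => e; rewrite negbK.
have cFr a b : corr J s a b = corr J (F ++ r) a b by rewrite /corr !Fr.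
rewrite -big_filter -/F cFr.
have : forall a b, corr J (F ++ r) a b <= corr J s a b by move=> a b; rewrite cFr.
elim: F {cFr Fr} => [|e F IH] le_s.
  rewrite big_nil /corr /= (@isum_odd_flip _ _ B) ?mul0r// => [e|v].
    by rewrite mem_filter => /andP[/eqP].
  by rewrite Bi (negbTE Bj) mul1r mulN1r mulNr.
have le_s' a b : corr J (F ++ r) a b <= corr J s a b.
  by apply: le_trans (le_s a b); have [] := corr_cons J e (F ++ r) a b J0.
rewrite big_cons addrC; have [_ /le_trans] := corr_cons J e (F ++ r) i j J0; apply.
apply: lerD; first exact: IH.
apply: ler_wpM2l; first by rewrite mulr_ge0.
by apply: lerD; apply: ler_pM => //; exact: corr_ge0.
Qed.

End simon.

(** * Decay of correlations in one-dimensional Ising models *)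

(** Flipping the spins beyond the [k]-th cut kills every term in which the
    factor [g k], that couples the two sides, is replaced by one. Hence each
    [g k] may be replaced by [g k - 1], a fixed fraction of it. *)
Lemma cut_contraction {R : realFieldType} (X : finType) (f : X -> R)
    (g : nat -> X -> R) (h : nat -> X -> X) (lam : R) :
  (forall x, `|f x| <= 1) -> 0 <= lam ->
  (forall k, involutive (h k)) ->
  (forall k x, 1 <= g k x) -> (forall k x, g k x - 1 <= lam * g k x) ->
  (forall (k l : nat) x, k != l -> g l (h k x) = g l x) ->
  forall n (V : X -> R), (forall x, 0 <= V x) ->
  (forall k x, (k < n)%N -> f (h k x) = - f x) ->
  (forall k x, (k < n)%N -> V (h k x) = V x) ->
  `|\sum_x f x * (V x * \prod_(k < n) g k x)| <=
    lam ^+ n * \sum_x V x * \prod_(k < n) g k x.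
Proof.
move=> f1 lam0 hh g1 glam gh; elim=> [|n IH] V V0 fh Vh.
  rewrite expr0 mul1r; apply: le_trans (ler_norm_sum _ _ _) _.
  apply: ler_sum => x _; rewrite normrM big_ord0 mulr1 (ger0_norm (V0 x)).
  by rewrite ler_piMl.
have p0 m x : 0 <= \prod_(k < m) g k x.
  by apply: prodr_ge0 => k _; apply: le_trans (g1 k x).
have -> : \sum_x f x * (V x * \prod_(k < n.+1) g k x) =
    \sum_x f x * ((V x * (g n x - 1)) * \prod_(k < n) g k x).
  suff van : \sum_x f x * (V x * \prod_(k < n) g k x) = 0.
    rewrite -[RHS]addr0 -[X in _ = _ + X]van -big_split/=; apply: eq_bigr => x _.
    by rewrite big_ord_recr/=; ring.
  suff : \sum_x f x * (V x * \prod_(k < n) g k x) =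
      - \sum_x f x * (V x * \prod_(k < n) g k x) by lra.
  rewrite {1}(reindex_inj (inv_inj (hh n))) -sumrN; apply: eq_bigr => x _.
  rewrite fh// Vh// mulNr; congr (- (_ * (_ * _))).
  by apply: eq_bigr => k _; rewrite gh// gtn_eqF.
apply: le_trans (IH _ _ _ _) _ => [x|k x kn|k x kn|].
- by rewrite mulr_ge0// subr_ge0.
- by rewrite fh// ltnW.
- by rewrite Vh 1?ltnW// gh// ltn_eqF.
rewrite exprSr -mulrA ler_wpM2l ?exprn_ge0// mulr_sumr; apply: ler_sum => x _.
rewrite big_ord_recr/=; move: (p0 n x); move: (\prod_(k < n) g k x) => P P0.
rewrite (_ : lam * _ = V x * (lam * g n x) * P); last by ring.
by rewrite ler_wpM2r// ler_wpM2l.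
Qed.

Lemma decay_small {R : realType} (p t : R) : 0 < p -> 0 < t ->
  exists l, decay p l <= t.
Proof.
move=> p0 t0; exists (Num.truncn (t `^ (- p^-1))).
have E : t = t `^ (- p^-1) `^ (- p).
  by rewrite -powRrM mulrNN mulVf ?gt_eqF// powRr1// ltW.
rewrite [leRHS]E /decay !(powRN _ p) lef_pV2 ?posrE ?powR_gt0 ?ltr0n//.
rewrite ge0_ler_powR ?nnegrE ?powR_ge0 ?ler0n ?(ltW p0)//.
by apply: ltW; have /truncn_itv/andP[_] := powR_ge0 t (- p^-1).
Qed.

Definition crosses {T : Type} (pos : T -> nat) (z : nat) (a b : T) : bool :=
  (pos a <= z)%N != (pos b <= z)%N.

Section one_dim.
Context {R : realType} (e Cj : R).
Hypotheses (e0 : 0 < e) (Cj0 : 0 <= Cj).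

Let p : R := 2 + 4 * e.
Let cb : R := Cj * (3 * (1 + e^-1)) ^+ 2.

Lemma cb_ge0 : 0 <= cb.
Proof. by rewrite /cb mulr_ge0// sqr_ge0. Qed.

Section model.
Context {T : finType} (pos : T -> nat) (J : T -> T -> R).
Hypothesis pos3 : forall m : nat, (#|[pred a | pos a == m]| <= 3)%N.
Hypothesis J0 : forall a b, 0 <= J a b.
Hypothesis Jd : forall a b, J a b <= Cj * decay p (gap (pos a) (pos b)).

Lemma crossing_sum z l :
  \sum_(ab : T * T | crosses pos z ab.1 ab.2 && (l <= gap (pos ab.1) (pos ab.2))%N)
    J ab.1 ab.2 <= 2 * cb * decay (2 * e) l.
Proof.
pose s := \sum_(a | (pos a <= z)%N)
    \sum_(b | (z < pos b)%N && (l <= gap (pos a) (pos b))%N)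
      decay p (gap (pos a) (pos b)).
have sb : Cj * s <= cb * decay (2 * e) l.
  by rewrite -mulrA ler_wpM2l// cut_sum.
apply: (@le_trans _ _ (Cj * s + Cj * s)); last by rewrite -mulrA; lra.
have half (F : T -> T -> R) : (forall a b, F a b <= Cj * decay p (gap (pos a) (pos b))) ->
  \sum_(ab : T * T | (pos ab.1 <= z)%N &&
     ((z < pos ab.2)%N && (l <= gap (pos ab.1) (pos ab.2))%N)) F ab.1 ab.2 <= Cj * s.
  move=> Fd; rewrite -(pair_big_dep (fun a => pos a <= z)%N
    (fun a b => (z < pos b)%N && (l <= gap (pos a) (pos b))%N) F)/=.
  rewrite /s mulr_sumr; apply: ler_sum => a _; rewrite mulr_sumr.
  by apply: ler_sum => b _; exact: Fd.
rewrite (bigID (fun ab => pos ab.1 <= z)%N)/=; apply: lerD.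
- apply: le_trans (half J Jd); rewrite le_eqVlt; apply/orP; left; apply/eqP.
  apply: eq_bigl => -[a b]/=; rewrite /crosses ltnNge.
  by case: (pos a <= z)%N; case: (pos b <= z)%N; rewrite ?andbT ?andbF.
- rewrite (reindex_inj (h := fun ab : T * T => (ab.2, ab.1))); last first.
    by move=> [a b] [c d]/= [-> ->].
  apply: le_trans (half (fun a b => J b a) _); last by move=> a b; rewrite gapC.
  rewrite le_eqVlt; apply/orP; left; apply/eqP; apply: eq_bigl => -[a b]/=.
  rewrite /crosses ltnNge gapC.
  by case: (pos a <= z)%N; case: (pos b <= z)%N; rewrite ?andbT ?andbF.
Qed.

Local Notation edges := (index_enum (T * T)%type).

(** Beyond a cut of [n] crossings spaced by [l], all edges that cross the cuts
    and are shorter than [l] meet only one of them. *)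
Lemma corr_cuts i j n l : (pos i + n * l <= pos j)%N -> (0 < l)%N ->
  corr J edges i j <= (1 - expR (- (4 * cb))) ^+ n +
    (expR (n%:R * (4 * cb * decay (2 * e) l)) - 1).
Proof.
move=> ij l0.
pose z k := (pos i + k * l)%N.
pose vv (x : {ffun T -> bool}) (ab : T * T) : R := spins x ab.1 * spins x ab.2.
pose short k (ab : T * T) := crosses pos (z k) ab.1 ab.2 && (gap (pos ab.1) (pos ab.2) < l)%N.
pose long (ab : T * T) := [exists k : 'I_n, crosses pos (z k) ab.1 ab.2] &&
  (l <= gap (pos ab.1) (pos ab.2))%N.
(* With [1] added to each bond variable the factors [g k] are at least one; [V]
   compensates for it. *)
pose Jv x ab := J ab.1 ab.2 * (1 + vv x ab).
have vv1 x ab : -1 <= vv x ab <= 1.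
  by rewrite -ler_norml normrM !norm_sg mulr1.
have Jv0 x ab : 0 <= Jv x ab.
  by rewrite mulr_ge0//; case/andP: (vv1 x ab); lra.
have Jv2 x ab : Jv x ab <= 2 * J ab.1 ab.2.
  by rewrite [leRHS]mulrC ler_wpM2l//; case/andP: (vv1 x ab); lra.
pose Qs k x := \sum_(ab | short k ab) Jv x ab.
pose Ql x := \sum_(ab | long ab) Jv x ab.
pose g k x := expR (Qs k x); pose g0 x := expR (Ql x).
(* Only the edges that cross no cut still depend on [x] in [V], see [Dcross];
   hence [V] is invariant under the flips [h k]. *)
pose V x := expR (energy J edges (spins x) - \sum_(k < n) Qs k x - Ql x).
pose f (x : {ffun T -> bool}) : R := spins x i * spins x j.
pose h k (x : {ffun T -> bool}) : {ffun T -> bool} := [ffun t => if (pos t <= z k)%N then x t else ~~ x t].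
have hh k : involutive (h k).
  by move=> x; apply/ffunP => t; rewrite !ffunE; case: (pos t <= z k)%N; rewrite ?negbK.
have hv k x ab : vv (h k x) ab = if crosses pos (z k) ab.1 ab.2 then - vv x ab else vv x ab.
  rewrite /vv /spins /crosses !ffunE.
  by case: (pos ab.1 <= _)%N; case: (pos ab.2 <= _)%N => //=; rewrite sgN ?sgN ?mulrN ?mulNr ?opprK.
have short_uniq k k' ab : short k ab -> crosses pos (z k') ab.1 ab.2 -> k = k'.
  rewrite /short /crosses /z /gap => /andP[c1 c2] c3.
  case: (ltngtP k k') => // kk; exfalso.
  - have : (k.+1 * l <= k' * l)%N by rewrite leq_mul2r kk orbT.
    by rewrite mulSn; move: (k' * l)%N (k * l)%N c1 c2 c3; lia.
  - have : (k'.+1 * l <= k * l)%N by rewrite leq_mul2r kk orbT.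
    by rewrite mulSn; move: (k' * l)%N (k * l)%N c1 c2 c3; lia.
have Qs0 k x : 0 <= Qs k x by rewrite sumr_ge0.
have Ql0 x : 0 <= Ql x by rewrite sumr_ge0.
have cross4 k d x : \sum_(ab | crosses pos (z k) ab.1 ab.2 &&
    (d <= gap (pos ab.1) (pos ab.2))%N) Jv x ab <= 4 * cb * decay (2 * e) d.
  apply: le_trans (ler_sum _ (fun ab _ => Jv2 x ab)) _; rewrite -mulr_sumr.
  by have := crossing_sum (z k) d; lra.
have Qs4 k x : Qs k x <= 4 * cb.
  have := cross4 k 0%N x; rewrite decay0 mulr1; apply: le_trans; rewrite [leLHS]big_mkcond [leRHS]big_mkcond/=.
  apply: ler_sum => ab _; rewrite leq0n andbT /short.
  by case: crosses => //=; case: ifP.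
have Ql4 x : Ql x <= n%:R * (4 * cb * decay (2 * e) l).
  apply: (@le_trans _ _ (\sum_(k < n) \sum_(ab | crosses pos (z k) ab.1 ab.2 &&
    (l <= gap (pos ab.1) (pos ab.2))%N) Jv x ab)).
    rewrite (exchange_big_dep xpredT)//= /Ql big_mkcond/=; apply: ler_sum => ab _.
    case: ifP => [/andP[/existsP[k ck] lab]|_]; last exact: sumr_ge0.
    by rewrite (bigD1 k)/= ?ck ?lab// lerDl sumr_ge0.
  apply: (@le_trans _ _ (\sum_(k < n) 4 * cb * decay (2 * e) l)).
    by apply: ler_sum => k _; exact: cross4.
  by rewrite sumr_const card_ord -[leLHS]mulr_natl.
pose D x ab := J ab.1 ab.2 * vv x ab - \sum_(k < n | short k ab) Jv x ab -
  (if long ab then Jv x ab else 0).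
have VE x : energy J edges (spins x) - \sum_(k < n) Qs k x - Ql x = \sum_ab D x ab.
  rewrite /D !sumrB /Ql -big_mkcond /=; congr (_ - _ - _).
  by rewrite (exchange_big_dep xpredT).
have Dcross (k : 'I_n) x ab : crosses pos (z k) ab.1 ab.2 -> D x ab = - J ab.1 ab.2.
  move=> ck; rewrite /D; have [lab|gl] := leqP l (gap (pos ab.1) (pos ab.2)).
    rewrite big1 => [|k']; last by rewrite /short ltnNge lab andbF.
    rewrite /long lab andbT ifT; last by apply/existsP; exists k.
    by rewrite /Jv; ring.
  rewrite /long leqNgt gl andbF subr0 (bigD1 k)/=; last by rewrite /short ck.
  rewrite big1 => [|k' /andP[sk' /negP[]]]; first by rewrite /Jv; ring.
  by apply/eqP/val_inj; exact: short_uniq sk' ck.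
have Dh k x ab : (k < n)%N -> D (h k x) ab = D x ab.
  move=> kn; case cab : (crosses pos (z k) ab.1 ab.2).
    by rewrite !(Dcross (Ordinal kn)).
  by rewrite /D /Jv hv cab.
have EV x : expR (energy J edges (spins x)) = V x * (\prod_(k < n) g k x) * g0 x.
  by rewrite /V /g /g0 -expR_sum -!expRD; congr expR; ring.
pose Z1 := \sum_x V x * \prod_(k < n) g k x.
have W0 x : 0 <= V x * \prod_(k < n) g k x.
  by rewrite mulr_ge0 ?expR_ge0// prodr_ge0// => k _; exact: expR_ge0.
have g01 x : 1 <= g0 x by rewrite -expR0 ler_expR.
have f1 x : `|f x| <= 1 by rewrite /f normrM !norm_sg mulr1.
have ZZ1 : Z1 <= isum J edges (fun=> 1).
  by apply: ler_sum => x _; rewrite mul1r EV ler_peMr.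
have main : `|\sum_x f x * (V x * \prod_(k < n) g k x)| <=
    (1 - expR (- (4 * cb))) ^+ n * Z1.
  apply: (@cut_contraction _ _ f g h) => //.
  - by rewrite subr_ge0 -[leRHS]expR0 ler_expR oppr_le0 mulr_ge0// cb_ge0.
  - by move=> k x; rewrite -expR0 ler_expR.
  - move=> k x; rewrite mulrBl mul1r lerD2l lerN2 /g -expRD -[leRHS]expR0 ler_expR.
    by have := Qs4 k x; lra.
  - move=> k m x km; congr expR; apply: eq_bigr => ab sab.
    rewrite /Jv hv; case: ifP => // cab.
    by rewrite (short_uniq _ _ _ sab cab) eqxx in km.
  - by move=> x; exact: expR_ge0.
  - move=> k x kn; have := hv k x (i, j); rewrite /vv /f /= => ->.
    rewrite /crosses /z leq_addr; case: (leqP (pos j)) => //=.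
    have : (k.+1 * l <= n * l)%N by rewrite leq_mul2r kn orbT.
    by rewrite mulSn; move: ij l0; clear; move: (n * l)%N (k * l)%N; lia.
  - by move=> k x kn; rewrite /V !VE; congr expR; apply: eq_bigr => ab _; exact: Dh.
have -> : corr J edges i j = (\sum_x f x * (V x * (\prod_(k < n) g k x) * g0 x)) /
    isum J edges (fun=> 1).
  by congr (_ / _); apply: eq_bigr => x _; rewrite EV.
rewrite ler_pdivrMr ?isum1_gt0//.
have lam0 : 0 <= 1 - expR (- (4 * cb)).
  by rewrite subr_ge0 -[leRHS]expR0 ler_expR oppr_le0 mulr_ge0// cb_ge0.
have eta0 : 0 <= expR (n%:R * (4 * cb * decay (2 * e) l)) - 1.
  rewrite subr_ge0 -[leLHS]expR0 ler_expR.
  by apply: mulr_ge0 => //; apply: mulr_ge0 (decay_ge0 _ _); rewrite mulr_ge0 ?cb_ge0.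
apply: (@le_trans _ _ (((1 - expR (- (4 * cb))) ^+ n +
    (expR (n%:R * (4 * cb * decay (2 * e) l)) - 1)) * Z1)); last first.
  by rewrite ler_wpM2l// addr_ge0// exprn_ge0.
rewrite mulrDl; apply: le_trans (lerD (le_trans (ler_norm _) main) (lexx _)).
rewrite /Z1 mulr_sumr -big_split/=; apply: ler_sum => x _.
move: (W0 x); set P := V x * _ => P0.
suff : f x * (g0 x - 1) * P <= (expR (n%:R * (4 * cb * decay (2 * e) l)) - 1) * P.
  by rewrite mulrBr mulr1 mulrBl; lra.
apply: ler_wpM2r => //; apply: (@le_trans _ _ (g0 x - 1)).
  by rewrite ler_piMl ?subr_ge0// (le_trans (ler_norm _) (f1 x)).
by rewrite lerD2r ler_expR.
Qed.

End model.
End one_dim.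

Section ising_decay.
Context {R : realType} (e Cj : R).
Hypotheses (e0 : 0 < e) (Cj0 : 0 <= Cj).

Let p : R := 2 + 4 * e.
Let cb : R := Cj * (3 * (1 + e^-1)) ^+ 2.

(** Up to three spins may share a position: a lattice spin and two auxiliary ones
    that serve as observables. *)
Definition power_law {T : finType} (pos : T -> nat) (J : T -> T -> R) :=
  [/\ forall m : nat, (#|[pred a | pos a == m]| <= 3)%N,
      forall a b, 0 <= J a b &
      forall a b, J a b <= Cj * decay p (gap (pos a) (pos b))].

Local Notation edges T := (index_enum (T * T)%type).

(** Enough cuts make the first term in [corr_cuts] small, and then wide spacing the
    second one. *)
Lemma corr_far (z : R) : 0 < z -> exists D : nat,
  forall (T : finType) (pos : T -> nat) (J : T -> T -> R), power_law pos J ->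
  forall i j, (D <= gap (pos i) (pos j))%N -> corr J (edges T) i j <= z.
Proof.
move=> z0.
have cb0 : 0 <= cb by exact: cb_ge0.
pose lam := 1 - expR (- (4 * cb)).
have lam0 : 0 <= lam.
  by rewrite subr_ge0 -[leRHS]expR0 ler_expR oppr_le0 mulr_ge0.
have lam1 : lam < 1 by rewrite ltrBlDr ltrDl expR_gt0.
have [n lamn] : exists n, lam ^+ n <= z / 2.
  have : GRing.exp lam @ \oo --> (0 : R) by apply: cvg_expr; rewrite ger0_norm.
  move=> /cvgr_le/(_ (z / 2)); rewrite divr_gt0// => /(_ isT)[n _ nP].
  by exists n; apply: nP => /=.
pose c := ln (1 + z / 2) / (n.+1%:R * (4 * cb + 1)).
have d0 : 0 < n.+1%:R * (4 * cb + 1) :> R.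
  by apply: mulr_gt0; [rewrite ltr0n|lra].
have c0 : 0 < c by apply: divr_gt0 => //; apply: ln_gt0; rewrite ltrDl divr_gt0.
have [l lc] := decay_small (2 * e) c ltac:(by rewrite mulr_gt0) c0.
exists (n * l.+1)%N => T pos J [pos3 J0 Jd] i j.
wlog : i j / (pos i <= pos j)%N => [H|ij].
  have [/H//|/ltnW/H] := leqP (pos i) (pos j).
  by rewrite gapC corrC.
rewrite /gap => nl.
apply: le_trans (corr_cuts e Cj e0 Cj0 pos J pos3 J0 Jd i j n l.+1 _ _) _ => //.
  by move: ij nl; clear; move: (n * l.+1)%N; lia.
rewrite -[_ * _ ^+ 2]/cb -/lam [leRHS](_ : z = z / 2 + z / 2); last by field.
apply: lerD => //; rewrite lerBlDl.
rewrite -[leRHS]lnK ?posrE ?addr_gt0 ?divr_gt0// ler_expR.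
have lc' : decay (2 * e) l.+1 <= c.
  by apply: le_trans lc; rewrite decay_anti// mulr_ge0// ltW.
apply: (@le_trans _ _ (n.+1%:R * (4 * cb + 1) * c)).
  have cb40 : 0 <= 4 * cb by lra.
  rewrite mulrA; apply: ler_pM => //.
  - by apply: mulr_ge0 cb40; exact: ler0n.
  - exact: decay_ge0.
  - by apply: ler_pM => //; rewrite ?ler_nat//; lra.
by rewrite /c mulrC divfK// gt_eqF.
Qed.

(** Simon's inequality for a large ball [B] around [i] bounds the correlations
    by a kernel whose rows sum to at most one half: the spins near the boundary
    of [B] are weakly correlated with [i], and the edges leaving [B] from its
    inner part are long. *)
Lemma ising_decay : exists2 C : R, 0 <= C &
  forall (T : finType) (pos : T -> nat) (J : T -> T -> R), power_law pos J ->
  (forall a b, J a b = J b a) ->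
  forall i j, corr J (edges T) i j <= C * decay p (gap (pos i) (pos j)).
Proof.
have cb0 : 0 <= cb by exact: cb_ge0.
have p0 : 0 < p by rewrite /p addr_gt0 ?mulr_gt0.
(* Small enough for the rows of the kernel [K] to sum to at most one half. *)
pose z := 64^-1 / (cb + 1).
have z0 : 0 < z by rewrite divr_gt0 ?invr_gt0// ltr_wpDl.
have [D far] := corr_far z z0.
have [l lz] := decay_small (2 * e) z ltac:(by rewrite mulr_gt0) z0.
pose M := (D + l)%N.
pose S : R := 6 * (1 + (1 + 4 * e)^-1).
have e4 : 0 < 1 + 4 * e by rewrite addr_gt0 ?mulr_gt0.
have S0 : 0 <= S by rewrite mulr_ge0// addr_ge0// invr_ge0 ltW.
have SE (T : finType) (pos : T -> nat) : (forall m : nat, (#|[pred a | pos a == m]| <= 3)%N) ->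
    forall k, \sum_a decay p (gap (pos k) (pos a)) <= S.
  move=> pos3 k.
  by rewrite /p (_ : 2 + 4 * e = 1 + (1 + 4 * e)); [exact: decay_sum|ring].
clearbody S.
pose dM := decay p M; have dM0 : 0 < dM by exact: decay_gt0.
pose Kk := 4 * Cj * (S + 6 * M.+1%:R) / dM.
have Kk0 : 0 <= Kk.
  apply: divr_ge0; last exact: ltW.
  by apply: mulr_ge0; [rewrite mulr_ge0|rewrite addr_ge0 ?mulr_ge0 ?ler0n].
have half01 : (0 < 2^-1 :> R) /\ (2^-1 < 1 :> R) by lra.
have dMV0 : 0 <= dM^-1 by rewrite invr_ge0 ltW.
have [C C0 HC] := resolvent_decay R 2^-1 p dM^-1 Kk S half01.1 half01.2 p0 dMV0 Kk0 S0.
exists C => // T pos J PJ JC i j; have [pos3 J0 Jd] := PJ.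
pose G a b := corr J (edges T) a b.
pose B i a := (gap (pos i) (pos a) <= M)%N.
have G0 a b : 0 <= G a b by exact: corr_ge0.
have G1 a b : G a b <= 1 by exact: le_trans (ler_norm _) (corr_le1 _ _ _ _).
have sepcross k a b : B k a != B k b ->
    crosses pos (pos k + M) a b || crosses pos (pos k - M.+1) a b.
  by rewrite /B /crosses /gap; clear; move: M => M; lia.
have sepsum k d : \sum_(ab : T * T | (B k ab.1 != B k ab.2) &&
    (d <= gap (pos ab.1) (pos ab.2))%N) J ab.1 ab.2 <= 4 * cb * decay (2 * e) d.
  apply: (@le_trans _ _ (2 * cb * decay (2 * e) d + 2 * cb * decay (2 * e) d)); last by lra.
  have cs z := crossing_sum e Cj e0 Cj0 pos J pos3 Jd z d.
  apply: le_trans (lerD (cs (pos k + M)%N) (cs (pos k - M.+1)%N)).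
  rewrite [leLHS]big_mkcond [X in _ <= X + _]big_mkcond [X in _ <= _ + X]big_mkcond/=.
  rewrite -big_split/=; apply: ler_sum => ab _.
  case: ifP => [/andP[/sepcross/orP[] -> ->]|_] /=.
  - by rewrite lerDl; case: ifP.
  - by rewrite lerDr; case: ifP.
  - by rewrite addr_ge0//; case: ifP.
pose K k b := 4 * \sum_(a | B k a != B k b) J a b * G k a.
have K0 a b : 0 <= K a b.
  by rewrite /K mulr_ge0// sumr_ge0// => c _; rewrite mulr_ge0.
pose A k b : R := if B k b then 1 else 0.
apply: (HC T pos G A K).
- exact: SE.
- exact: G0.
- by move=> a b; exact: corrC.
- exact: K0.
- move=> k; rewrite /K -mulr_sumr.
  have -> : \sum_b \sum_(a | B k a != B k b) J a b * G k a =
      \sum_(ab : T * T | B k ab.1 != B k ab.2) J ab.1 ab.2 * G k ab.1.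
    rewrite (exchange_big_dep xpredT)//= pair_big_dep/=.
    by apply: eq_bigl => -[].
  have step : \sum_(ab : T * T | B k ab.1 != B k ab.2) J ab.1 ab.2 * G k ab.1 <=
     z * (4 * cb) + 4 * cb * decay (2 * e) l.
    apply: (@le_trans _ _ (z * \sum_(ab : T * T | (B k ab.1 != B k ab.2) &&
        (0 <= gap (pos ab.1) (pos ab.2))%N) J ab.1 ab.2 +
      \sum_(ab : T * T | (B k ab.1 != B k ab.2) &&
        (l <= gap (pos ab.1) (pos ab.2))%N) J ab.1 ab.2)); last first.
      by apply: lerD => //; rewrite ler_wpM2l ?(ltW z0)//; have := sepsum k 0%N; rewrite decay0 mulr1.
    rewrite mulr_sumr [leLHS]big_mkcond [X in _ <= X + _]big_mkcond [X in _ <= _ + X]big_mkcond/=.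
    rewrite -big_split/=; apply: ler_sum => -[a b] _ /=; rewrite leq0n andbT.
    case: ifP => /= sep; last by rewrite ?addr0.
    have [Da|aD] := leqP D (gap (pos k) (pos a)).
      rewrite -[leLHS]addr0; apply: lerD; last by case: ifP.
      by rewrite mulrC ler_wpM2r//; exact: far.
    rewrite ifT; last first.
      by move: sep aD; rewrite /B /gap /M; clear; lia.
    rewrite -[leLHS]add0r; apply: lerD; first by rewrite mulr_ge0// ltW.
    by rewrite ler_piMr.
  apply: le_trans (ler_wpM2l _ step) _ => //.
  have zc : z * (cb + 1) = 64^-1 by rewrite /z divfK// gt_eqF// ltr_wpDl.
  have zcb : z * cb <= 64^-1 by rewrite -zc ler_wpM2l ?(ltW z0)//; lra.
  have : cb * decay (2 * e) l <= cb * z by rewrite ler_wpM2l.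
  by rewrite mulrC in zcb; lra.
- move=> k b.
  have dkb := decay_ge0 p (gap (pos k) (pos b)).
  have -> : Kk * decay p (gap (pos k) (pos b)) = 4 * (Cj * (S * (decay p (gap (pos k) (pos b)) / dM)
     + 6 * M.+1%:R * (decay p (gap (pos k) (pos b)) / dM))).
    by rewrite /Kk; field; rewrite gt_eqF.
  rewrite /K ler_wpM2l//.
  apply: (@le_trans _ _ (\sum_(a | B k a != B k b) Cj * decay p (gap (pos a) (pos b)))).
    by apply: ler_sum => a _; rewrite (le_trans _ (Jd a b))// ler_piMr.
  rewrite -mulr_sumr ler_wpM2l//.
  set q := decay p _ / dM; have q0 : 0 <= q by rewrite divr_ge0// ltW.
  case Bb : (B k b).
    apply: (@le_trans _ _ (S * q)); last by rewrite lerDl !mulr_ge0.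
    apply: (@le_trans _ _ S).
      apply: le_trans (SE _ _ pos3 b); rewrite big_mkcond/=; apply: ler_sum => a _.
      by rewrite gapC; case: ifP => // _; exact: decay_ge0.
    rewrite ler_peMr// ler_pdivlMr// mul1r decay_anti// ?(ltW p0)//.
  apply: (@le_trans _ _ (6 * M.+1%:R * q)); last by rewrite lerDr mulr_ge0.
  apply: (@le_trans _ _ (\sum_(a | B k a) q)).
    rewrite big_mkcond [leRHS]big_mkcond/=; apply: ler_sum => a _.
    case Ba : (B k a) => //=; rewrite ler_pdivlMr// mulrC.
    apply: (@le_trans _ _ (decay p (gap (pos k) (pos a)) * decay p (gap (pos a) (pos b)))).
      by rewrite ler_wpM2r ?decay_ge0// decay_anti// ltW.
    rewrite (le_trans (decayM_le _ _ _ (ltW p0)))// decay_anti ?(ltW p0)//.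
    exact: gap_triangle.
  rewrite sumr_const -[leLHS]mulr_natl ler_wpM2r// -natrM ler_nat.
  exact: (@ball_card R T pos pos3 (pos k) M).
- move=> a b; rewrite /A; case: ifP => [ab|_]; last by rewrite mulr_ge0// decay_ge0.
  by rewrite mulrC ler_pdivlMr// mul1r decay_anti// ltW.
- move=> a b; rewrite /A; case: ifPn => [_|Bab].
    apply: le_trans (G1 a b) _; rewrite lerDl sumr_ge0// => k _.
    exact: mulr_ge0.
  rewrite add0r.
  have Baa : B a a by rewrite /B /gap subnn.
  have := simon_ineq J (edges T) (B a) a b J0 Baa Bab.
  move=> /le_trans; apply.
  rewrite (eq_bigr (fun e => 2 * (J e.1 e.2 * (G a e.1 * G b e.2)) +
     2 * (J e.1 e.2 * (G a e.2 * G b e.1)))); last by move=> ? _; rewrite /G; ring.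
  rewrite big_split/= [X in _ + X](reindex_inj (h := fun ab : T * T => (ab.2, ab.1)))/=; last first.
    by move=> [? ?] [? ?]/= [-> ->].
  rewrite [X in _ + X](eq_bigl (fun ab : T * T => B a ab.1 != B a ab.2)) /=; last first.
    by move=> ab; rewrite eq_sym.
  rewrite -big_split/=.
  have -> : \sum_k K a k * G k b = \sum_(ab : T * T | B a ab.1 != B a ab.2)
      4 * (J ab.1 ab.2 * G a ab.1) * G ab.2 b.
    rewrite -(pair_big_dep xpredT (fun c k => B a c != B a k)
      (fun c k => 4 * (J c k * G a c) * G k b))/=.
    rewrite (exchange_big_dep xpredT)//=; apply: eq_bigr => k _.
    by rewrite /K mulr_sumr mulr_suml.
  apply: ler_sum => ab _; rewrite (JC ab.2) (_ : G ab.2 b = G b ab.2); last exact: corrC.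
  by rewrite le_eqVlt; apply/orP; left; apply/eqP; ring.
Qed.

End ising_decay.

(** * Integration over [R^n] *)

Section dominated_fubini.
Context d1 d2 (T1 : measurableType d1) (T2 : measurableType d2) (R : realType).
Context (m1 : {sigma_finite_measure set T1 -> \bar R}).
Context (m2 : {sigma_finite_measure set T2 -> \bar R}).
Context (f : T1 * T2 -> R) (G1 : T1 -> R) (G2 : T2 -> R).
Hypothesis mf : measurable_fun setT f.
Hypothesis iG1 : m1.-integrable setT (EFin \o G1).
Hypothesis iG2 : m2.-integrable setT (EFin \o G2).
Hypothesis fG : forall x y, `|f (x, y)| <= G1 x * G2 y.

Lemma dom_section1 x : m2.-integrable setT (EFin \o (fun y => f (x, y))).
Proof.
apply: (@le_integrable _ _ _ _ _ _ _ (EFin \o (fun y => G1 x * G2 y))) => //.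
- by apply/measurable_EFinP; apply: measurableT_comp.
- move=> y _ /=; rewrite lee_fin (le_trans (fG x y))// ler_norm//.
- exact: (integrableZl measurableT (G1 x) iG2).
Qed.

Lemma dom_section2 y : m1.-integrable setT (EFin \o (fun x => f (x, y))).
Proof.
apply: (@le_integrable _ _ _ _ _ _ _ (EFin \o (fun x => G1 x * G2 y))) => //.
- by apply/measurable_EFinP; apply: measurableT_comp.
- move=> x _ /=; rewrite lee_fin (le_trans (fG x y))// ler_norm//.
- exact: (integrableZr measurableT (G2 y) iG1).
Qed.

Lemma dom_integrable : (m1 \x m2)%E.-integrable setT (EFin \o f).
Proof.
apply/integrable12ltyP; first exact/measurable_EFinP.
apply: (@le_lt_trans _ _ (\int[m1]_x (`|(G1 x)%:E| * \int[m2]_y `|(G2 y)%:E|))%E).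
  apply: ge0_le_integral => //.
  - by move=> x _; exact: integral_ge0.
  - apply: (@measurable_fun_fubini_tonelli_F _ _ _ _ _ m2 (fun z => `|(f z)%:E|%E)) => //.
    by apply: measurableT_comp => //; exact/measurable_EFinP.
  - apply: emeasurable_funM => //; apply: measurableT_comp => //.
    exact: measurable_int iG1.
  - move=> x _; rewrite -ge0_integralZl//.
    + apply: ge0_le_integral => //=.
      * apply/measurable_EFinP; apply: measurableT_comp => //.
        exact: measurableT_comp.
      * apply/measurable_EFinP; apply: measurable_funM => //.
        by apply: measurableT_comp => //; exact/measurable_EFinP/measurable_int/iG2.
      * move=> y _; rewrite -EFinM lee_fin -normrM.
        exact: le_trans (fG x y) (ler_norm _).
    + by apply: measurableT_comp => //; exact: measurable_int iG2.
under eq_integral do rewrite muleC.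
rewrite ge0_integralZl//; last 2 first.
- by apply: measurableT_comp => //; exact: measurable_int iG1.
- exact: integral_ge0.
rewrite lte_mul_pinfty//; first exact: integral_ge0.
- rewrite ge0_fin_numE; first by case/integrableP : iG2.
  exact: integral_ge0.
- by case/integrableP : iG1.
Qed.

Lemma dom_outer1 : m1.-integrable setT (EFin \o (fun x => \int[m2]_y f (x, y))).
Proof.
rewrite (_ : EFin \o _ = fubini_F m2 (EFin \o f)).
  by apply: integrable_fubini_F; exact: dom_integrable.
apply/funext => x; rewrite /fubini_F /= /Rintegral fineK//.
exact/integrable_fin_num/dom_section1.
Qed.

Lemma Rfubini1 :
  \int[(m1 \x m2)%E]_z f z = \int[m1]_x \int[m2]_y f (x, y).
Proof.
rewrite {1 2}/Rintegral -integral12_prod_meas1; last exact: dom_integrable.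
congr fine; apply: eq_integral => x _; rewrite /Rintegral fineK//.
exact/integrable_fin_num/dom_section1.
Qed.

Lemma Rfubini2 :
  \int[(m1 \x m2)%E]_z f z = \int[m2]_y \int[m1]_x f (x, y).
Proof.
rewrite {1 2}/Rintegral -integral21_prod_meas1; last exact: dom_integrable.
congr fine; apply: eq_integral => x _; rewrite /Rintegral fineK//.
exact/integrable_fin_num/dom_section2.
Qed.

Lemma Rfubini :
  \int[m1]_x \int[m2]_y f (x, y) = \int[m2]_y \int[m1]_x f (x, y).
Proof. by rewrite -Rfubini1 Rfubini2. Qed.

End dominated_fubini.

Section lebesgue_Rn.
Context {R : realType}.
Local Notation leb := (@lebesgue_measure R).
Local Notation lam := (lebesgue_Rn R).

Lemma measurable_tuple_cons n :
  measurable_fun [set: measurableTypeR R * 'Rn[R]_n] (@tuple_cons R n).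
Proof. by apply: measurable_cons; [exact: measurable_fst|exact: measurable_snd]. Qed.

Lemma tnth_cons0 n (p : measurableTypeR R * 'Rn[R]_n) : tnth (tuple_cons p) ord0 = p.1.
Proof. by []. Qed.

Lemma tnth_consS n (p : measurableTypeR R * 'Rn[R]_n) k :
  tnth (tuple_cons p) (lift ord0 k) = tnth p.2 k.
Proof. by rewrite /tuple_cons tnthS. Qed.

Lemma measurable_coord n (k : 'I_n) :
  measurable_fun [set: 'Rn[R]_n] (fun x => tnth x k : R).
Proof. exact: (@measurable_tnth _ (measurableTypeR R) n k). Qed.

Lemma measurable_comp_coord n (k : 'I_n) (f : R -> R) : measurable_fun setT f ->
  measurable_fun [set: 'Rn[R]_n] (fun x => f (tnth x k)).
Proof. by move=> mf; exact: (measurableT_comp mf (measurable_coord n k)). Qed.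

Lemma ge0_integral_Rn_cons n (f : 'Rn[R]_n.+1 -> \bar R) :
  measurable_fun setT f -> (forall x, 0 <= f x)%E ->
  (\int[lam n.+1]_x f x = \int[leb]_a \int[lam n]_x f (tuple_cons (a, x)))%E.
Proof.
move=> mf f0.
transitivity (\int[pushforward (leb \x lam n) (@tuple_cons R n)]_x f x)%E => //.
rewrite ge0_integral_pushforward//; last exact: measurable_tuple_cons.
rewrite preimage_setT (@fubini_tonelli1 _ _ _ _ _ leb (lam n) (f \o @tuple_cons R n))//.
- by apply: measurableT_comp => //; exact: measurable_tuple_cons.
- by move=> x /=.
Qed.

Lemma integrable_Rn_cons n (f : 'Rn[R]_n.+1 -> \bar R) :
  measurable_fun setT f ->
  (leb \x lam n)%E.-integrable setT (f \o @tuple_cons R n) ->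
  (lam n.+1).-integrable setT f /\
  (\int[lam n.+1]_x f x = \int[(leb \x lam n)%E]_p f (tuple_cons p))%E.
Proof.
move=> mf fi; have mc := measurable_tuple_cons n.
split.
- apply/integrableP; split=> //.
  by have /integrableP[_] := integrable_pushforward mc mf fi measurableT.
- transitivity (\int[pushforward (leb \x lam n) (@tuple_cons R n)]_x f x)%E => //.
  by rewrite integral_pushforward.
Qed.

Lemma integral_Rn_prod n (f : 'I_n -> R -> R) :
  (forall k, leb.-integrable setT (EFin \o f k)) ->
  (lam n).-integrable setT (EFin \o (fun x => \prod_k f k (tnth x k))) /\
  \int[lam n]_x \prod_k f k (tnth x k) = \prod_k \int[leb]_a f k a.
Proof.
elim: n f => [|n IH] f fi.
  have E (x : 'Rn[R]_0) : \prod_k f k (tnth x k) = 1 by rewrite big_ord0.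
  split.
    rewrite (_ : EFin \o _ = cst 1%E); first by apply: finite_measure_integrable_cst.
    by apply/funext => x /=; rewrite big_ord0.
  rewrite big_ord0 /Rintegral; under eq_integral do rewrite E.
  have -> : (\int[lam 0%N]__ 1 = 1 :> \bar R)%E; last by [].
  have -> := @integral_cst _ _ R (lam 0%N) setT measurableT 1%E.
  by rewrite mul1e /= diracT.
have mf k : measurable_fun setT (f k) by apply/measurable_EFinP; exact: measurable_int (fi k).
have [gi gE] := IH (fun k => f (lift ord0 k)) (fun k => fi _).
pose g (x : 'Rn[R]_n) := \prod_k f (lift ord0 k) (tnth x k).
pose F (x : 'Rn[R]_n.+1) := \prod_k f k (tnth x k).
have FE p : F (tuple_cons p) = f ord0 p.1 * g p.2.
  rewrite /F /g big_ord_recl; rewrite tnth_cons0; congr (_ * _).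
  by apply: eq_bigr => k _; rewrite tnth_consS.
have mF : measurable_fun setT F.
  by apply: measurable_prod => k _; exact: measurable_comp_coord.
have mFc : measurable_fun setT (F \o @tuple_cons R n).
  by apply: measurableT_comp => //; exact: measurable_tuple_cons.
have iN d (T : measurableType d) (m : {measure set T -> \bar R}) (h : T -> R) :
    m.-integrable setT (EFin \o h) -> m.-integrable setT (EFin \o (fun x => `|h x|)).
  by move=> /integrable_abse; congr integrable.
have dom (a : measurableTypeR R) x : `|(F \o @tuple_cons R n) (a, x)| <= `|f ord0 a| * `|g x|.
  by rewrite /= FE normrM.
have [Fi FI] := integrable_Rn_cons _ (EFin \o F) (proj2 (measurable_EFinP _ _) mF)
  (dom_integrable _ _ _ _ _ leb (lam n) _ _ _ mFc (iN _ _ _ _ (fi ord0)) (iN _ _ _ _ gi) dom).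
split=> //.
rewrite {1}/Rintegral [X in fine X]FI -/(Rintegral _ _ (F \o @tuple_cons R n)).
rewrite (Rfubini1 _ _ _ _ _ leb (lam n) _ _ _ mFc (iN _ _ _ _ (fi ord0)) (iN _ _ _ _ gi) dom).
rewrite big_ord_recl -gE -RintegralZr//.
by apply: eq_Rintegral => a _ /=; under eq_Rintegral do rewrite FE/=; rewrite RintegralZl.
Qed.

End lebesgue_Rn.

Section affine.
Context {R : realType}.
Local Notation leb := (@lebesgue_measure R).
Local Notation lam := (lebesgue_Rn R).

Lemma lebesgue_translation (a : R) (A : set (measurableTypeR R)) : measurable A ->
  pushforward leb (fun x : measurableTypeR R => x + a) A = leb A.
Proof.
have ma : measurable_fun [set: measurableTypeR R]
    ((fun x : R => x + a) : measurableTypeR R -> measurableTypeR R).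
  by apply: measurable_funD => //; exact: measurable_id.
pose m := measure_function_pushforward__canonical__measure_function_Measure leb ma.
move=> mA; apply/esym/(@lebesgue_measure_unique R m) => //= _ [[b c]] _ <-.
rewrite /m /= /pushforward.
rewrite (_ : _ @^-1` _ = `]b - a, c - a]%classic); last first.
  by apply/seteqP; split => x /=; rewrite !in_itv/= ltrBlDr lerBrDr.
by rewrite !lebesgue_measure_itv/= !lte_fin ltrD2r -!EFinB opprB addrA subrK.
Qed.

(** A sign [s = 1] or [s = -1]: translations and reflections at once. *)
Lemma ge0_integral_affine1 (s a : R) (f : R -> \bar R) : s * s = 1 ->
  measurable_fun setT f -> (forall x, 0 <= f x)%E ->
  (\int[leb]_x f (s * x + a)%R = \int[leb]_x f x)%E.
Proof.
move=> ss mf f0.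
have tr (g : R -> \bar R) b : measurable_fun setT g -> (forall x, 0 <= g x)%E ->
    (\int[leb]_x g (x + b)%R = \int[leb]_x g x)%E.
  move=> mg g0.
  have mb : measurable_fun [set: measurableTypeR R]
      ((fun x : R => x + b) : measurableTypeR R -> measurableTypeR R).
    by apply: measurable_funD => //; exact: measurable_id.
  rewrite -(@ge0_integral_pushforward _ _ _ _ _ _ mb leb setT g)//.
  by apply: eq_measure_integral => A mA _; exact: lebesgue_translation.
have op (g : R -> \bar R) : measurable_fun setT g -> (forall x, 0 <= g x)%E ->
    (\int[leb]_x g (- x)%R = \int[leb]_x g x)%E.
  move=> mg g0.
  have mb : measurable_fun [set: measurableTypeR R]
      ((fun x : R => - x) : measurableTypeR R -> measurableTypeR R).
    by apply: measurableT_comp => //; exact: measurable_id.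
  rewrite -(@ge0_integral_pushforward _ _ _ _ _ _ mb leb setT g)//.
  by apply: eq_measure_integral => A mA _; exact: lebesgue_measureN.
have /eqP : (s - 1) * (s + 1) = 0 by rewrite mulrDr mulrBl ss; ring.
rewrite mulf_eq0 => /orP[]; rewrite ?subr_eq0 ?addr_eq0 => /eqP ->.
  by under eq_integral do rewrite mul1r; exact: tr.
under eq_integral do rewrite mulN1r.
rewrite (op (fun x => f (x + a)))// ?tr//.
apply: measurableT_comp => //; apply: measurable_funD => //; exact: measurable_id.
Qed.

Definition affine {n} (s : R) (t x : 'Rn[R]_n) : 'Rn[R]_n :=
  [tuple s * tnth x k + tnth t k | k < n].

Lemma tnth_affine n s (t x : 'Rn[R]_n) k :
  tnth (affine s t x) k = s * tnth x k + tnth t k.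
Proof. by rewrite tnth_mktuple. Qed.

Lemma measurable_tuple n d (T : measurableType d) (f : T -> 'Rn[R]_n) :
  (forall k, measurable_fun setT (fun x => tnth (f x) k : R)) -> measurable_fun setT f.
Proof. by move=> mf; apply/measurable_fun_tnthP => k; exact: mf. Qed.

Lemma measurable_affine n s (t : 'Rn[R]_n) : measurable_fun setT (affine s t).
Proof.
apply: measurable_tuple => k; under eq_fun do rewrite tnth_affine.
by apply: measurable_funD => //; apply: measurable_funM => //; exact: measurable_coord.
Qed.

Lemma ge0_integral_affine n s (t : 'Rn[R]_n) (f : 'Rn[R]_n -> \bar R) : s * s = 1 ->
  measurable_fun setT f -> (forall x, 0 <= f x)%E ->
  (\int[lam n]_x f (affine s t x) = \int[lam n]_x f x)%E.
Proof.
move=> ss; elim: n t f => [|n IH] t f mf f0.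
  by apply: eq_integral => x _; congr f; apply: eq_from_tnth => -[].
pose t' : 'Rn[R]_n := [tuple of behead t].
have tS (j : 'I_n) : tnth t (lift ord0 j) = tnth t' j.
  rewrite /t' tnth_behead; congr (tnth t _); apply/val_inj => /=.
  by rewrite inordK// ltnS.
have affE a (x : 'Rn[R]_n) :
    affine s t (tuple_cons (a, x)) = tuple_cons (s * a + thead t, affine s t' x).
  apply: eq_from_tnth => k; rewrite tnth_affine.
  case: (unliftP ord0 k) => [j ->|->]; last by [].
  by rewrite (tnth_consS _ (a, x) j) (tnth_consS _ (_, affine s t' x) j) tnth_affine tS.
rewrite ge0_integral_Rn_cons//; last first.
  by apply: measurableT_comp => //; exact: measurable_affine.
rewrite ge0_integral_Rn_cons//.
have mfc : measurable_fun setT (f \o @tuple_cons R n).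
  by apply: measurableT_comp => //; exact: measurable_tuple_cons.
rewrite -(ge0_integral_affine1 s (thead t) (fun a => \int[lam n]_x f (tuple_cons (a, x)))%E)//.
- apply: eq_integral => a _.
  rewrite -(IH t' (fun x => f (tuple_cons (s * a + thead t, x))))//.
  + by apply: eq_integral => x _; rewrite affE.
  + exact: (measurableT_comp mfc).
- by apply: (@measurable_fun_fubini_tonelli_F _ _ _ _ _ (lam n) (f \o @tuple_cons R n)) => // p /=.
- by move=> a; exact: integral_ge0.
Qed.

Lemma integral_affine n s (t : 'Rn[R]_n) (f : 'Rn[R]_n -> R) : s * s = 1 ->
  measurable_fun setT f ->
  \int[lam n]_x f (affine s t x) = \int[lam n]_x f x.
Proof.
move=> ss mf; have mEf : measurable_fun setT (EFin \o f) by exact/measurable_EFinP.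
rewrite /Rintegral; congr fine; rewrite integralE [RHS]integralE.
congr (_ - _)%E.
- rewrite -[RHS](ge0_integral_affine n s t _ ss (measurable_funepos mEf) (funepos_ge0 _)).
  by apply: eq_integral => x _; rewrite !funeposE.
- rewrite -[RHS](ge0_integral_affine n s t _ ss (measurable_funeneg mEf) (funeneg_ge0 _)).
  by apply: eq_integral => x _; rewrite !funenegE.
Qed.

Lemma integrable_affine n s (t : 'Rn[R]_n) (f : 'Rn[R]_n -> R) : s * s = 1 ->
  (lam n).-integrable setT (EFin \o f) ->
  (lam n).-integrable setT (EFin \o (fun x => f (affine s t x))).
Proof.
move=> ss fi; have mEf := measurable_int _ fi; apply/integrableP; split.
  by apply: (measurableT_comp mEf); exact: measurable_affine.
case/integrableP : fi => _; rewrite -(ge0_integral_affine n s t)//.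
exact: measurableT_comp.
Qed.

Lemma Rintegral_opp (f : R -> R) : measurable_fun setT f ->
  \int[leb]_x f (- x) = \int[leb]_x f x.
Proof.
move=> mf; have mEf : measurable_fun setT (EFin \o f) by exact/measurable_EFinP.
have ss : (-1) * (-1) = 1 :> R by rewrite mulrNN mulr1.
rewrite /Rintegral; congr fine; rewrite integralE [RHS]integralE.
congr (_ - _)%E.
- rewrite -[RHS](ge0_integral_affine1 _ 0 _ ss (measurable_funepos mEf) (funepos_ge0 _)).
  by apply: eq_integral => x _; rewrite !funeposE /= mulN1r addr0.
- rewrite -[RHS](ge0_integral_affine1 _ 0 _ ss (measurable_funeneg mEf) (funeneg_ge0 _)).
  by apply: eq_integral => x _; rewrite !funenegE /= mulN1r addr0.
Qed.

Lemma Rintegral_shift (a : R) (f : R -> R) : measurable_fun setT f ->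
  \int[leb]_x f (x + a) = \int[leb]_x f x.
Proof.
move=> mf; have mEf : measurable_fun setT (EFin \o f) by exact/measurable_EFinP.
have ss : 1 * 1 = 1 :> R by rewrite mulr1.
rewrite /Rintegral; congr fine; rewrite integralE [RHS]integralE.
congr (_ - _)%E.
- rewrite -[RHS](ge0_integral_affine1 _ a _ ss (measurable_funepos mEf) (funepos_ge0 _)).
  by apply: eq_integral => x _; rewrite !funeposE /= mul1r.
- rewrite -[RHS](ge0_integral_affine1 _ a _ ss (measurable_funeneg mEf) (funeneg_ge0 _)).
  by apply: eq_integral => x _; rewrite !funenegE /= mul1r.
Qed.

(** ** Gaussian domination *)

Lemma integrable_gauss1 (e : R) : 0 < e ->
  leb.-integrable setT (EFin \o (fun x => expR (- (e * x ^+ 2)))).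
Proof.
move=> e0; pose s := Num.sqrt ((2 * e)^-1).
have s0 : s != 0 by rewrite gt_eqF// sqrtr_gt0 invr_gt0 mulr_gt0.
have := integrable_normal_pdf 0 s; rewrite normal_pdfE//.
move=> /(integrableZl measurableT (normal_peak s)^-1); congr integrable.
apply/funext => x /=; rewrite -EFinM mulrA mulVf ?mul1r; last first.
  by rewrite gt_eqF// normal_peak_gt0.
rewrite /normal_fun subr0 sqr_sqrtr ?invr_ge0 ?mulr_ge0 ?(ltW e0)//.
by congr (expR _)%:E; field; rewrite gt_eqF.
Qed.

Definition gauss {n} (e : R) (x : 'Rn[R]_n) : R :=
  \prod_k expR (- (e * tnth x k ^+ 2)).

Lemma gaussE n e (x : 'Rn[R]_n) : gauss e x = expR (- (e * \sum_k tnth x k ^+ 2)).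
Proof. by rewrite /gauss -expR_sum sumrN mulr_sumr. Qed.

Lemma integrable_gauss n e : 0 < e -> (lam n).-integrable setT (EFin \o gauss e).
Proof.
by move=> e0; case: (integral_Rn_prod n _ (fun=> integrable_gauss1 e e0)).
Qed.

Lemma gauss_gt0 n e (x : 'Rn[R]_n) : 0 < gauss e x.
Proof. by rewrite gaussE expR_gt0. Qed.

Lemma integrable_dom d (T : measurableType d) (m : {measure set T -> \bar R})
    (f g : T -> R) :
  measurable_fun setT f -> m.-integrable setT (EFin \o g) ->
  (forall x, `|f x| <= g x) -> m.-integrable setT (EFin \o f).
Proof.
move=> mf ig fg; apply: (le_integrable measurableT _ _ ig); first exact/measurable_EFinP.
by move=> x _ /=; rewrite lee_fin (le_trans (fg x))// ler_norm.
Qed.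

Lemma integrableZ d (T : measurableType d) (m : {measure set T -> \bar R})
    (f : T -> R) c :
  m.-integrable setT (EFin \o f) -> m.-integrable setT (EFin \o (fun x => c * f x)).
Proof. by move=> fi; exact: (integrableZl measurableT c fi). Qed.

Lemma integrableRB d (T : measurableType d) (m : {measure set T -> \bar R})
    (f g : T -> R) :
  m.-integrable setT (EFin \o f) -> m.-integrable setT (EFin \o g) ->
  m.-integrable setT (EFin \o (fun x => f x - g x)).
Proof. by move=> fi gi; exact: (integrableB measurableT fi gi). Qed.

Lemma integrableRD d (T : measurableType d) (m : {measure set T -> \bar R})
    (f g : T -> R) :
  m.-integrable setT (EFin \o f) -> m.-integrable setT (EFin \o g) ->
  m.-integrable setT (EFin \o (fun x => f x + g x)).
Proof. by move=> fi gi; exact: (integrableD measurableT fi gi). Qed.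

Lemma gauss_dom n (f : 'Rn[R]_n -> R) (C e : R) : measurable_fun setT f -> 0 < e ->
  (forall x, `|f x| <= C * gauss e x) -> (lam n).-integrable setT (EFin \o f).
Proof.
by move=> mf e0; apply: integrable_dom => //; apply: integrableZ; exact: integrable_gauss.
Qed.

Lemma gauss_dom1 (f : R -> R) (C e : R) : measurable_fun setT f -> 0 < e ->
  (forall x, `|f x| <= C * expR (- (e * x ^+ 2))) -> leb.-integrable setT (EFin \o f).
Proof.
move=> mf e0 fd; apply: (@integrable_dom _ (measurableTypeR R) leb f _ mf _ fd).
exact: integrableZ (integrable_gauss1 e e0).
Qed.

Lemma Rintegral_gauss1_gt0 (e : R) : 0 < e -> 0 < \int[leb]_x expR (- (e * x ^+ 2)).
Proof.
move=> e0; pose s := Num.sqrt ((2 * e)^-1).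
have s0 : s != 0 by rewrite gt_eqF// sqrtr_gt0 invr_gt0 mulr_gt0.
have p0 := normal_peak_gt0 s0.
suff E : normal_peak s * \int[leb]_x expR (- (e * x ^+ 2)) = 1.
  by rewrite -(pmulr_rgt0 _ p0) E.
rewrite -RintegralZl//; last exact: integrable_gauss1.
have := integral_normal_pdf 0 s; rewrite normal_pdfE// => I1.
rewrite -[RHS]/(fine 1%E) -I1 /Rintegral; congr fine; apply: eq_integral => x _.
rewrite /normal_fun subr0 sqr_sqrtr ?invr_ge0 ?mulr_ge0 ?(ltW e0)//.
by congr (_ * expR _)%:E; field; rewrite gt_eqF.
Qed.

Lemma Rintegral_gauss_gt0 n e : 0 < e -> 0 < \int[lam n]_x gauss e x.
Proof.
move=> e0; rewrite (integral_Rn_prod n _ (fun=> integrable_gauss1 e e0)).2.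
by apply: prodr_gt0 => k _; exact: Rintegral_gauss1_gt0.
Qed.

End affine.

(** * Comparison of two even densities on the line *)

Section hyperbolic.
Context {R : realType}.
Implicit Types x y u v : R.

Definition cosh x : R := (expR x + expR (- x)) / 2.
Definition sinh x : R := (expR x - expR (- x)) / 2.

Lemma coshN x : cosh (- x) = cosh x.
Proof. by rewrite /cosh opprK addrC. Qed.

Lemma cosh_norm x : cosh `|x| = cosh x.
Proof. by case: (ger0P x) => _; rewrite ?coshN. Qed.

Lemma cosh_gt0 x : 0 < cosh x.
Proof. by rewrite divr_gt0// addr_gt0 ?expR_gt0. Qed.

Lemma cosh_ge0 x : 0 <= cosh x. Proof. exact/ltW/cosh_gt0. Qed.

Lemma ler_cosh x y : `|x| <= `|y| -> cosh x <= cosh y.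
Proof.
rewrite -(cosh_norm x) -(cosh_norm y); move: `|x| `|y| (normr_ge0 x) => {}x {}y x0 xy.
have p1 : 1 <= expR x by rewrite -expR0 ler_expR.
have pq : expR x <= expR y by rewrite ler_expR.
rewrite /cosh ler_pM2r ?invr_gt0// !expRN.
move: (expR x) (expR y) p1 pq => p q p1 pq.
have p0 : 0 < p by lra.
have q0 : 0 < q by lra.
rewrite -subr_ge0 (_ : _ - _ = (q - p) * (p * q - 1) / (p * q)); last first.
  by field; rewrite !gt_eqF.
by rewrite divr_ge0 ?mulr_ge0 ?subr_ge0 ?(ltW p0) ?(ltW q0)//; nra.
Qed.

Lemma cosh_le_expR x : cosh x <= expR `|x|.
Proof.
rewrite -cosh_norm; move: `|x| (normr_ge0 x) => {}x x0.
have : expR (- x) <= expR x by rewrite ler_expR; lra.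
by rewrite /cosh; lra.
Qed.

(** Beyond [1] the logarithmic derivative [tanh] of [cosh] exceeds one half. *)
Lemma cosh_growth u v : 1 <= u -> 0 <= v -> cosh u * expR (v / 2) <= cosh (u + v).
Proof.
move=> u1 v0; rewrite /cosh !expRN expRD.
have -> : expR v = expR (v / 2) ^+ 2 by rewrite -expRM_natl; congr expR; field.
have t1 : 1 <= expR (v / 2) by rewrite -expR0 ler_expR divr_ge0.
have p3 : 3 <= expR u ^+ 2.
  by rewrite -expRM_natl (le_trans _ (expR_ge1Dx _))//; lra.
move: (expR u) (expR (v / 2)) (expR_gt0 u) p3 t1 => p t p0 p3 t1.
have t0 : 0 < t by lra.
rewrite -subr_ge0 (_ : _ - _ = (t - 1) * (p ^+ 2 * t ^+ 3 - (t ^+ 2 + t + 1)) / (2 * p * t ^+ 2)); last first.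
  by field; rewrite !gt_eqF.
apply: divr_ge0; last by rewrite !mulr_ge0 ?exprn_ge0// ltW.
apply: mulr_ge0; first by rewrite subr_ge0.
rewrite subr_ge0 (@le_trans _ _ (3 * t ^+ 3))//; last by rewrite ler_wpM2r// exprn_ge0// ltW.
have t2 : t <= t ^+ 2 by rewrite expr2 ler_peMr// ltW.
have t3 : t ^+ 2 <= t ^+ 3 by rewrite [leRHS]exprSr ler_peMr// exprn_ge0// ltW.
by lra.
Qed.

Lemma cosh_surj v : 1 <= v -> exists2 u, 0 <= u & cosh u = v.
Proof.
move=> v1; pose w := Num.sqrt (v ^+ 2 - 1).
have v21 : 0 <= v ^+ 2 - 1 by rewrite subr_ge0 expr_ge1//; lra.
have w2 : w ^+ 2 = v ^+ 2 - 1 by rewrite sqr_sqrtr.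
have w0 : 0 <= w by exact: sqrtr_ge0.
exists (ln (v + w)); first by rewrite ln_ge0//; lra.
have vw0 : 0 < v + w by lra.
rewrite /cosh expRN lnK ?posrE//.
have -> : (v + w)^-1 = v - w.
  apply: (mulfI (lt0r_neq0 vw0)); rewrite divff ?gt_eqF//.
  by rewrite mulrC -subr_sqr w2; ring.
by field.
Qed.

Lemma cosh1_le : cosh 1 <= expR 1.
Proof. by have := cosh_le_expR 1; rewrite normr1. Qed.

Lemma gauss_exp_le (a k x : R) : 0 < a ->
  expR (k * `|x|) * expR (- (a * x ^+ 2)) <=
  expR (k ^+ 2 / (2 * a)) * expR (- (a / 2 * x ^+ 2)).
Proof.
move=> a0; rewrite -!expRD ler_expR -[x ^+ 2]real_normK ?num_real//.
move: `|x| => y; rewrite -subr_ge0.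
rewrite (_ : _ - _ = (a * y - k) ^+ 2 / (2 * a)); last by field; rewrite gt_eqF.
by rewrite divr_ge0 ?sqr_ge0// mulr_ge0// ltW.
Qed.

Lemma poly_le_expR (N : nat) x : (1 + `|x|) ^+ N <= expR (N%:R * `|x|).
Proof.
rewrite expRM_natl; apply: lerXn2r; rewrite ?nnegrE ?expR_ge0 ?addr_ge0//.
exact: expR_ge1Dx.
Qed.

End hyperbolic.

Section gauss_mgf1.
Context {R : realType}.
Local Notation leb := (@lebesgue_measure R).

Lemma measurable_gaussian (a : R) : measurable_fun setT (fun x : R => expR (- (a * x ^+ 2))).
Proof.
apply: measurableT_comp => //; apply: measurableT_comp => //.
by apply: measurable_funM => //; exact: measurable_funX.
Qed.

Lemma measurable_cosh (c : R) : measurable_fun setT (fun x : R => cosh (c * x)).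
Proof.
apply: measurable_funM => //; apply: measurable_funD; apply: measurableT_comp => //.
by apply: measurableT_comp => //; exact: measurable_funM.
Qed.

Lemma Rintegral_cosh_gauss (a c : R) : 0 < a ->
  \int[leb]_x (cosh (c * x) * expR (- (a * x ^+ 2))) =
  expR (c ^+ 2 / (4 * a)) * \int[leb]_x expR (- (a * x ^+ 2)).
Proof.
move=> a0; pose g d (x : R) := expR (- (a * (x + d) ^+ 2)).
have mg d : measurable_fun setT (g d).
  apply: measurableT_comp => //; apply: measurableT_comp => //.
  by apply: measurable_funM => //; apply: measurable_funX => //; exact: measurable_funD.
have gi d : leb.-integrable setT (EFin \o g d).
  apply: (gauss_dom1 (g d) (expR (a * d ^+ 2)) (a / 2) (mg d)); first by rewrite divr_gt0.
  move=> x; rewrite ger0_norm ?expR_ge0// -expRD ler_expR -subr_ge0.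
  rewrite (_ : _ - _ = a / 2 * (x + 2 * d) ^+ 2); last by field.
  by rewrite mulr_ge0 ?sqr_ge0// divr_ge0// ltW.
have gE d : \int[leb]_x g d x = \int[leb]_x expR (- (a * x ^+ 2)).
  by rewrite -(Rintegral_shift d (fun x => expR (- (a * x ^+ 2))))//; exact: measurable_gaussian.
pose d := c / (2 * a).
have -> : \int[leb]_x (cosh (c * x) * expR (- (a * x ^+ 2))) =
    \int[leb]_x (expR (c ^+ 2 / (4 * a)) / 2 * g d x + expR (c ^+ 2 / (4 * a)) / 2 * g (- d) x).
  apply: eq_Rintegral => x _; rewrite -mulrDr.
  have E s : s * s = 1 -> expR (s * (c * x)) * expR (- (a * x ^+ 2)) =
      expR (c ^+ 2 / (4 * a)) * g (- (s * d)) x.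
    move=> ss; rewrite /g -!expRD; congr expR; rewrite /d.
    rewrite (_ : (x - s * _) ^+ 2 = x ^+ 2 - 2 * x * s * (c / (2 * a)) + s * s * (c / (2 * a)) ^+ 2); last by ring.
    by rewrite ss; field; rewrite gt_eqF.
  have ss : -1 * -1 = 1 :> R by rewrite mulrNN mulr1.
  have E1 := E 1 (mulr1 1); have E2 := E (-1) ss.
  rewrite !mul1r in E1; rewrite !mulN1r opprK in E2.
  by rewrite /cosh mulrAC mulrDl E1 E2; field.
set K := expR (c ^+ 2 / (4 * a)); clearbody K g.
rewrite RintegralD//; [|exact: integrableZ|exact: integrableZ].
have Z k d' : \int[leb]_x (k * g d' x) = k * \int[leb]_x g d' x by exact: RintegralZl.
by rewrite (Z _ d) (Z _ (- d)) !gE -mulrDl -splitr.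
Qed.

End gauss_mgf1.

Section one_site.
Context {R : realType} (a b c : R) (kap bet : R -> R).
Local Notation leb := (@lebesgue_measure R).
Hypotheses (a0 : 0 < a) (b0 : 0 <= b) (c1 : 1 <= c) (cb : 2 * b <= c)
  (cab : 4 * a * (2 * b + 1) <= c ^+ 2).
Hypotheses (mkap : measurable_fun setT kap) (mbet : measurable_fun setT bet).
Hypothesis kap_mono : forall x y, `|x| <= `|y| -> kap x <= kap y.
Hypothesis bet_b : forall x, `|bet x| <= b.
Hypothesis bet_lip : forall x y, bet x - bet y <= b * `| `|x| - `|y| |.

Let c0 : 0 <= c. Proof. exact: le_trans ler01 c1. Qed.

(** The factor [cosh (c * x)] grows faster than the perturbation [bet] varies, and
    splits into two exponentials, whose Gaussian integrals are explicit. *)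
Definition dens_hi (x : R) : R := cosh (c * x) * expR (- (a * x ^+ 2)).
Definition dens_lo (x : R) : R := expR (- kap x - bet x - a * x ^+ 2).

Lemma measurable_dens_hi : measurable_fun setT dens_hi.
Proof. by apply: measurable_funM; [exact: measurable_cosh|exact: measurable_gaussian]. Qed.

Lemma measurable_dens_lo : measurable_fun setT dens_lo.
Proof.
apply: measurableT_comp => //; apply: measurable_funB; last first.
  by apply: measurable_funM => //; exact: measurable_funX.
by apply: measurable_funB => //; exact: measurableT_comp.
Qed.

Lemma dens_hi_ge0 x : 0 <= dens_hi x.
Proof. by rewrite mulr_ge0 ?cosh_ge0 ?expR_ge0. Qed.

Lemma dens_lo_ge0 x : 0 <= dens_lo x. Proof. exact: expR_ge0. Qed.

Lemma dens_hiN x : dens_hi (- x) = dens_hi x.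
Proof. by rewrite /dens_hi mulrN coshN sqrrN. Qed.

Lemma dens_loN x : dens_lo (- x) = dens_lo x.
Proof.
have kE : kap (- x) = kap x by apply/eqP; rewrite eq_le !kap_mono ?normrN.
have bE : bet (- x) = bet x.
  apply/eqP; rewrite eq_le -!(subr_le0 _ (bet _)).
  by rewrite !(le_trans (bet_lip _ _))// normrN subrr normr0 mulr0.
by rewrite /dens_lo kE bE sqrrN.
Qed.

Lemma integrable_dens_hi (N : nat) :
  leb.-integrable setT (EFin \o (fun x => (1 + `|x|) ^+ N * dens_hi x)).
Proof.
apply: (gauss_dom1 _ (expR ((N%:R + c) ^+ 2 / (2 * a))) (a / 2)).
- apply: measurable_funM => //; last exact: measurable_dens_hi.
  by apply: measurable_funX => //; apply: measurable_funD => //; exact: measurableT_comp.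
- by rewrite divr_gt0.
- move=> x; rewrite ger0_norm ?mulr_ge0 ?dens_hi_ge0 ?exprn_ge0 ?addr_ge0//.
  apply: le_trans (gauss_exp_le _ _ _ a0); rewrite /dens_hi mulrA ler_wpM2r ?expR_ge0//.
  rewrite mulrDl expRD; apply: ler_pM; rewrite ?cosh_ge0 ?exprn_ge0 ?addr_ge0//.
    exact: poly_le_expR.
  by rewrite (le_trans (cosh_le_expR _))// ler_expR normrM (ger0_norm c0).
Qed.

Lemma integrable_dens_lo (N : nat) :
  leb.-integrable setT (EFin \o (fun x => (1 + `|x|) ^+ N * dens_lo x)).
Proof.
apply: (gauss_dom1 _ (expR (- kap 0 + b) * expR (N%:R ^+ 2 / (2 * a))) (a / 2)).
- apply: measurable_funM => //; last exact: measurable_dens_lo.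
  by apply: measurable_funX => //; apply: measurable_funD => //; exact: measurableT_comp.
- by rewrite divr_gt0.
- move=> x; rewrite ger0_norm ?mulr_ge0 ?dens_lo_ge0 ?exprn_ge0 ?addr_ge0//.
  rewrite -mulrA; apply: le_trans (ler_wpM2l (expR_ge0 _) (gauss_exp_le _ _ _ a0)).
  rewrite mulrCA; apply: ler_pM; rewrite ?dens_lo_ge0 ?exprn_ge0 ?addr_ge0//.
    exact: poly_le_expR.
  rewrite -expRD ler_expR; have := kap_mono 0 x; rewrite normr0 normr_ge0 => /(_ isT).
  by have := bet_b x; rewrite ler_norml => /andP[]; lra.
Qed.

Definition pol (m n : nat) (x y : R) : R := (x + y) ^+ m * (x - y) ^+ n.

Lemma pol_le m n x y : `|pol m n x y| <= (1 + `|x|) ^+ (m + n) * (1 + `|y|) ^+ (m + n).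
Proof.
rewrite -exprMn /pol normrM !normrX exprD.
have H z : `|z| <= `|x| + `|y| -> `|z| <= (1 + `|x|) * (1 + `|y|).
  by move=> /le_trans; apply; have := normr_ge0 x; have := normr_ge0 y; nra.
by apply: ler_pM; rewrite ?exprn_ge0//; apply: lerXn2r;
  rewrite ?nnegrE ?mulr_ge0 ?addr_ge0//; apply: H; rewrite ?ler_normD ?ler_normB.
Qed.

Lemma measurable_pol m n :
  measurable_fun [set: measurableTypeR R * measurableTypeR R] (fun p => pol m n p.1 p.2 : R).
Proof.
by apply: measurable_funM; apply: measurable_funX;
  [apply: measurable_funD|apply: measurable_funB]; first
  [exact: measurable_fst|exact: measurable_snd].
Qed.

(** Away from the origin the logarithm of [cosh (c * x)] grows at a rate of at
    least [c / 2 >= b], and [kap] only helps. *)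
Lemma dens_cross x y : `|y| <= `|x| -> 1 <= c * `|y| ->
  dens_hi y * dens_lo x <= dens_hi x * dens_lo y.
Proof.
move=> yx cy; rewrite /dens_hi /dens_lo.
rewrite -[cosh (c * y)]cosh_norm -[cosh (c * x)]cosh_norm !normrM (ger0_norm c0).
have := cosh_growth _ (c * (`|x| - `|y|)) cy.
rewrite mulr_ge0 ?subr_ge0 ?c0// => /(_ isT).
rewrite [c * `|y| + _](_ : _ = c * `|x|); last by ring.
move=> gr.
have := kap_mono y x yx.
have := bet_lip y x; rewrite distrC (ger0_norm (_ : 0 <= `|x| - `|y|)) ?subr_ge0// => lip km.
set X := `|x| in yx gr lip *; set Y := `|y| in yx cy gr lip *.
rewrite (_ : cosh (c * Y) * _ * _ = cosh (c * Y) *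
  expR (- kap x - bet x - a * x ^+ 2 - a * y ^+ 2)); last first.
  by rewrite -mulrA -expRD; congr (_ * expR _); ring.
rewrite (_ : cosh (c * X) * _ * _ = cosh (c * X) *
  expR (- kap y - bet y - a * x ^+ 2 - a * y ^+ 2)); last first.
  by rewrite -mulrA -expRD; congr (_ * expR _); ring.
apply: le_trans (ler_wpM2r (expR_ge0 _) gr).
rewrite -[leRHS]mulrA ler_wpM2l ?cosh_ge0// -expRD ler_expR.
have : b * (X - Y) <= c * (X - Y) / 2.
  by rewrite mulrAC ler_wpM2r ?subr_ge0//; have := cb; lra.
by lra.
Qed.

Section odd.
Variables k l : nat.
Let m := k.*2.+1.
Let n := l.*2.+1.

Let oddXN (z : R) h : (- z) ^+ h.*2.+1 = - z ^+ h.*2.+1.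
Proof. by rewrite exprNn exprS -mul2n exprM sqrrN !expr1n mulr1 mulN1r. Qed.

(** Both densities are even, so that [pol] may be symmetrized in [x]. The result is
    antisymmetric in [x] and [y], and nonnegative for [|x| >= |y|]: it is the
    difference of its positive part [opolp] and the transpose of [opolp]. *)
Definition opol x y := pol m n x y + pol m n (- x) y.
Definition opolp x y := Num.max (opol x y) 0.

Lemma opolE x y : opol x y = (x + y) ^+ m * (x - y) ^+ n + (x - y) ^+ m * (x + y) ^+ n.
Proof.
rewrite /opol /pol (_ : - x + y = - (x - y)); last by ring.
rewrite (_ : - x - y = - (x + y)); last by ring.
by rewrite !oddXN mulrNN.
Qed.

Lemma opolN x y : opol y x = - opol x y.
Proof.
rewrite !opolE (_ : y - x = - (x - y)); last by ring.
by rewrite (addrC y) !oddXN mulrN mulNr -opprD addrC.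
Qed.

Lemma opol_norm x y : opol x y = opol `|x| `|y|.
Proof.
have N1 z w : opol (- z) w = opol z w by rewrite /opol opprK addrC.
have N2 z w : opol z (- w) = opol z w.
  by rewrite !opolE opprK addrC; congr (_ + _); rewrite mulrC.
by case: (ger0P x) => _; case: (ger0P y) => _; rewrite ?N1 ?N2.
Qed.

Lemma opol_mono x x' y : `|y| <= `|x| -> `|x| <= `|x'| -> opol x y <= opol x' y.
Proof.
rewrite (opol_norm x) (opol_norm x') !opolE.
move: `|x| `|x'| `|y| (normr_ge0 y) => {}x {}x' {}y y0 yx xx.
by apply: lerD; apply: ler_pM; rewrite ?exprn_ge0//; try lra;
  apply: lerXn2r; rewrite ?nnegrE; lra.
Qed.

Lemma opol_diag x y : `|x| = `|y| -> opol x y = 0.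
Proof. by rewrite opol_norm opolE => ->; rewrite subrr /m /n !exprS !mul0r mulr0 addr0. Qed.

Lemma opolp_ge0 x y : 0 <= opolp x y.
Proof. by rewrite le_max lexx orbT. Qed.

Lemma opolp_eq0 x y : `|x| <= `|y| -> opolp x y = 0.
Proof.
move=> xy; apply/max_idPr; rewrite -oppr_ge0 -opolN -(opol_diag x x)//.
rewrite (opol_norm x x) (opol_norm y x).
by apply: opol_mono; rewrite ?normr_id.
Qed.

Lemma opolp_mono x x' y : `|x| <= `|x'| -> opolp x y <= opolp x' y.
Proof.
move=> xx; have [xy|/ltW yx] := leP `|x| `|y|; first by rewrite opolp_eq0// opolp_ge0.
by rewrite /opolp ge_max !le_max opol_mono//= lexx orbT.
Qed.

Lemma opolp_sub x y : opolp x y - opolp y x = opol x y.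
Proof.
rewrite /opolp (opolN x y); have [h|h] := leP 0 (opol x y).
  by rewrite (max_idPr _) ?subr0// oppr_le0.
by rewrite (max_idPl _) ?sub0r ?opprK// oppr_ge0 ltW.
Qed.

End odd.
Local Notation leb2 := (leb \x leb)%E.

(** Polynomial growth against the two densities: what Fubini's theorem needs. *)
Definition well_dominated (f : R -> R -> R) (r1 r2 : R -> R) := exists N : nat,
  [/\ measurable_fun [set: measurableTypeR R * measurableTypeR R]
        (fun p => f p.1 p.2 * (r1 p.1 * r2 p.2) : R),
      forall x y, `|f x y * (r1 x * r2 y)| <=
        2 * ((1 + `|x|) ^+ N * r1 x) * ((1 + `|y|) ^+ N * r2 y),
      leb.-integrable setT (EFin \o (fun x => 2 * ((1 + `|x|) ^+ N * r1 x))) &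
      leb.-integrable setT (EFin \o (fun x => (1 + `|x|) ^+ N * r2 x))].

Lemma well_dominatedP (f : R -> R -> R) (r1 r2 : R -> R) (N : nat) :
  measurable_fun [set: measurableTypeR R * measurableTypeR R] (fun p => f p.1 p.2 : R) ->
  (forall x y, `|f x y| <= 2 * ((1 + `|x|) ^+ N * (1 + `|y|) ^+ N)) ->
  (r1 = dens_hi /\ r2 = dens_lo) \/ (r1 = dens_lo /\ r2 = dens_hi) ->
  well_dominated f r1 r2.
Proof.
move=> mf fN r12; exists N.
have [mr1 mr2 [r10 r20] [i1 i2]] : [/\ measurable_fun setT r1, measurable_fun setT r2,
    (forall x, 0 <= r1 x) /\ (forall x, 0 <= r2 x) &
    leb.-integrable setT (EFin \o (fun x => (1 + `|x|) ^+ N * r1 x)) /\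
    leb.-integrable setT (EFin \o (fun x => (1 + `|x|) ^+ N * r2 x))].
  case: r12 => -[-> ->]; split; try split;
    by [exact: measurable_dens_hi|exact: measurable_dens_lo|exact: dens_hi_ge0|
        exact: dens_lo_ge0|exact: integrable_dens_hi|exact: integrable_dens_lo].
split=> //.
- apply: measurable_funM => //; apply: measurable_funM.
  + exact: (measurableT_comp mr1 measurable_fst).
  + exact: (measurableT_comp mr2 measurable_snd).
- move=> x y; rewrite normrM (ger0_norm (mulr_ge0 (r10 x) (r20 y))).
  apply: le_trans (ler_wpM2r (mulr_ge0 (r10 x) (r20 y)) (fN x y)) _.
  by rewrite le_eqVlt; apply/orP; left; apply/eqP; ring.
- exact: integrableZ.
Qed.

Lemma pol_dominated m n : well_dominated (pol m n) dens_hi dens_lo.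
Proof.
apply: (well_dominatedP _ _ _ (m + n)); [exact: measurable_pol| |by left].
move=> x y; apply: le_trans (pol_le m n x y) _.
by rewrite ler_peMl ?mulr_ge0 ?exprn_ge0 ?addr_ge0//; lra.
Qed.

Section well_dominated.
Variables (f : R -> R -> R) (r1 r2 : R -> R).
Hypothesis fd : well_dominated f r1 r2.

Lemma wd_int2 : leb2.-integrable setT (EFin \o (fun p => f p.1 p.2 * (r1 p.1 * r2 p.2))).
Proof.
by case: fd => N [mf fN i1 i2]; exact: (dom_integrable _ _ _ _ _ leb leb _ _ _ mf i1 i2).
Qed.

Lemma wd_sec2 y : leb.-integrable setT (EFin \o (fun x => f x y * (r1 x * r2 y))).
Proof.
by case: fd => N [mf fN i1 i2]; exact: (dom_section2 _ _ _ _ _ leb _ _ _ mf i1 fN y).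
Qed.

Lemma wd_sec1 x : leb.-integrable setT (EFin \o (fun y => f x y * (r1 x * r2 y))).
Proof.
by case: fd => N [mf fN i1 i2]; exact: (dom_section1 _ _ _ _ _ leb _ _ _ mf i2 fN x).
Qed.

Lemma wd_outer : leb.-integrable setT (EFin \o (fun x => \int[leb]_y (f x y * (r1 x * r2 y)))).
Proof.
by case: fd => N [mf fN i1 i2]; exact: (dom_outer1 _ _ _ _ _ leb leb _ _ _ mf i1 i2 fN).
Qed.

Lemma wd_fubini1 : \int[leb2]_p (f p.1 p.2 * (r1 p.1 * r2 p.2)) =
  \int[leb]_x \int[leb]_y (f x y * (r1 x * r2 y)).
Proof.
by case: fd => N [mf fN i1 i2]; exact: (Rfubini1 _ _ _ _ _ leb leb _ _ _ mf i1 i2 fN).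
Qed.

Lemma wd_fubini : \int[leb]_x \int[leb]_y (f x y * (r1 x * r2 y)) =
  \int[leb]_y \int[leb]_x (f x y * (r1 x * r2 y)).
Proof.
by case: fd => N [mf fN i1 i2]; exact: (Rfubini _ _ _ _ _ leb leb _ _ _ mf i1 i2 fN).
Qed.

End well_dominated.

Lemma flip_outer (f : R -> R -> R) :
  well_dominated f dens_hi dens_lo ->
  \int[leb]_x \int[leb]_y (f (- x) y * (dens_hi x * dens_lo y)) =
  \int[leb]_x \int[leb]_y (f x y * (dens_hi x * dens_lo y)).
Proof.
move=> fd; rewrite -[RHS]Rintegral_opp; last first.
  by apply/measurable_EFinP; exact: measurable_int (wd_outer _ _ _ fd).
by apply: eq_Rintegral => x _; apply: eq_Rintegral => y _; rewrite dens_hiN.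
Qed.

Section odd_integral.
Variables k l : nat.
Local Notation m := k.*2.+1.
Local Notation n := l.*2.+1.
Local Notation op := (opolp k l).

Lemma opol_le x y : `|opol k l x y| <= 2 * ((1 + `|x|) ^+ (m + n) * (1 + `|y|) ^+ (m + n)).
Proof.
rewrite /opol (le_trans (ler_normD _ _))//.
by have := pol_le m n x y; have := pol_le m n (- x) y; rewrite normrN; lra.
Qed.

Lemma measurable_opol :
  measurable_fun [set: measurableTypeR R * measurableTypeR R] (fun p => opol k l p.1 p.2 : R).
Proof.
apply: measurable_funD; first exact: measurable_pol.
apply: measurable_funM; apply: measurable_funX.
- apply: measurable_funD; last exact: measurable_snd.
  by apply: measurableT_comp => //; exact: measurable_fst.
- apply: measurable_funB; last exact: measurable_snd.
  by apply: measurableT_comp => //; exact: measurable_fst.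
Qed.

Lemma opolp_le x y : `|op x y| <= 2 * ((1 + `|x|) ^+ (m + n) * (1 + `|y|) ^+ (m + n)).
Proof.
apply: le_trans (opol_le x y); rewrite ger0_norm ?opolp_ge0// /opolp.
by rewrite ge_max normr_ge0 ler_norm.
Qed.

Lemma measurable_opolp :
  measurable_fun [set: measurableTypeR R * measurableTypeR R] (fun p => op p.1 p.2 : R).
Proof. by apply: measurable_maxr => //; exact: measurable_opol. Qed.

Lemma opolp_swap_le x y : `|op y x| <= 2 * ((1 + `|x|) ^+ (m + n) * (1 + `|y|) ^+ (m + n)).
Proof. by rewrite [X in 2 * X]mulrC opolp_le. Qed.

Lemma measurable_opolp_swap :
  measurable_fun [set: measurableTypeR R * measurableTypeR R] (fun p => op p.2 p.1 : R).
Proof.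
rewrite (_ : (fun p => _) = fun p => Num.max (- opol k l p.1 p.2) 0).
  by apply: measurable_maxr => //; apply: measurableT_comp => //; exact: measurable_opol.
by apply/funext => p; rewrite /opolp opolN.
Qed.

(** Near the origin the comparison holds only on average: [cosh (c x)] is so
    large for most [x] that a lower bound [h] of the difference of densities,
    which changes sign once, has nonnegative integral; the weight [op] is
    monotone. *)
Lemma odd_section_ge0 y :
  0 <= \int[leb]_x (op x y * (dens_hi x * dens_lo y)) -
       \int[leb]_x (op x y * (dens_lo x * dens_hi y)).
Proof.
have d1 : well_dominated op dens_hi dens_lo.
  by apply: (well_dominatedP _ _ _ (m + n)); [exact: measurable_opolp|exact: opolp_le|left].
have d2 : well_dominated op dens_lo dens_hi.
  by apply: (well_dominatedP _ _ _ (m + n)); [exact: measurable_opolp|exact: opolp_le|right].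
have i1 := wd_sec2 _ _ _ d1 y; have i2 := wd_sec2 _ _ _ d2 y.
rewrite -RintegralB//.
have [cy|cy] := leP 1 (c * `|y|).
  apply: Rintegral_ge0 => x _; rewrite -mulrBr.
  have [xy|/ltW yx] := leP `|x| `|y|; first by rewrite opolp_eq0// mul0r.
  rewrite mulr_ge0 ?opolp_ge0// subr_ge0 mulrC.
  exact: dens_cross.
(* The lower bound [h] changes sign at [u / c]. *)
have [u u0 uE] : exists2 u, 0 <= u & cosh u = expR (2 * b) * cosh 1.
  apply: cosh_surj; rewrite -[leLHS]mulr1; apply: ler_pM => //.
    by rewrite -expR0 ler_expR mulr_ge0.
  have : cosh 0 <= cosh (1 : R) by rewrite ler_cosh// normr0.
  by rewrite /cosh oppr0 expR0; lra.
have uE' : expR (- b) * cosh u = expR b * cosh 1.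
  by rewrite uE mulrA -expRD; congr (expR _ * _); ring.
pose xs := u / c.
have c_gt0 : 0 < c by exact: lt_le_trans ltr01 c1.
have xs0 : 0 <= xs by rewrite divr_ge0.
have hs : c * xs = u by rewrite /xs mulrC divfK// gt_eqF.
pose g x := expR (- (a * x ^+ 2)).
pose h x := expR (- b) * cosh (c * x) - expR b * cosh 1.
pose Ky := op xs y * (expR (- kap y - a * y ^+ 2)).
have Ky0 : 0 <= Ky by rewrite mulr_ge0 ?opolp_ge0 ?expR_ge0.
have gi : leb.-integrable setT (EFin \o g) by exact: integrable_gauss1.
have cgi : leb.-integrable setT (EFin \o (fun x => cosh (c * x) * g x)).
  have := integrable_dens_hi 0; congr (integrable _ _ (EFin \o _)).
  by apply/funext => x; rewrite expr0 mul1r.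
have hgi : leb.-integrable setT (EFin \o (fun x => expR (- b) * (cosh (c * x) * g x) - expR b * cosh 1 * g x)).
  by apply: integrableRB; exact: integrableZ.
have hI : 0 <= \int[leb]_x (expR (- b) * (cosh (c * x) * g x) - expR b * cosh 1 * g x).
  rewrite RintegralB//; [|exact: integrableZ|exact: integrableZ].
  rewrite (RintegralZl _ measurableT cgi) (RintegralZl _ measurableT gi).
  rewrite Rintegral_cosh_gauss// mulrA -mulrBl mulr_ge0//; last first.
    by apply: Rintegral_ge0 => x _; exact: expR_ge0.
  rewrite subr_ge0 -expRD; apply: (@le_trans _ _ (expR b * expR 1)).
    by rewrite ler_wpM2l ?expR_ge0 ?cosh1_le.
  rewrite -expRD ler_expR.
  (* The requirement on [c ^ 2 / a] makes the mean of [h] nonnegative. *)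
  have : 2 * b + 1 <= c ^+ 2 / (4 * a).
    by rewrite ler_pdivlMr ?mulr_gt0// mulrC cab.
  by lra.
apply: (@le_trans _ _ (\int[leb]_x (Ky * (expR (- b) * (cosh (c * x) * g x) - expR b * cosh 1 * g x)))).
  by rewrite (RintegralZl _ measurableT hgi) mulr_ge0.
apply: le_Rintegral => //.
- exact: integrableZ.
- exact: integrableRB.
move=> x _; rewrite -mulrBr.
pose W := expR (- kap y - a * y ^+ 2) * g x.
have W0 : 0 <= W by rewrite mulr_ge0 ?expR_ge0.
apply: (@le_trans _ _ (op x y * (W * h x))).
  rewrite (_ : Ky * _ = op xs y * (W * h x)); last by rewrite /Ky /W /h; ring.
  have [ux|xu] := leP u (c * `|x|).
    rewrite ler_wpM2r//; last first.
      apply: opolp_mono; rewrite (ger0_norm xs0).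
      by rewrite -(ler_pM2l c_gt0) hs.
    rewrite mulr_ge0// subr_ge0.
    have : cosh u <= cosh (c * x).
      by rewrite ler_cosh// normrM (ger0_norm c0) (ger0_norm u0).
    by move=> /(ler_wpM2l (expR_ge0 (- b))); apply: le_trans; rewrite uE'.
  rewrite -subr_ge0 -mulrBl mulr_le0//.
    rewrite subr_le0; apply: opolp_mono; rewrite (ger0_norm xs0).
    by rewrite -(ler_pM2l c_gt0) hs ltW.
  rewrite mulr_ge0_le0// subr_le0.
  have : cosh (c * x) <= cosh u.
    by rewrite ler_cosh// normrM (ger0_norm c0) (ger0_norm u0) ltW.
  by move=> /(ler_wpM2l (expR_ge0 (- b))) /le_trans; apply; rewrite uE'.
have [xy|/ltW yx] := leP `|x| `|y|; first by rewrite opolp_eq0// !mul0r.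
rewrite ler_wpM2l ?opolp_ge0// mulrBr; apply: lerB.
- rewrite /W /dens_hi /dens_lo -/(g x).
  rewrite [leLHS](_ : _ = cosh (c * x) * g x * (expR (- kap y - a * y ^+ 2) * expR (- b))); last by ring.
  rewrite -expRD ler_wpM2l ?mulr_ge0 ?cosh_ge0 ?expR_ge0// ler_expR.
  by have := bet_b y; rewrite ler_norml => /andP[]; lra.
- rewrite /W /dens_hi /dens_lo.
  rewrite [leLHS](_ : _ = cosh (c * y) * (expR (- kap x - bet x - a * x ^+ 2) * expR (- (a * y ^+ 2)))); last by ring.
  rewrite [leRHS](_ : _ = cosh 1 * (expR (- kap y - a * y ^+ 2) * g x * expR b)); last by ring.
  apply: ler_pM; rewrite ?cosh_ge0 ?mulr_ge0 ?expR_ge0//.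
    by rewrite ler_cosh// normrM (ger0_norm c0) normr1 ltW.
  rewrite -!expRD ler_expR; have := kap_mono y x yx.
  by have := bet_b x; rewrite ler_norml => /andP[]; lra.
Qed.

(** Exchanging [x] and [y] in the part with the minus sign exchanges the densities
    there; the two parts are then compared for each fixed [y]. *)
Lemma odd_integral_ge0 :
  0 <= \int[leb]_x \int[leb]_y (pol m n x y * (dens_hi x * dens_lo y)).
Proof.
have d0 := pol_dominated m n.
have dN : well_dominated (fun x y => pol m n (- x) y) dens_hi dens_lo.
  apply: (well_dominatedP _ _ _ (m + n)); last by left.
    apply: measurable_funM; apply: measurable_funX.
    - apply: measurable_funD; last exact: measurable_snd.
      by apply: measurableT_comp => //; exact: measurable_fst.
    - apply: measurable_funB; last exact: measurable_snd.
      by apply: measurableT_comp => //; exact: measurable_fst.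
  move=> x y; apply: le_trans (pol_le m n (- x) y) _; rewrite normrN.
  by rewrite ler_peMl ?mulr_ge0 ?exprn_ge0 ?addr_ge0//; lra.
have d1 : well_dominated op dens_hi dens_lo.
  by apply: (well_dominatedP _ _ _ (m + n)); [exact: measurable_opolp|exact: opolp_le|left].
have d2 : well_dominated op dens_lo dens_hi.
  by apply: (well_dominatedP _ _ _ (m + n)); [exact: measurable_opolp|exact: opolp_le|right].
have ds : well_dominated (fun x y => op y x) dens_hi dens_lo.
  by apply: (well_dominatedP _ _ _ (m + n));
    [exact: measurable_opolp_swap|exact: opolp_swap_le|left].
have ds2 : well_dominated (fun x y => op y x) dens_lo dens_hi.
  by apply: (well_dominatedP _ _ _ (m + n));
    [exact: measurable_opolp_swap|exact: opolp_swap_le|right].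
suff : 0 <= 2 * \int[leb]_x \int[leb]_y (pol m n x y * (dens_hi x * dens_lo y)).
  by rewrite pmulr_rge0.
rewrite mulr_natl mulr2n -{2}(flip_outer _ d0).
rewrite -(wd_fubini1 _ _ _ d0) -(wd_fubini1 _ _ _ dN).
rewrite -RintegralD//; [|exact: (wd_int2 _ _ _ d0)|exact: (wd_int2 _ _ _ dN)].
rewrite (_ : \int[leb2]_x _ = \int[leb2]_p (op p.1 p.2 * (dens_hi p.1 * dens_lo p.2) -
    op p.2 p.1 * (dens_hi p.1 * dens_lo p.2))); last first.
  by apply: eq_Rintegral => -[x y] _ /=; rewrite -mulrDl -mulrBl opolp_sub.
rewrite RintegralB//; [|exact: (wd_int2 _ _ _ d1)|exact: (wd_int2 _ _ _ ds)].
rewrite (wd_fubini1 _ _ _ d1) (wd_fubini1 _ _ _ ds) (wd_fubini _ _ _ d1).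
rewrite (_ : \int[leb]_x \int[leb]_y (op y x * (dens_hi x * dens_lo y)) =
  \int[leb]_y \int[leb]_x (op x y * (dens_lo x * dens_hi y))); last first.
  by apply: eq_Rintegral => x _; apply: eq_Rintegral => y _; rewrite [dens_hi x * _]mulrC.
rewrite -RintegralB//.
- by apply: Rintegral_ge0 => y _; exact: odd_section_ge0.
- have := wd_outer _ _ _ ds2; congr (integrable _ _ (EFin \o _)).
  apply/funext => y; apply: eq_Rintegral => x _; by rewrite [dens_lo y * _]mulrC.
- have := wd_outer _ _ _ ds; congr (integrable _ _ (EFin \o _)).
  apply/funext => y; apply: eq_Rintegral => x _; by rewrite [dens_hi y * _]mulrC.
Qed.

End odd_integral.

(** Ginibre's condition at one site. If [m + n] is odd the integral vanishes by
    reflection, and if both exponents are even the integrand is nonnegative; only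
    for two odd exponents do the densities have to be compared. *)
Lemma one_site_ge0 m n :
  0 <= \int[leb]_x \int[leb]_y (pol m n x y * (dens_hi x * dens_lo y)).
Proof.
have [mn|mn] := boolP (odd (m + n)).
  suff : \int[leb]_x \int[leb]_y (pol m n x y * (dens_hi x * dens_lo y)) =
    - \int[leb]_x \int[leb]_y (pol m n x y * (dens_hi x * dens_lo y)) by lra.
  have d0 := pol_dominated m n.
  rewrite -{1}(flip_outer _ d0) -mulN1r -RintegralZl//; last exact: (wd_outer _ _ _ d0).
  apply: eq_Rintegral => x _; rewrite -RintegralZl//; last exact: (wd_sec1 _ _ _ d0).
  rewrite -[LHS]Rintegral_opp; last first.
    apply: measurable_funM; last by apply: measurable_funM => //; exact: measurable_dens_lo.
    by apply: measurable_funM; apply: measurable_funX; [apply: measurable_funD|apply: measurable_funB].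
  apply: eq_Rintegral => y _; rewrite dens_loN.
  have E : pol m n (- x) (- y) = - pol m n x y.
    rewrite /pol -opprD (_ : - x - - y = - (x - y)); last by ring.
    move: (x + y) (x - y) => A B; rewrite [(- A) ^+ _]exprNn [(- B) ^+ _]exprNn.
    by rewrite mulrACA -exprD -signr_odd mn expr1 mulN1r.
  by rewrite E mulNr mulN1r.
move: mn; rewrite oddD; have [mo|me] := boolP (odd m); rewrite ?addTb ?addFb => /negbTE no.
- have [] := (odd_double_half m, odd_double_half n).
  rewrite mo; move/negbFE: no => -> /= <- <-; rewrite !add1n.
  exact: odd_integral_ge0.
- apply: Rintegral_ge0 => x _; apply: Rintegral_ge0 => y _.
  apply: mulr_ge0; last by rewrite mulr_ge0 ?dens_hi_ge0 ?dens_lo_ge0.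
  by rewrite mulr_ge0// exprn_even_ge0// no.
Qed.

End one_site.

(** * Ginibre's comparison of two systems of continuous spins *)

Section limits.
Context d (T : measurableType d) (R : realType) (mu : {measure set T -> \bar R}).

Lemma Rintegral_lim_ge0 (f_ : nat -> T -> R) (f g : T -> R) :
  (forall n, measurable_fun setT (f_ n)) -> (forall x, f_ ^~ x @ \oo --> f x) ->
  mu.-integrable setT (EFin \o g) -> (forall n x, `|f_ n x| <= g x) ->
  (forall n, 0 <= \int[mu]_x f_ n x) -> 0 <= \int[mu]_x f x.
Proof.
move=> mf fc gi fg f0.
have cv : (\int[mu]_x (EFin \o f_ n) x)%E @[n --> \oo] --> (\int[mu]_x (EFin \o f) x)%E.
  apply: (dominated_cvg measurableT (g := EFin \o g)) => //.
  - by move=> n; exact/measurable_EFinP.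
  - by move=> x _; apply: cvg_comp (fc x) _.
  - by move=> k x _; rewrite lee_fin.
suff : (0 <= \int[mu]_x (EFin \o f) x)%E by exact: fine_ge0.
apply: (cvge_to_ge cv); apply: nearW => n.
rewrite -[X in (_ <= X)%E]fineK; first by rewrite lee_fin; exact: f0.
exact/integrable_fin_num/(integrable_dom _ _ _ _ (g : T -> R)).
Qed.

Lemma Rintegral_lin (I : Type) (r : seq I) (c : I -> R) (f : I -> T -> R) :
  (forall i, mu.-integrable setT (EFin \o f i)) ->
  \int[mu]_x \sum_(i <- r) c i * f i x = \sum_(i <- r) c i * \int[mu]_x f i x.
Proof.
move=> fi; suff [] : mu.-integrable setT (EFin \o (fun x => \sum_(i <- r) c i * f i x)) /\
  \int[mu]_x \sum_(i <- r) c i * f i x = \sum_(i <- r) c i * \int[mu]_x f i x by [].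
elim: r => [|i r [IHi IH]].
  rewrite big_nil (_ : (fun x => _) = fun=> 0); last by apply/funext => x; rewrite big_nil.
  by split; [exact: integrable0|by rewrite /Rintegral integral0].
rewrite big_cons (_ : (fun x => _) = fun x => c i * f i x + \sum_(j <- r) c j * f j x); last first.
  by apply/funext => x; rewrite big_cons.
have ci : mu.-integrable setT (EFin \o (fun x => c i * f i x)) by exact: integrableZ.
by split; [exact: integrableRD|rewrite RintegralD// RintegralZl// IH].
Qed.

End limits.

Section products.
Context d1 d2 (T1 : measurableType d1) (T2 : measurableType d2) (R : realType).
Context (m1 : {sigma_finite_measure set T1 -> \bar R}).
Context (m2 : {sigma_finite_measure set T2 -> \bar R}).
Variables (f : T1 -> R) (g : T2 -> R).
Hypotheses (fi : m1.-integrable setT (EFin \o f)) (gi : m2.-integrable setT (EFin \o g)).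

Let abs_int d (T : measurableType d) (m : {measure set T -> \bar R}) (h : T -> R) :
  m.-integrable setT (EFin \o h) -> m.-integrable setT (EFin \o (fun x => `|h x|)).
Proof. by move=> /integrable_abse; congr integrable. Qed.

Let fg_measurable : measurable_fun setT (fun w : T1 * T2 => f w.1 * g w.2).
Proof.
apply: measurable_funM.
- by apply: (measurableT_comp _ measurable_fst); apply/measurable_EFinP; exact: measurable_int fi.
- by apply: (measurableT_comp _ measurable_snd); apply/measurable_EFinP; exact: measurable_int gi.
Qed.

Let fg_dom x y : `|f x * g y| <= `|f x| * `|g y|. Proof. by rewrite normrM. Qed.

Lemma prod_integrable : (m1 \x m2)%E.-integrable setT (EFin \o (fun w => f w.1 * g w.2)).
Proof.
exact: (dom_integrable _ _ _ _ _ m1 m2 _ _ _ fg_measurable (abs_int _ _ _ _ fi)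
  (abs_int _ _ _ _ gi) fg_dom).
Qed.

Lemma Rintegral_prod :
  \int[(m1 \x m2)%E]_w (f w.1 * g w.2) = (\int[m1]_x f x) * \int[m2]_y g y.
Proof.
rewrite (Rfubini1 _ _ _ _ _ m1 m2 _ _ _ fg_measurable (abs_int _ _ _ _ fi)
  (abs_int _ _ _ _ gi) fg_dom)/=.
rewrite -RintegralZr//; apply: eq_Rintegral => x _.
exact: (RintegralZl _ measurableT gi).
Qed.

End products.

Section trunc_sinh.
Context {R : realType}.
Implicit Type x : R.

Definition trunc_sinh N x := (exp_partial N.+2 x - exp_partial N.+2 (- x)) / 2.

(** The first term is [x] itself, which combines with that of the other copy in
    [poscone_pair]; all further terms have nonnegative coefficients. *)
Lemma trunc_sinhE N x : trunc_sinh N x =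
  x + \sum_(k < N) (1 - (-1) ^+ k) / 2 / k.+2`!%:R * x ^+ k.+2.
Proof.
have E (t : R) : exp_partial N.+2 t = 1 + (t + \sum_(k < N) t ^+ k.+2 / k.+2`!%:R).
  rewrite /exp_partial !big_ord_recl/= expr0 expr1; congr (_ + (_ + _)); by rewrite ?divr1.
rewrite /trunc_sinh !E.
have -> : \sum_(k < N) (1 - (-1) ^+ k) / 2 / k.+2`!%:R * x ^+ k.+2 =
    (\sum_(k < N) x ^+ k.+2 / k.+2`!%:R - \sum_(k < N) (- x) ^+ k.+2 / k.+2`!%:R) / 2.
  rewrite -sumrB mulr_suml; apply: eq_bigr => k _.
  rewrite (_ : (- x) ^+ k.+2 = (-1) ^+ k * x ^+ k.+2); first by ring.
  by rewrite [LHS]exprNn; congr (_ * _); rewrite 2!exprS !mulN1r opprK.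
by field.
Qed.

Lemma trunc_sinh_cvg x : trunc_sinh ^~ x @ \oo --> sinh x.
Proof.
apply: cvgM; last exact: cvg_cst.
have H t : (fun N => exp_partial N.+2 t) @ \oo --> expR t.
  have := exp_partial_cvg t; rewrite -(cvg_shiftn 2).
  by under eq_fun do rewrite addn2.
by apply: cvgB; exact: H.
Qed.

Lemma norm_trunc_sinh_le N x : `|trunc_sinh N x| <= expR `|x|.
Proof.
rewrite /trunc_sinh normrM [X in _ * X]ger0_norm ?invr_ge0//.
have := norm_exp_partial_le x N.+2; have := norm_exp_partial_le (- x) N.+2.
rewrite normrN; have := ler_normB (exp_partial N.+2 x) (exp_partial N.+2 (- x)).
by rewrite ler_pdivrMr//; lra.
Qed.

Lemma norm_sinh_le x : `|sinh x| <= expR `|x|.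
Proof.
have cv : `|trunc_sinh N x| @[N --> \oo] --> `|sinh x|.
  by apply: cvg_norm; exact: trunc_sinh_cvg.
apply: (cvgr_to_le cv).
by apply: nearW => N; exact: norm_trunc_sinh_le.
Qed.

End trunc_sinh.

Section ginibre.
Context {R : realType} (n : nat).
Local Notation leb := (@lebesgue_measure R).
Local Notation lam := (lebesgue_Rn R n).
Variables (J J' : 'I_n -> 'I_n -> R) (r1 r2 : 'I_n -> R -> R) (e : R).
Variables (c1 c2 : 'I_n -> R).
Hypothesis JJ' : forall k l, `|J' k l| <= J k l.
Hypothesis JC : forall k l, J k l = J l k.
Hypothesis e0 : 0 < e.

Let s k := \sum_l J k l.

Hypotheses (m1 : forall k, measurable_fun setT (r1 k))
           (m2 : forall k, measurable_fun setT (r2 k)).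
Hypotheses (r1ge0 : forall k x, 0 <= r1 k x) (r2ge0 : forall k x, 0 <= r2 k x).
Hypothesis r1le : forall k x, r1 k x <= c1 k * expR (- ((s k + e) * x ^+ 2)).
Hypothesis r2le : forall k x, r2 k x <= c2 k * expR (- ((s k + e) * x ^+ 2)).
Hypothesis one_site : forall k a b,
  0 <= \int[leb]_x \int[leb]_y (pol a b x y * (r1 k x * r2 k y)).

Definition quad (K : 'I_n -> 'I_n -> R) (x : 'Rn[R]_n) : R :=
  \sum_k \sum_l K k l * (tnth x k * tnth x l).
Definition prodw (r : 'I_n -> R -> R) (x : 'Rn[R]_n) : R := \prod_k r k (tnth x k).

Lemma measurable_quad K : measurable_fun setT (quad K).
Proof.
apply: measurable_sum => k; apply: measurable_sum => l.
by apply: measurable_funM => //; apply: measurable_funM; exact: measurable_coord.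
Qed.

Lemma measurable_prodw r : (forall k, measurable_fun setT (r k)) ->
  measurable_fun setT (prodw r).
Proof. by move=> mr; apply: measurable_prod => k _; exact: measurable_comp_coord. Qed.

Let J0 k l : 0 <= J k l. Proof. exact: le_trans (normr_ge0 _) (JJ' k l). Qed.

Lemma quad_le K x : (forall k l, `|K k l| <= J k l) ->
  `|quad K x| <= \sum_k s k * tnth x k ^+ 2.
Proof.
move=> KJ; have -> : \sum_k s k * tnth x k ^+ 2 =
    \sum_k \sum_l J k l * ((tnth x k ^+ 2 + tnth x l ^+ 2) / 2).
  have E : \sum_k \sum_l J k l * (tnth x l ^+ 2) = \sum_k s k * tnth x k ^+ 2.
    rewrite exchange_big/=; apply: eq_bigr => k _; rewrite /s mulr_suml.
    by apply: eq_bigr => l _; rewrite JC.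
  have E' : \sum_k \sum_l J k l * (tnth x k ^+ 2) = \sum_k s k * tnth x k ^+ 2.
    by apply: eq_bigr => k _; rewrite /s mulr_suml.
  rewrite (_ : \sum_k \sum_l _ = (\sum_k \sum_l J k l * (tnth x k ^+ 2) +
     \sum_k \sum_l J k l * (tnth x l ^+ 2)) / 2); first by rewrite E E'; field.
  rewrite -big_split/= mulr_suml; apply: eq_bigr => k _.
  by rewrite -big_split/= mulr_suml; apply: eq_bigr => l _; field.
apply: le_trans (ler_norm_sum _ _ _) _; apply: ler_sum => k _.
apply: le_trans (ler_norm_sum _ _ _) _; apply: ler_sum => l _.
rewrite normrM; apply: ler_pM => //; rewrite ler_norml.
move: (tnth x k : R) (tnth x l : R) => a b.
have := sqr_ge0 (a + b); have := sqr_ge0 (a - b).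
by rewrite sqrrB sqrrD; lra.
Qed.

Lemma prodw_ge0 r x : (forall k z, 0 <= r k z) -> 0 <= prodw r x.
Proof. by move=> r0; exact: prodr_ge0. Qed.

Variables i j : 'I_n.
Let envexp (x : 'Rn[R]_n) := expR (`|tnth x i| + `|tnth x j|).

Let norm_le_sqr (z : R) : `|z| <= e^-1 + e / 4 * z ^+ 2.
Proof.
rewrite -[z ^+ 2]real_normK ?num_real//; move: `|z| => y.
rewrite -subr_ge0 (_ : _ - _ = (e * y - 2) ^+ 2 / (4 * e)); last by field; rewrite gt_eqF.
by rewrite divr_ge0 ?sqr_ge0// mulr_ge0// ltW.
Qed.

(** The quadratic form costs at most [s k * x_k ^ 2] at each site; half of the
    remaining Gaussian factor pays for the exponential growth. *)
Lemma weight_dom (r : 'I_n -> R -> R) (c : 'I_n -> R) x : (forall k z, 0 <= r k z) ->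
  (forall k z, r k z <= c k * expR (- ((s k + e) * z ^+ 2))) ->
  envexp x * expR (\sum_k s k * tnth x k ^+ 2) * prodw r x <=
  (expR (2 / e) * \prod_k c k) * gauss (e / 2) x.
Proof.
move=> r0 rc.
have sq k : tnth x k ^+ 2 <= \sum_k tnth x k ^+ 2.
  by rewrite (bigD1 k)//= lerDl sumr_ge0// => l _; exact: sqr_ge0.
apply: (@le_trans _ _ (expR (2 / e + e / 2 * \sum_k tnth x k ^+ 2) *
    expR (\sum_k s k * tnth x k ^+ 2) *
    \prod_k (c k * expR (- ((s k + e) * tnth x k ^+ 2))))).
  apply: ler_pM.
  - by rewrite mulr_ge0 ?expR_ge0.
  - exact: prodw_ge0.
  - rewrite ler_wpM2r ?expR_ge0// ler_expR.
    have := norm_le_sqr (tnth x i); have := norm_le_sqr (tnth x j).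
    have := ler_wpM2l (_ : 0 <= e / 4) (sq i); have := ler_wpM2l (_ : 0 <= e / 4) (sq j).
    rewrite divr_ge0 ?(ltW e0)// => /(_ isT) + /(_ isT); lra.
  - by apply: ler_prod => k _; rewrite r0 rc.
rewrite big_split/= -expR_sum gaussE.
rewrite [leLHS](_ : _ = \prod_k c k * expR (2 / e) * (expR (e / 2 * \sum_k tnth x k ^+ 2) *
   expR (\sum_k s k * tnth x k ^+ 2) * expR (\sum_k - ((s k + e) * tnth x k ^+ 2)))); last first.
  by rewrite expRD; ring.
rewrite -!expRD [X in X * _ <= _]mulrC le_eqVlt; apply/orP; left; apply/eqP; congr (_ * expR _).
rewrite sumrN (_ : \sum_k (s k + e) * _ = \sum_k s k * tnth x k ^+ 2 +
    e * \sum_k tnth x k ^+ 2); first by field.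
by rewrite mulr_sumr -big_split/=; apply: eq_bigr => k _; rewrite mulrDl.
Qed.

Let envexp_ge1 x : 1 <= envexp x.
Proof. by rewrite -expR0 ler_expR addr_ge0. Qed.

Lemma moment_integrable (r : 'I_n -> R -> R) (c : 'I_n -> R) k (N : nat) : measurable_fun setT (r k) ->
  (forall z, 0 <= r k z) -> (forall z, r k z <= c k * expR (- ((s k + e) * z ^+ 2))) ->
  leb.-integrable setT (EFin \o (fun z => (1 + `|z|) ^+ N * r k z)).
Proof.
move=> mr r0 rc.
have ck : 0 <= c k.
  by rewrite -(pmulr_lge0 _ (expR_gt0 (- ((s k + e) * 0 ^+ 2)))) (le_trans (r0 0)).
apply: (gauss_dom1 _ (c k * expR (N%:R ^+ 2 / (2 * e))) (e / 2)).
- by apply: measurable_funM => //; apply: measurable_funX => //;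
    apply: measurable_funD => //; exact: measurableT_comp.
- by rewrite divr_gt0.
- move=> z; rewrite ger0_norm ?mulr_ge0 ?exprn_ge0 ?addr_ge0//.
  rewrite -mulrA; apply: le_trans (ler_wpM2l ck (gauss_exp_le _ _ _ e0)).
  rewrite mulrCA; apply: ler_pM; rewrite ?exprn_ge0 ?addr_ge0//; first exact: poly_le_expR.
  apply: le_trans (rc z) _; rewrite ler_wpM2l// ler_expR lerN2 ler_wpM2r ?sqr_ge0//.
  by rewrite lerDr sumr_ge0.
Qed.

Let Rn2 := ('Rn[R]_n * 'Rn[R]_n)%type.

(** The sums and differences of the two copies, as generators of the cone. *)
Definition gin (t : 'I_n * bool) (w : Rn2) : R :=
  if t.2 then tnth w.1 t.1 + tnth w.2 t.1 else tnth w.1 t.1 - tnth w.2 t.1.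

Lemma gin_monomE (p : {ffun 'I_n * bool -> nat}) w :
  monom gin p w = \prod_k pol (p (k, true)) (p (k, false)) (tnth w.1 k) (tnth w.2 k).
Proof.
transitivity (\prod_k \prod_b gin (k, b) w ^+ p (k, b)).
  by rewrite pair_bigA /monom; apply: eq_bigr => -[].
by apply: eq_bigr => k _; rewrite big_bool.
Qed.

Let wt (w : Rn2) := prodw r1 w.1 * prodw r2 w.2.

Lemma measurable_gin_coord1 k : measurable_fun [set: Rn2] (fun w => tnth w.1 k : R).
Proof. by apply: (measurableT_comp (measurable_coord n k)); exact: measurable_fst. Qed.

Lemma measurable_gin_coord2 k : measurable_fun [set: Rn2] (fun w => tnth w.2 k : R).
Proof. by apply: (measurableT_comp (measurable_coord n k)); exact: measurable_snd. Qed.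

Let measurable_wt : measurable_fun setT wt.
Proof.
apply: measurable_funM.
- by apply: (measurableT_comp (measurable_prodw _ m1)); exact: measurable_fst.
- by apply: (measurableT_comp (measurable_prodw _ m2)); exact: measurable_snd.
Qed.

Lemma gin_monom_int (p : {ffun 'I_n * bool -> nat}) :
  (lam \x lam)%E.-integrable setT (EFin \o (fun w => monom gin p w * wt w)) /\
  0 <= \int[(lam \x lam)%E]_w (monom gin p w * wt w).
Proof.
pose a k := p (k, true); pose b k := p (k, false).
pose F (w : Rn2) := monom gin p w * wt w.
have FE x y : F (x, y) =
    \prod_k (pol (a k) (b k) (tnth x k) (tnth y k) * (r1 k (tnth x k) * r2 k (tnth y k))).
  by rewrite /F gin_monomE /wt /prodw/= -!big_split.
have mF : measurable_fun setT F.
  apply: measurable_funM => //; apply: measurable_prod => -[k []] _; apply: measurable_funX.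
  - by apply: measurable_funD; [exact: measurable_gin_coord1|exact: measurable_gin_coord2].
  - by apply: measurable_funB; [exact: measurable_gin_coord1|exact: measurable_gin_coord2].
pose g1 k (z : R) := (1 + `|z|) ^+ (a k + b k) * r1 k z.
pose g2 k (z : R) := (1 + `|z|) ^+ (a k + b k) * r2 k z.
have ig1 k : leb.-integrable setT (EFin \o g1 k) by exact: moment_integrable.
have ig2 k : leb.-integrable setT (EFin \o g2 k) by exact: moment_integrable.
have [iG1 _] := integral_Rn_prod n g1 ig1; have [iG2 _] := integral_Rn_prod n g2 ig2.
pose h k (w : measurableTypeR R * measurableTypeR R) : R :=
  pol (a k) (b k) w.1 w.2 * (r1 k w.1 * r2 k w.2).
have mh k : measurable_fun setT (h k).
  apply: measurable_funM; first exact: measurable_pol.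
  by apply: measurable_funM; [apply: (measurableT_comp (m1 k))|apply: (measurableT_comp (m2 k))].
have hle k x y : `|h k (x, y)| <= g1 k x * g2 k y.
  rewrite /h normrM /= [X in _ * X]ger0_norm ?mulr_ge0//.
  by rewrite /g1 /g2 mulrACA ler_wpM2r ?mulr_ge0//; exact: pol_le.
have FG x y : `|F (x, y)| <= (\prod_k g1 k (tnth x k)) * (\prod_k g2 k (tnth y k)).
  rewrite FE normr_prod -big_split/=; apply: ler_prod => k _; rewrite normr_ge0/=.
  exact: (hle k (tnth x k) (tnth y k)).
split; first exact: (dom_integrable _ _ _ _ _ lam lam F _ _ mF iG1 iG2 FG).
rewrite -/F (Rfubini1 _ _ _ _ _ lam lam F _ _ mF iG1 iG2 FG).
have sec (x : 'Rn[R]_n) : \int[lam]_y F (x, y) = \prod_k \int[leb]_z h k (tnth x k, z).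
  rewrite -(integral_Rn_prod n (fun k z => h k (tnth x k, z)) (fun k =>
    dom_section1 _ _ _ _ _ leb (h k) _ _ (mh k) (ig2 k) (hle k) (tnth x k))).2.
  by apply: eq_Rintegral => y _; exact: FE.
rewrite (eq_Rintegral _ (fun x _ => sec x)).
rewrite (integral_Rn_prod n (fun k z => \int[leb]_y h k (z, y)) (fun k =>
    dom_outer1 _ _ _ _ _ leb leb (h k) _ _ (mh k) (ig1 k) (ig2 k) (hle k))).2.
by apply: prodr_ge0 => k _; exact: one_site.
Qed.

Lemma gin_poscone_int F : poscone gin F ->
  0 <= \int[(lam \x lam)%E]_w (F w * wt w).
Proof.
case=> t [t0 Ft].
under eq_Rintegral => w _.
  rewrite Ft mulr_suml; under eq_bigr => u _ do rewrite -mulrA.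
  over.
rewrite (Rintegral_lin _ _ _ _ _ t _ (fun u w => monom gin u.2 w * wt w)); last first.
  by move=> u; case: (gin_monom_int u.2).
rewrite big_seq sumr_ge0// => u ut; rewrite mulr_ge0//; first exact: (allP t0).
by case: (gin_monom_int u.2).
Qed.

Let gin1 k (w : Rn2) : tnth w.1 k = 2^-1 * (gin (k, true) w + gin (k, false) w) :> R.
Proof. by rewrite /gin/=; field. Qed.

Let gin2 k (w : Rn2) : tnth w.2 k = 2^-1 * (gin (k, true) w - gin (k, false) w) :> R.
Proof. by rewrite /gin/=; field. Qed.

Let half0 : 0 <= 2^-1 :> R. Proof. by rewrite invr_ge0. Qed.

Lemma poscone_coord k : poscone gin (fun w => tnth w.1 k).
Proof.
apply: poscone_ext (posconeM _ _ _ (poscone_cst _ _ half0)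
  (posconeD _ _ _ (poscone_gen gin (k, true)) (poscone_gen gin (k, false)))) => w.
by rewrite gin1.
Qed.

Lemma poscone_pair k l (b : bool) :
  poscone gin (fun w => tnth w.1 k * tnth w.1 l + (-1) ^+ b * (tnth w.2 k * tnth w.2 l)).
Proof.
apply: poscone_ext (posconeM _ _ _ (poscone_cst _ _ half0)
  (posconeD _ _ _ (posconeM _ _ _ (poscone_gen gin (k, true)) (poscone_gen gin (l, ~~ b)))
    (posconeM _ _ _ (poscone_gen gin (k, false)) (poscone_gen gin (l, b))))) => w.
by rewrite !gin1 !gin2; case: b => /=; rewrite ?expr0 ?expr1; field.
Qed.

Lemma poscone_quad : poscone gin (fun w => quad J w.1 + quad J' w.2).
Proof.
pose F (w : Rn2) k l : R := (J k l + J' k l) / 2 * (tnth w.1 k * tnth w.1 l + (-1) ^+ false * (tnth w.2 k * tnth w.2 l))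
  + (J k l - J' k l) / 2 * (tnth w.1 k * tnth w.1 l + (-1) ^+ true * (tnth w.2 k * tnth w.2 l)).
apply: (poscone_ext _ (fun w => \sum_k \sum_l F w k l)).
  move=> w; rewrite /quad -big_split/=; apply: eq_bigr => k _.
  rewrite -big_split/=; apply: eq_bigr => l _; by rewrite /F expr0 expr1; field.
apply: poscone_sum => k _; apply: poscone_sum => l _.
have := JJ' k l; rewrite ler_norml => /andP[lo hi].
by apply: posconeD; apply: posconeM (poscone_pair _ _ _); apply: poscone_cst;
  rewrite divr_ge0//; lra.
Qed.

Let obs N (b : bool) (w : Rn2) : R := trunc_sinh N (tnth w.1 i) * trunc_sinh N (tnth w.1 j) +
  (-1) ^+ b * (tnth w.2 i * tnth w.2 j).

Let poscone_obs N b : poscone gin (obs N b).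
Proof.
pose tl k (w : Rn2) : R := \sum_(a < N) (1 - (-1) ^+ a) / 2 / a.+2`!%:R * tnth w.1 k ^+ a.+2.
have Ptl k : poscone gin (tl k).
  apply: poscone_sum => a _; apply: posconeM; last exact/posconeX/poscone_coord.
  apply: poscone_cst; rewrite !divr_ge0// subr_ge0.
  by rewrite -signr_odd; case: (odd a); rewrite ?expr1 ?expr0//; lra.
apply: poscone_ext (posconeD _ _ _ (poscone_pair i j b)
  (posconeD _ _ _ (posconeM _ _ _ (poscone_coord i) (Ptl j))
    (posconeM _ _ _ (Ptl i) (posconeD _ _ _ (poscone_coord j) (Ptl j))))) => w.
by rewrite /obs !trunc_sinhE -/(tl i w) -/(tl j w); ring.
Qed.

Let bnd (x : 'Rn[R]_n) := envexp x * expR (\sum_k s k * tnth x k ^+ 2).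

Let lo (x : 'Rn[R]_n) K : (forall k l, `|K k l| <= J k l) ->
  expR (quad K x) <= expR (\sum_k s k * tnth x k ^+ 2).
Proof. by move=> KJ; rewrite ler_expR (le_trans (ler_norm _))// quad_le. Qed.

(** Truncating the exponential and [sinh] leaves a function in the cone; the limit
    is taken by dominated convergence. *)
Lemma ginibre_ge0 (b : bool) : 0 <= \int[(lam \x lam)%E]_w
  ((sinh (tnth w.1 i) * sinh (tnth w.1 j) + (-1) ^+ b * (tnth w.2 i * tnth w.2 j)) *
   expR (quad J w.1 + quad J' w.2) * wt w).
Proof.
pose C (r : 'I_n -> R) := (expR (2 / e) * \prod_k r k : R).
pose g (w : Rn2) := 2 * (C c1 * gauss (e / 2) w.1 * (C c2 * gauss (e / 2) w.2)).
have e20 : 0 < e / 2 by rewrite divr_gt0.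
have JJ k l : `|J k l| <= J k l by rewrite ger0_norm.
apply: (@Rintegral_lim_ge0 _ _ _ _ (fun N w => obs N b w *
  exp_partial N (quad J w.1 + quad J' w.2) * wt w) _ g).
- move=> N; apply: measurable_funM => //; apply: measurable_funM.
    apply: measurable_funD.
      by apply: measurable_funM; rewrite /trunc_sinh; apply: measurable_funM => //;
        apply: measurable_funB; apply: measurable_sum => k;
        apply: measurable_funM => //; apply: measurable_funX; rewrite ?oppr_id//;
        try exact: measurable_gin_coord1; apply: measurableT_comp => //;
        exact: measurable_gin_coord1.
    apply: measurable_funM => //.
    by apply: measurable_funM; exact: measurable_gin_coord2.
  apply: measurable_sum => k; apply: measurable_funM => //; apply: measurable_funX.
  apply: measurable_funD.
    by apply: (measurableT_comp (measurable_quad J)); exact: measurable_fst.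
  by apply: (measurableT_comp (measurable_quad J')); exact: measurable_snd.
- move=> w; apply: cvgM; last exact: cvg_cst.
  apply: cvgM; last exact: exp_partial_cvg.
  apply: cvgD; last exact: cvg_cst.
  by apply: cvgM; exact: trunc_sinh_cvg.
- have ig c : lam.-integrable setT (EFin \o (fun x => C c * gauss (e / 2) x)).
    exact: integrableZ (integrable_gauss n _ e20).
  exact: (integrableZ _ _ _ _ 2 (prod_integrable _ _ _ _ _ lam lam _ _ (ig c1) (ig c2))).
- move=> N [x y] /=; rewrite /wt/= normrM [X in _ * X]ger0_norm; last first.
    by rewrite mulr_ge0 ?prodw_ge0.
  apply: (@le_trans _ _ (2 * ((bnd x * prodw r1 x) * (bnd y * prodw r2 y)))); last first.
    rewrite ler_pM2l//; apply: ler_pM; last 2 first.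
    - exact: (weight_dom r1 c1).
    - exact: (weight_dom r2 c2).
    - by rewrite mulr_ge0 ?prodw_ge0// mulr_ge0 ?expR_ge0.
    - by rewrite mulr_ge0 ?prodw_ge0// mulr_ge0 ?expR_ge0.
  rewrite [X in _ <= 2 * X]mulrACA [leRHS]mulrA; apply: ler_wpM2r.
    by rewrite mulr_ge0 ?prodw_ge0.
  rewrite normrM (_ : 2 * (bnd x * bnd y) = 2 * envexp x * envexp y * expR
    (\sum_k s k * tnth x k ^+ 2 + \sum_k s k * tnth y k ^+ 2)); last first.
    by rewrite expRD /bnd; ring.
  apply: ler_pM => //; last first.
    apply: le_trans (norm_exp_partial_le _ _) _; rewrite ler_expR.
    by rewrite (le_trans (ler_normD _ _))// lerD ?quad_le.
  have ox : `|trunc_sinh N (tnth x i) * trunc_sinh N (tnth x j)| <= envexp x.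
    by rewrite normrM /envexp expRD; apply: ler_pM => //; exact: norm_trunc_sinh_le.
  have oy : `|(-1) ^+ b * (tnth y i * tnth y j)| <= envexp y.
    rewrite normrM normrX normrN1 expr1n mul1r normrM /envexp expRD.
    by apply: ler_pM => //; rewrite (le_trans _ (expR_ge1Dx _))// lerDr.
  have := envexp_ge1 x; have := envexp_ge1 y.
  have := ler_normD (trunc_sinh N (tnth x i) * trunc_sinh N (tnth x j))
    ((-1) ^+ b * (tnth y i * tnth y j)).
  rewrite /obs/=; move: (envexp x) (envexp y) ox oy => p q; nra.
- move=> N; apply: gin_poscone_int; apply: posconeM; first exact: poscone_obs.
  exact/poscone_exp_partial/poscone_quad.
Qed.

Lemma weighted_integrable K (r : 'I_n -> R -> R) (c : 'I_n -> R) (f : 'Rn[R]_n -> R) :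
  (forall k l, `|K k l| <= J k l) -> (forall k, measurable_fun setT (r k)) ->
  (forall k z, 0 <= r k z) ->
  (forall k z, r k z <= c k * expR (- ((s k + e) * z ^+ 2))) ->
  measurable_fun setT f -> (forall x, `|f x| <= expR (`|tnth x i| + `|tnth x j|)) ->
  lam.-integrable setT (EFin \o (fun x => f x * expR (quad K x) * prodw r x)).
Proof.
move=> KJ mr r0 rc mf fb.
apply: (gauss_dom n _ (expR (2 / e) * \prod_k c k) (e / 2)).
- apply: measurable_funM; last exact: measurable_prodw.
  by apply: measurable_funM => //; apply: measurableT_comp => //; exact: measurable_quad.
- by rewrite divr_gt0.
- move=> x; apply: le_trans (weight_dom r c x r0 rc); rewrite !normrM.
  rewrite [X in _ * X]ger0_norm ?prodw_ge0// ler_wpM2r ?prodw_ge0//.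
  by rewrite [X in _ * X]ger0_norm ?expR_ge0//; apply: ler_pM => //; exact: lo.
Qed.

Let sinh2 (x : 'Rn[R]_n) := sinh (tnth x i) * sinh (tnth x j).
Let coord2 (x : 'Rn[R]_n) : R := tnth x i * tnth x j.

(** The two signs in [ginibre_ge0] give a bound on the absolute value. No factor
    [sinh] appears for the second system, because its observable is compared with
    the first term of the power series only. *)
Lemma ginibre_comparison :
  `|\int[lam]_x (tnth x i * tnth x j * expR (quad J' x) * prodw r2 x)| *
    \int[lam]_x (expR (quad J x) * prodw r1 x) <=
  \int[lam]_x (sinh (tnth x i) * sinh (tnth x j) * expR (quad J x) * prodw r1 x) *
    \int[lam]_x (expR (quad J' x) * prodw r2 x).
Proof.
have JJ k l : `|J k l| <= J k l by rewrite ger0_norm.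
have msinh k : measurable_fun [set: 'Rn[R]_n] (fun x => sinh (tnth x k)).
  apply: measurable_funM => //; apply: measurable_funB; apply: measurableT_comp => //.
    exact: measurable_coord.
  by apply: measurableT_comp => //; exact: measurable_coord.
have one_le x : `|1 : R| <= expR (`|tnth x i : R| + `|tnth x j : R|).
  by rewrite normr1; exact: envexp_ge1.
have i1 : lam.-integrable setT (EFin \o (fun x => 1 * expR (quad J x) * prodw r1 x)).
  exact: (weighted_integrable J r1 c1).
have i2 : lam.-integrable setT (EFin \o (fun x => 1 * expR (quad J' x) * prodw r2 x)).
  exact: (weighted_integrable J' r2 c2).
have is1 : lam.-integrable setT (EFin \o (fun x => sinh2 x * expR (quad J x) * prodw r1 x)).
  apply: (weighted_integrable J r1 c1) => //; first exact: measurable_funM.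
  by move=> x; rewrite normrM expRD; apply: ler_pM => //; exact: norm_sinh_le.
have is2 : lam.-integrable setT (EFin \o (fun x => coord2 x * expR (quad J' x) * prodw r2 x)).
  apply: (weighted_integrable J' r2 c2) => //.
    by apply: measurable_funM; exact: measurable_coord.
  move=> x; rewrite normrM expRD.
  by apply: ler_pM => //; rewrite (le_trans _ (expR_ge1Dx _))// lerDr.
set A1 := \int[lam]_x (_ * _ * _ * _); set B1 := \int[lam]_x _.
set A2 := \int[lam]_x _; set B2 := \int[lam]_x _.
have B1E : B1 = \int[lam]_x (1 * expR (quad J x) * prodw r1 x).
  by apply: eq_Rintegral => x _; rewrite mul1r.
have B2E : B2 = \int[lam]_x (1 * expR (quad J' x) * prodw r2 x).
  by apply: eq_Rintegral => x _; rewrite mul1r.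
have key (b : bool) : 0 <= A2 * B2 + (-1) ^+ b * (B1 * A1).
  rewrite B1E B2E -(Rintegral_prod _ _ _ _ _ lam lam _ _ is1 i2).
  rewrite -(Rintegral_prod _ _ _ _ _ lam lam _ _ i1 is2).
  have p1 := prod_integrable _ _ _ _ _ lam lam _ _ is1 i2.
  have p2 := prod_integrable _ _ _ _ _ lam lam _ _ i1 is2.
  rewrite -(RintegralZl _ measurableT p2) -RintegralD//; last exact: integrableZ p2.
  apply: le_trans (ginibre_ge0 b) _; rewrite le_eqVlt; apply/orP; left; apply/eqP.
  by apply: eq_Rintegral => w _; rewrite /wt expRD /sinh2 /coord2; ring.
have B10 : 0 <= B1 by apply: Rintegral_ge0 => x _; rewrite mulr_ge0 ?expR_ge0 ?prodw_ge0.
rewrite -(ger0_norm B10) -normrM ler_norml; have := key true; have := key false.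
by rewrite expr0 expr1; lra.
Qed.

End ginibre.

(** * The Green function of a diagonally dominant matrix *)

Section green.
Context {R : realType} (n : nat).
Variables (J : 'I_n -> 'I_n -> R) (delta : R).
Hypothesis J0 : forall k l, 0 <= J k l.
Hypothesis JC : forall k l, J k l = J l k.
Hypothesis delta0 : 0 < delta.

Definition rowsum k := \sum_l J k l.

Lemma rowsum_ge0 k : 0 <= rowsum k. Proof. exact: sumr_ge0. Qed.

(** At a maximum of [|u|] the sum over neighbours is at most [rowsum k * |u k|],
    which leaves [delta * |u k|]. *)
Lemma max_principle (u f : 'I_n -> R) F :
  (forall k, (rowsum k + delta) * u k - \sum_l J k l * u l = f k) ->
  (forall k, `|f k| <= F) -> forall k, `|u k| <= F / delta.
Proof.
move=> eqn fF k.
case: (@arg_maxP _ _ _ k xpredT (fun m => `|u m|) isT) => m _ mmax.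
apply: le_trans (mmax k isT) _; rewrite ler_pdivlMr//.
have : (rowsum m + delta) * `|u m| <= F + rowsum m * `|u m|.
  rewrite -[X in X * _](@ger0_norm _ (rowsum m + delta)) ?addr_ge0 ?rowsum_ge0 ?(ltW delta0)//.
  rewrite -normrM (_ : _ * u m = f m + \sum_l J m l * u l); last by rewrite -eqn subrK.
  apply: le_trans (ler_normD _ _) _; apply: lerD => //.
  apply: le_trans (ler_norm_sum _ _ _) _; rewrite /rowsum mulr_suml.
  by apply: ler_sum => l _; rewrite normrM ger0_norm// ler_wpM2l//; exact: (mmax l isT).
by rewrite mulrDl; lra.
Qed.

Lemma min_principle (u : 'I_n -> R) :
  (forall k, 0 <= (rowsum k + delta) * u k - \sum_l J k l * u l) -> forall k, 0 <= u k.
Proof.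
move=> eqn k.
case: (@arg_minP _ _ _ k xpredT u isT) => m _ mmin.
apply: le_trans (mmin k isT).
have : rowsum m * u m <= \sum_l J m l * u l.
  by rewrite /rowsum mulr_suml; apply: ler_sum => l _; rewrite ler_wpM2l//; exact: (mmin l isT).
have := eqn m; rewrite mulrDl => h1 h2.
by rewrite -(pmulr_rge0 _ delta0); lra.
Qed.

Definition green_mx : 'M[R]_n :=
  \matrix_(k, l) ((rowsum k + delta) *+ (k == l) - J k l).

Definition green k l : R := invmx green_mx k l.

Let sum_diag k (g u : 'I_n -> R) : \sum_m (g m *+ (k == m)) * u m = g k * u k.
Proof.
rewrite (bigD1 k)//= eqxx big1 ?addr0// => m mk.
by rewrite eq_sym (negbTE mk) mul0r.
Qed.

Lemma green_mx_sym : green_mx^T = green_mx.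
Proof.
apply/matrixP => k l; rewrite !mxE JC eq_sym; congr (_ - _).
by case: eqP => [->|] //; rewrite ?mulr0n.
Qed.

Lemma green_mx_unit : green_mx \in unitmx.
Proof.
rewrite -row_free_unit; apply: inj_row_free => v v0.
apply/rowP => k; rewrite mxE; apply/eqP; rewrite -normr_le0.
rewrite -(mul0r delta^-1); apply: (max_principle (fun l => v ord0 l) (fun=> 0)); last first.
  by move=> l; rewrite normr0.
move=> l; have /rowP/(_ l) := v0; rewrite !mxE => E.
rewrite -[RHS]E -(sum_diag l (fun m => rowsum m + delta)) -sumrB.
by apply: eq_bigr => m _; rewrite !mxE mulrBr ![v _ _ * _]mulrC JC eq_sym; congr (_ * _ - _).
Qed.

Lemma green_eq k l :
  (rowsum k + delta) * green k l - \sum_m J k m * green m l = (k == l)%:R.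
Proof.
have /matrixP/(_ k l) := mulmxV green_mx_unit; rewrite !mxE => <-.
rewrite -(sum_diag k (fun=> rowsum k + delta) (fun m => green m l)) -sumrB.
by apply: eq_bigr => m _; rewrite !mxE mulrBl.
Qed.

Lemma greenC k l : green k l = green l k.
Proof. by rewrite /green -{1}green_mx_sym -trmx_inv mxE. Qed.

Lemma green_ge0 k l : 0 <= green k l.
Proof. by apply: (min_principle (green^~ l)) => m; rewrite green_eq ler0n. Qed.

Lemma green_rowsum k : \sum_l green k l <= delta^-1.
Proof.
apply: le_trans (ler_norm _) _; rewrite -[delta^-1]mul1r.
apply: (max_principle (fun k => \sum_l green k l) (fun=> 1)); last by move=> m; rewrite normr1.
move=> m; rewrite mulr_sumr.
under [X in _ - X]eq_bigr do rewrite mulr_sumr.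
rewrite exchange_big/= -sumrB; under eq_bigr do rewrite green_eq.
by rewrite (bigD1 m)//= eqxx big1 ?addr0// => l lm; rewrite eq_sym (negbTE lm).
Qed.

(** Up to a factor, the centre of the Gaussian density tilted by the linear form
    [h] solves this equation. *)
Lemma green_solve (h : 'I_n -> R) k :
  (rowsum k + delta) * (\sum_l green k l * h l) -
    \sum_m J k m * (\sum_l green m l * h l) = h k.
Proof.
rewrite mulr_sumr; under [X in _ - X]eq_bigr do rewrite mulr_sumr.
rewrite exchange_big/= -sumrB (eq_bigr (fun l => (k == l)%:R * h l)); last first.
  move=> l _; rewrite -green_eq mulrBl mulrA; congr (_ - _).
  by rewrite mulr_suml; apply: eq_bigr => m _; rewrite mulrA.
by rewrite (bigD1 k)//= eqxx mul1r big1 ?addr0// => l lk; rewrite eq_sym (negbTE lk) mul0r.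
Qed.

End green.

(** [green_eq] is a resolvent equation for the kernel
    [J k l / (rowsum k + delta)], whose rows sum to less than one, uniformly. *)
Lemma green_decay {R : realType} (alpha delta S Kj : R) :
  0 < alpha -> 0 < delta -> 0 <= S -> 0 <= Kj ->
  exists2 C : R, 0 <= C & forall n (J : 'I_n -> 'I_n -> R) (pos : 'I_n -> nat),
    injective pos -> (forall k l, 0 <= J k l) -> (forall k l, J k l = J l k) ->
    (forall k, rowsum n J k <= S) ->
    (forall k l, J k l <= Kj * decay (2 + alpha) (gap (pos k) (pos l))) ->
    forall k l, green n J delta k l <= C * decay (2 + alpha) (gap (pos k) (pos l)).
Proof.
move=> alpha0 delta0 S0 Kj0; have Sd : 0 < S + delta + delta by lra.
(* [S / (S + delta)] would bound the row sums as well, but may vanish. *)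
pose theta := (S + delta) / (S + delta + delta).
have th0 : 0 < theta by rewrite divr_gt0//; lra.
have th1 : theta < 1 by rewrite ltr_pdivrMr//; lra.
have d0 : 0 <= delta^-1 by rewrite invr_ge0 ltW.
have Kd0 : 0 <= Kj / delta by rewrite mulr_ge0.
have z0 : 0 <= 6 * (1 + (1 + alpha)^-1).
  by rewrite mulr_ge0// addr_ge0// invr_ge0 addr_ge0// ltW.
have p0 : 0 < 2 + alpha by lra.
have [C C0 H] := resolvent_decay R theta (2 + alpha) _ _ _ th0 th1 p0 d0 Kd0 z0.
exists C => // n J pos pos_inj J0 JC JS Jd.
have dk k : 0 < rowsum n J k + delta by rewrite ltr_wpDl// rowsum_ge0.
apply: (H _ pos _ (fun k l => (k == l)%:R / delta) (fun k l => J k l / (rowsum n J k + delta))).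
- move=> i; rewrite (_ : 2 + alpha = 1 + (1 + alpha)); last by ring.
  apply: decay_sum; last by lra.
  move=> m; apply: (@leq_trans 1) => //.
  apply/card_le1_eqP => a b; rewrite !inE => /eqP <- /eqP /pos_inj; exact.
- by move=> i j; exact: green_ge0.
- by move=> i j; exact: greenC.
- by move=> i j; rewrite divr_ge0// ltW.
- move=> i; rewrite -mulr_suml -/(rowsum n J i) ler_pdivrMr// /theta mulrAC ler_pdivlMr//.
  have := JS i; have := rowsum_ge0 n J J0 i; move: (rowsum n J i) => s; nra.
- move=> i j; rewrite -mulrA [delta^-1 * _]mulrC mulrA.
  apply: ler_pM => //; first by rewrite invr_ge0 ltW.
  by rewrite lef_pV2 ?posrE// lerDr rowsum_ge0.
- move=> i j; have [->|ij] := eqVneq i j; last by rewrite mul0r mulr_ge0 ?decay_ge0// invr_ge0 ltW.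
  by rewrite /gap subnn decay0 mulr1 mul1r.
- move=> i j; have E := green_eq n J delta J0 JC delta0 i j.
  have -> : green n J delta i j =
      (i == j)%:R / (rowsum n J i + delta) +
      \sum_k J i k / (rowsum n J i + delta) * green n J delta k j.
    rewrite (eq_bigr (fun k => J i k * green n J delta k j / (rowsum n J i + delta))); last first.
      by move=> k _; rewrite mulrAC.
    by rewrite -mulr_suml -mulrDl -E subrK [_ * green _ _ _ _ _]mulrC mulfK// gt_eqF.
  rewrite lerD2r ler_wpM2l// lef_pV2 ?posrE// lerDr; exact: rowsum_ge0.
Qed.

(** * From Gaussian spins to the Ising model *)

Section gaussian_mgf.
Context {R : realType} (n : nat).
Local Notation lam := (lebesgue_Rn R n).
Variables (J : 'I_n -> 'I_n -> R) (delta : R).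
Hypothesis J0 : forall k l, 0 <= J k l.
Hypothesis JC : forall k l, J k l = J l k.
Hypothesis delta0 : 0 < delta.

(** The exponent is minus the quadratic form of [green_mx], so that the covariance
    is [green / 2]. *)
Definition gaussJ (x : 'Rn[R]_n) : R :=
  expR (quad n J x) * \prod_k expR (- ((rowsum n J k + delta) * tnth x k ^+ 2)).

Let lin (u : 'I_n -> R) k := (rowsum n J k + delta) * u k - \sum_l J k l * u l.

Lemma gaussJE x : gaussJ x = expR (- \sum_k tnth x k * lin (fun k => tnth x k) k).
Proof.
rewrite /gaussJ -expR_sum -expRD; congr expR.
rewrite /quad -big_split/= -sumrN; apply: eq_bigr => k _.
rewrite /lin mulrBr opprB mulr_sumr; congr (_ + _); last by ring.
by apply: eq_bigr => l _; ring.
Qed.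

Lemma gaussJ_le x : gaussJ x <= gauss delta x.
Proof.
rewrite /gaussJ -expR_sum -expRD gaussE ler_expR.
have JJ k l : `|J k l| <= J k l by rewrite ger0_norm.
have := le_trans (ler_norm _) (quad_le n J JC J x JJ).
rewrite sumrN (_ : \sum_k (rowsum n J k + delta) * _ =
  \sum_k rowsum n J k * tnth x k ^+ 2 + delta * \sum_k tnth x k ^+ 2); first by rewrite /rowsum; lra.
by rewrite mulr_sumr -big_split/=; apply: eq_bigr => k _; rewrite mulrDl.
Qed.

Lemma gaussJ_ge x : gauss (2 * (\sum_k rowsum n J k) + delta) x <= gaussJ x.
Proof.
rewrite /gaussJ -expR_sum -expRD gaussE ler_expR.
have JJ k l : `|J k l| <= J k l by rewrite ger0_norm.
have := quad_le n J JC J x JJ; rewrite ler_norml => /andP[lo _].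
have : \sum_k rowsum n J k * tnth x k ^+ 2 <=
    (\sum_k rowsum n J k) * \sum_k tnth x k ^+ 2.
  rewrite mulr_sumr; apply: ler_sum => k _; rewrite ler_wpM2r ?sqr_ge0//.
  by rewrite (bigD1 k)//= lerDl sumr_ge0// => l _; exact: rowsum_ge0.
rewrite sumrN (_ : \sum_k (rowsum n J k + delta) * _ =
  \sum_k rowsum n J k * tnth x k ^+ 2 + delta * \sum_k tnth x k ^+ 2); last first.
  by rewrite mulr_sumr -big_split/=; apply: eq_bigr => k _; rewrite mulrDl.
move: lo; rewrite -/(rowsum _ _ _); lra.
Qed.

Lemma gaussJ_ge0 x : 0 <= gaussJ x.
Proof. by rewrite gaussJE expR_ge0. Qed.

Lemma measurable_gaussJ : measurable_fun setT gaussJ.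
Proof.
apply: measurable_funM; first by apply: measurableT_comp => //; exact: measurable_quad.
apply: measurable_prod => k _.
by apply: (measurable_comp_coord n k (fun z => expR (- (_ * z ^+ 2)))); exact: measurable_gaussian.
Qed.

Lemma integrable_gaussJ : lam.-integrable setT (EFin \o gaussJ).
Proof.
apply: (gauss_dom n _ 1 delta measurable_gaussJ delta0) => x.
by rewrite mul1r ger0_norm ?gaussJ_ge0// gaussJ_le.
Qed.

(** Completing the square. *)
Lemma gaussJ_tilt (h : 'I_n -> R) x :
  expR (\sum_k h k * tnth x k) * gaussJ x =
  expR (4^-1 * \sum_k \sum_l h k * green n J delta k l * h l) *
  gaussJ (affine 1 [tuple - (2^-1 * \sum_l green n J delta k l * h l) | k < n] x).
Proof.
pose t k := 2^-1 * \sum_l green n J delta k l * h l.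
have tE k : lin t k = h k / 2.
  rewrite -(green_solve n J delta J0 JC delta0 h k) /lin.
  have -> : \sum_m J k m * t m = 2^-1 * \sum_m J k m * \sum_l green n J delta m l * h l.
    by rewrite mulr_sumr; apply: eq_bigr => m _; rewrite mulrCA.
  by rewrite /t; ring.
rewrite !gaussJE -!expRD; congr expR.
have hE : 4^-1 * \sum_k \sum_l h k * green n J delta k l * h l = \sum_k t k * lin t k.
  rewrite mulr_sumr; apply: eq_bigr => k _; rewrite tE /t.
  rewrite (eq_bigr (fun l => h k * (green n J delta k l * h l))); last by move=> l _; rewrite mulrA.
  by rewrite -mulr_sumr; field.
have sym (u v : 'I_n -> R) : \sum_k u k * lin v k = \sum_k v k * lin u k.
  have E (p q : 'I_n -> R) : \sum_k p k * lin q k =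
      \sum_k (rowsum n J k + delta) * (p k * q k) - \sum_k \sum_l J k l * (p k * q l).
    rewrite -sumrB; apply: eq_bigr => k _; rewrite /lin mulrBr mulr_sumr.
    by congr (_ - _); [ring|apply: eq_bigr => l _; ring].
  rewrite !E; congr (_ - _); first by apply: eq_bigr => k _; ring.
  by rewrite exchange_big/=; apply: eq_bigr => k _; apply: eq_bigr => l _; rewrite JC; ring.
have tn k : tnth (affine 1 [tuple - t k | k < n] x) k = tnth x k - t k :> R.
  by rewrite tnth_affine tnth_mktuple mul1r.
have linB k : lin (fun m => tnth x m - t m) k = lin (fun m => tnth x m) k - h k / 2.
  rewrite -tE /lin (eq_bigr (fun l => J k l * tnth x l - J k l * t l)); last first.
    by move=> l _; rewrite mulrBr.
  by rewrite sumrB; ring.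
rewrite hE; pose X k : R := tnth x k.
have -> : \sum_k tnth (affine 1 [tuple - t k | k < n] x) k *
    lin (fun k => tnth (affine 1 [tuple - t k | k < n] x) k) k =
    \sum_k (X k * lin X k - X k * lin t k - t k * lin X k + t k * lin t k).
  apply: eq_bigr => k _; rewrite tn.
  rewrite (_ : lin _ k = lin X k - lin t k); first by rewrite /X; ring.
  rewrite tE -linB /lin tn; congr (_ - _).
  by apply: eq_bigr => l _; rewrite tn.
rewrite big_split/= !sumrB (sym t X).
have -> : \sum_k h k * tnth x k = 2 * \sum_k X k * lin t k.
  by rewrite mulr_sumr; apply: eq_bigr => k _; rewrite tE /X; field.
by rewrite -/X; ring.
Qed.

Lemma gaussJ_mgf (h : 'I_n -> R) :
  lam.-integrable setT (EFin \o (fun x => expR (\sum_k h k * tnth x k) * gaussJ x)) /\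
  \int[lam]_x (expR (\sum_k h k * tnth x k) * gaussJ x) =
  expR (4^-1 * \sum_k \sum_l h k * green n J delta k l * h l) * \int[lam]_x gaussJ x.
Proof.
set t := [tuple - (2^-1 * \sum_l green n J delta k l * h l) | k < n].
have ii : lam.-integrable setT (EFin \o (fun x => gaussJ (affine 1 t x))).
  by apply: integrable_affine; [rewrite mulr1|exact: integrable_gaussJ].
rewrite (_ : (fun x => _) = (fun x => expR (4^-1 * \sum_k \sum_l h k * green n J delta k l * h l) *
    gaussJ (affine 1 t x))); last by apply/funext => x; exact: gaussJ_tilt.
split; first exact: integrableZ.
rewrite -(integral_affine n 1 t gaussJ (mulr1 1) measurable_gaussJ).
exact: RintegralZl.
Qed.

(** A sum over spins of exponentials of linear forms integrates to an Ising sum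
    whose couplings are given by the covariance of the Gaussian density. *)
Lemma isum_gaussJ (T : finType) (pi : T -> 'I_n) (w : T -> R) (f : (T -> R) -> R) :
  isum (fun a b => 4^-1 * (w a * w b) * green n J delta (pi a) (pi b))
    (index_enum (T * T)%type) f * \int[lam]_x gaussJ x =
  \int[lam]_x ((\sum_(s : {ffun T -> bool}) f (spins s) *
    \prod_a expR (w a * spins s a * tnth x (pi a))) * gaussJ x).
Proof.
pose h (s : {ffun T -> bool}) k : R := \sum_(a | pi a == k) w a * spins s a.
have hx s x : \prod_a expR (w a * spins s a * tnth x (pi a)) = expR (\sum_k h s k * tnth x k).
  rewrite -expR_sum; congr expR; rewrite (partition_big pi xpredT)//=.
  apply: eq_bigr => k _; rewrite /h mulr_suml.
  by apply: eq_bigr => a /eqP ->.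
have hh s : energy (fun a b => 4^-1 * (w a * w b) * green n J delta (pi a) (pi b))
    (index_enum (T * T)%type) (spins s) =
    4^-1 * \sum_k \sum_l h s k * green n J delta k l * h s l.
  rewrite /energy -(pair_bigA _ (fun a b => 4^-1 * (w a * w b) *
    green n J delta (pi a) (pi b) * (spins s a * spins s b)))/=.
  rewrite (partition_big pi xpredT)//= mulr_sumr; apply: eq_bigr => k _.
  under eq_bigr => a ak.
    rewrite (partition_big pi xpredT)//=; over.
  rewrite exchange_big/= mulr_sumr; apply: eq_bigr => l _.
  rewrite /h mulr_suml mulr_suml mulr_sumr; apply: eq_bigr => a /eqP ->.
  rewrite mulr_sumr mulr_sumr; apply: eq_bigr => b /eqP ->; ring.
rewrite /isum mulr_suml.
under [RHS]eq_Rintegral => x _.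
  rewrite mulr_suml; under eq_bigr => s _ do rewrite hx -mulrA.
  over.
rewrite (Rintegral_lin _ _ _ lam _ _ (fun s => f (spins s))
  (fun s x => expR (\sum_k h s k * tnth x k) * gaussJ x)); last first.
  by move=> s; case: (gaussJ_mgf (h s)).
by apply: eq_bigr => s _; rewrite (gaussJ_mgf (h s)).2 hh mulrA.
Qed.

End gaussian_mgf.

Section ghost_spins.
Context {R : realType} (n : nat).
Local Notation lam := (lebesgue_Rn R n).
Variables (J : 'I_n -> 'I_n -> R) (delta c : R) (i j : 'I_n).
Hypothesis J0 : forall k l, 0 <= J k l.
Hypothesis JC : forall k l, J k l = J l k.
Hypothesis delta0 : 0 < delta.
Hypothesis c1 : 1 <= c.

Local Notation spot := ('I_n + bool)%type.
Local Notation edges := (index_enum (spot * spot)%type).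

(** Two ghost spins, placed at [i] and [j]: summing the exponential of the field
    over a ghost, with its sign, yields a factor [sinh]. *)
Definition site (a : spot) : 'I_n :=
  match a with inl k => k | inr false => i | inr true => j end.

(** Ghosts of weight [1] enter the two-point function; for the normalization they
    are decoupled by the weight [0]. *)
Definition ghost_weight (g : R) (a : spot) : R := if a is inl _ then c else g.

Definition ghost_coupling g (a b : spot) :=
  4^-1 * (ghost_weight g a * ghost_weight g b) * green n J delta (site a) (site b).

Let K := (c + 2) / delta.

Let weight_ge0 g a : 0 <= g -> 0 <= ghost_weight g a.
Proof. by case: a => //= _ _; exact: le_trans ler01 c1. Qed.

Lemma ghost_coupling_ge0 g a b : 0 <= g -> 0 <= ghost_coupling g a b.
Proof. by move=> g0; rewrite !mulr_ge0 ?invr_ge0 ?weight_ge0// green_ge0. Qed.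

Lemma ghost_couplingC g a b : ghost_coupling g a b = ghost_coupling g b a.
Proof. by rewrite /ghost_coupling greenC// [ghost_weight _ _ * _]mulrC. Qed.

Let green_sum g k : 0 <= g -> g <= 1 -> \sum_b ghost_weight g b * green n J delta k (site b) <= K.
Proof.
move=> g0 g1; rewrite big_sumType/= big_bool/= -mulr_sumr.
have r := green_rowsum n J delta J0 JC delta0 k.
have le l : green n J delta k l <= delta^-1.
  by apply: le_trans r; rewrite (bigD1 l)//= lerDl sumr_ge0// => m _; exact: green_ge0.
have gle l : g * green n J delta k l <= delta^-1.
  apply: le_trans (le l); rewrite -[leRHS]mul1r ler_wpM2r// green_ge0//.
have := gle i; have := gle j.
have : c * \sum_l green n J delta k l <= c * delta^-1.
  by rewrite ler_wpM2l// (le_trans ler01 c1).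
rewrite /K mulrDl; lra.
Qed.

Let K0 : 0 <= K. Proof. by rewrite divr_ge0 ?(ltW delta0)//; have := c1; lra. Qed.

(** Removing the two ghosts from the interaction costs a bounded factor, because
    the total coupling of one site is bounded. *)
Lemma ghost_isum : isum (ghost_coupling 1) edges (fun=> 1) <=
  expR K * isum (ghost_coupling 0) edges (fun=> 1).
Proof.
rewrite /isum mulr_sumr; apply: ler_sum => s _; rewrite !mul1r -expRD ler_expR.
rewrite -lerBlDr /energy -sumrB.
apply: (@le_trans _ _ (\sum_(e <- edges) (ghost_coupling 1 e.1 e.2 - ghost_coupling 0 e.1 e.2))).
  apply: ler_sum => -[a b] _ /=; rewrite -mulrBl ler_piMr//; last first.
    by rewrite (le_trans (ler_norm _))// normrM !norm_sg mulr1.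
  rewrite subr_ge0 /ghost_coupling ler_wpM2r ?green_ge0// ler_wpM2l ?invr_ge0//.
  by apply: ler_pM; rewrite ?weight_ge0//; case: a b => [?|?] [?|?].
rewrite -(pair_bigA _ (fun a b => ghost_coupling 1 a b - ghost_coupling 0 a b))/=.
pose d (a : spot) : R := if a is inl _ then 0 else 1.
have dE a b : ghost_coupling 1 a b - ghost_coupling 0 a b =
    4^-1 * (d a * (ghost_weight 1 b * green n J delta (site a) (site b))) +
    4^-1 * (d b * (ghost_weight 0 a * green n J delta (site b) (site a))).
  rewrite /ghost_coupling (greenC n J delta JC (site b)).
  by case: a b => [?|?] [?|?] /=; ring.
have half g : 0 <= g -> g <= 1 ->
    \sum_a \sum_b 4^-1 * (d a * (ghost_weight g b * green n J delta (site a) (site b))) <= K / 2.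
  move=> g0 g1.
  apply: (@le_trans _ _ (\sum_a 4^-1 * (d a * K))).
    apply: ler_sum => a _; rewrite -2!mulr_sumr ler_wpM2l ?invr_ge0//.
    by rewrite ler_wpM2l ?green_sum//; case: a.
  rewrite big_sumType/= big_bool/= big1 => [|k _]; last by rewrite mul0r mulr0.
  by lra.
under eq_bigr do under eq_bigr do rewrite dE.
under eq_bigr do rewrite big_split/=.
rewrite big_split/= [X in _ + X]exchange_big/=.
have := half 1 ler01 (lexx _); have := half 0 (lexx _) ler01; lra.
Qed.

Let sum_exp y : \sum_b expR (sg b * y) = 2 * cosh y :> R.
Proof. by rewrite big_bool/= /sg expr1 expr0 mulN1r mul1r /cosh; field. Qed.

Let distr (F : spot -> bool -> R) :
  \sum_(s : {ffun spot -> bool}) \prod_a F a (s a) =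
  (\prod_k (F (inl k) true + F (inl k) false)) *
  ((F (inr true) true + F (inr true) false) * (F (inr false) true + F (inr false) false)).
Proof.
rewrite -(bigA_distr_bigA F)/= big_sumType/= big_bool/=; congr (_ * (_ * _));
  by rewrite ?big_bool//; apply: eq_bigr => k _; rewrite big_bool.
Qed.

Lemma ghost_sinh (x : 'Rn[R]_n) :
  \sum_(s : {ffun spot -> bool}) (spins s (inr false) * spins s (inr true)) *
    \prod_a expR (ghost_weight 1 a * spins s a * tnth x (site a)) =
  2 ^+ n.+2 * (sinh (tnth x i) * sinh (tnth x j) * \prod_k cosh (c * tnth x k)).
Proof.
pose F (a : spot) b := (if a is inl _ then 1 else sg b) *
  expR (ghost_weight 1 a * sg b * tnth x (site a)).
rewrite (eq_bigr (fun s : {ffun spot -> bool} => \prod_a F a (s a))); last first.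
  move=> s _; rewrite /F big_split/=; congr (_ * _).
  by rewrite big_sumType/= big_bool/= big1// mul1r mulrC.
rewrite distr /F/= !mul1r.
have E k : expR (c * sg true * tnth x k) + expR (c * sg false * tnth x k) = 2 * cosh (c * tnth x k).
  by rewrite -sum_exp big_bool/=; congr (expR _ + expR _); ring.
under eq_bigr do rewrite !mul1r E.
have S (y : R) : sg true * expR (sg true * y) + expR y = 2 * sinh y.
  by rewrite /sg expr1 !mulN1r /sinh; field.
rewrite !S.
by rewrite big_split/= prodr_const card_ord !exprS; ring.
Qed.

Lemma ghost_cosh (x : 'Rn[R]_n) :
  \sum_(s : {ffun spot -> bool}) 1 *
    \prod_a expR (ghost_weight 0 a * spins s a * tnth x (site a)) =
  2 ^+ n.+2 * \prod_k cosh (c * tnth x k).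
Proof.
pose F (a : spot) b : R := expR (ghost_weight 0 a * sg b * tnth x (site a)).
rewrite (eq_bigr (fun s : {ffun spot -> bool} => \prod_a F a (s a))); last first.
  by move=> s _; rewrite mul1r.
rewrite distr /F/= !mul0r expR0.
have E k : expR (c * sg true * tnth x k) + expR (c * sg false * tnth x k) = 2 * cosh (c * tnth x k).
  by rewrite -sum_exp big_bool/=; congr (expR _ + expR _); ring.
under eq_bigr do rewrite E.
by rewrite big_split/= prodr_const card_ord !exprS; ring.
Qed.

Let wgt (x : 'Rn[R]_n) := expR (quad n J x) *
  prodw n (fun k => dens_hi (rowsum n J k + delta) c) x.

Let wgtE x : wgt x = (\prod_k cosh (c * tnth x k)) * gaussJ n J delta x.
Proof. by rewrite /wgt /prodw /dens_hi big_split/= mulrCA. Qed.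

Lemma hi_le s z : dens_hi (s + delta) c z <=
  expR (c ^+ 2 / (2 * delta)) * expR (- ((s + delta / 2) * z ^+ 2)).
Proof.
rewrite /dens_hi (_ : - ((s + delta) * z ^+ 2) = - (s * z ^+ 2) - delta * z ^+ 2); last by ring.
rewrite (_ : - ((s + delta / 2) * z ^+ 2) = - (s * z ^+ 2) - delta / 2 * z ^+ 2); last by ring.
rewrite !expRD mulrCA [leRHS]mulrCA ler_wpM2l ?expR_ge0//.
apply: le_trans (gauss_exp_le delta c z delta0); rewrite ler_wpM2r ?expR_ge0//.
by rewrite (le_trans (cosh_le_expR _))// ler_expR normrM (ger0_norm (le_trans ler01 c1)).
Qed.

Let hi := fun k => dens_hi (rowsum n J k + delta) c.

Lemma hi_integrable (f : 'Rn[R]_n -> R) : measurable_fun setT f ->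
  (forall x, `|f x| <= expR (`|tnth x i| + `|tnth x j|)) ->
  lam.-integrable setT (EFin \o (fun x => f x * expR (quad n J x) * prodw n hi x)).
Proof.
move=> mf fb; apply: (weighted_integrable n J (delta / 2) JC _ i j J hi (fun=> expR (c ^+ 2 / (2 * delta)))) => //.
- by rewrite divr_gt0.
- by move=> k l; rewrite ger0_norm.
- by move=> k; exact: measurable_dens_hi.
- by move=> k z; exact: dens_hi_ge0.
- by move=> k z; exact: hi_le.
Qed.

Let one_le (x : 'Rn[R]_n) : `|1 : R| <= expR (`|tnth x i : R| + `|tnth x j : R|).
Proof. by rewrite normr1 -expR0 ler_expR addr_ge0. Qed.

Lemma hi_integrable1 :
  lam.-integrable setT (EFin \o (fun x => expR (quad n J x) * prodw n hi x)).
Proof.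
have := hi_integrable (fun=> 1) (measurable_cst _) one_le.
by congr (integrable _ _ (EFin \o _)); apply/funext => x; rewrite mul1r.
Qed.

(** Numerator and denominator become Ising sums over the same set of spins, with
    coupled and with decoupled ghosts. *)
Lemma hi_ratio : \int[lam]_x (sinh (tnth x i) * sinh (tnth x j) *
    expR (quad n J x) * prodw n hi x) <=
  expR K * corr (ghost_coupling 1) edges (inr false) (inr true) *
    \int[lam]_x (expR (quad n J x) * prodw n hi x).
Proof.
have p2 : 0 < 2 ^+ n.+2 :> R by rewrite exprn_gt0.
rewrite -(ler_pM2l p2).
set N := \int[lam]_x _; set D := \int[lam]_x _; set Z := \int[lam]_x gaussJ n J delta x.
have NE : 2 ^+ n.+2 * N = isum (ghost_coupling 1) edges
    (fun v => v (inr false) * v (inr true)) * Z.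
  rewrite [RHS](isum_gaussJ n J delta J0 JC delta0 _ site (ghost_weight 1)).
  have ii := hi_integrable (fun x => sinh (tnth x i) * sinh (tnth x j)).
  rewrite -(RintegralZl _ measurableT (ii _ _)).
  - by apply: eq_Rintegral => x _; rewrite ghost_sinh -!mulrA -/(wgt x) wgtE.
  - have ms k : measurable_fun [set: 'Rn[R]_n] (fun x => sinh (tnth x k)).
      apply: measurable_funM => //; apply: measurable_funB; apply: measurableT_comp => //.
        exact: measurable_coord.
      by apply: measurableT_comp => //; exact: measurable_coord.
    exact: measurable_funM.
  - by move=> x; rewrite normrM expRD; apply: ler_pM => //; exact: norm_sinh_le.
have DE : 2 ^+ n.+2 * D = isum (ghost_coupling 0) edges (fun=> 1) * Z.
  rewrite [RHS](isum_gaussJ n J delta J0 JC delta0 _ site (ghost_weight 0)).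
  rewrite -(RintegralZl _ measurableT hi_integrable1).
  by apply: eq_Rintegral => x _; rewrite ghost_cosh -mulrA -/(wgt x) wgtE.
have Z0 : 0 <= Z by apply: Rintegral_ge0 => x _; exact: gaussJ_ge0.
have cge0 : 0 <= corr (ghost_coupling 1) edges (inr false) (inr true).
  by apply: corr_ge0 => a b; exact: ghost_coupling_ge0.
rewrite [leRHS]mulrCA DE NE mulrA ler_wpM2r// -[leRHS]mulrAC.
apply: le_trans (ler_wpM2r cge0 ghost_isum).
by rewrite /corr mulrC divfK// gt_eqF// isum1_gt0.
Qed.

Lemma hi_gt0 : 0 < \int[lam]_x (expR (quad n J x) * prodw n hi x).
Proof.
pose e := 2 * (\sum_k rowsum n J k) + delta.
have e0 : 0 < e by rewrite ltr_wpDl// mulr_ge0// sumr_ge0// => k _; exact: rowsum_ge0.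
apply: lt_le_trans (Rintegral_gauss_gt0 n e e0) _.
apply: le_Rintegral => //; [exact: integrable_gauss|exact: hi_integrable1|].
move=> x _; rewrite -/(wgt x) wgtE.
apply: le_trans (gaussJ_ge n J delta J0 JC x) _.
rewrite ler_peMl ?gaussJ_ge0//; elim/big_ind: _ => // [p q p1 q1|k _].
  by rewrite -[1]mul1r ler_pM.
have := ler_cosh 0 (c * tnth x k); rewrite normr0 normr_ge0 => /(_ isT).
by apply: le_trans; rewrite /cosh oppr0 expR0; lra.
Qed.

End ghost_spins.

Lemma hi_decay {R : realType} (alpha delta S Kj c : R) :
  0 < alpha -> 0 < delta -> 0 <= S -> 0 <= Kj -> 1 <= c ->
  exists2 C : R, 0 <= C & forall n (J : 'I_n -> 'I_n -> R) (pos : 'I_n -> nat),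
    injective pos -> (forall k l, 0 <= J k l) -> (forall k l, J k l = J l k) ->
    (forall k, rowsum n J k <= S) ->
    (forall k l, J k l <= Kj * decay (2 + alpha) (gap (pos k) (pos l))) ->
    let hi k := dens_hi (rowsum n J k + delta) c in forall i j,
    \int[lebesgue_Rn R n]_x (sinh (tnth x i) * sinh (tnth x j) *
      expR (quad n J x) * prodw n hi x) <=
    C * decay (2 + alpha) (gap (pos i) (pos j)) *
      \int[lebesgue_Rn R n]_x (expR (quad n J x) * prodw n hi x).
Proof.
move=> alpha0 delta0 S0 Kj0 c1.
have [Cg Cg0 G] := green_decay alpha delta S Kj alpha0 delta0 S0 Kj0.
pose e := alpha / 4.
have e0 : 0 < e by rewrite divr_gt0.
have pE : 2 + alpha = 2 + 4 * e by rewrite /e; field.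
have Cj0 : 0 <= 4^-1 * (c * c) * Cg.
  by rewrite !mulr_ge0 ?invr_ge0// (le_trans ler01 c1).
have [C C0 I] := ising_decay e _ e0 Cj0.
exists (expR ((c + 2) / delta) * C); first by rewrite mulr_ge0 ?expR_ge0.
move=> n J pos pos_inj J0 JC JS Jd hi i j.
apply: le_trans (hi_ratio n J delta c i j J0 JC delta0 c1) _.
apply: ler_wpM2r; first exact/ltW/hi_gt0.
rewrite -mulrA ler_wpM2l ?expR_ge0// pE.
apply: (I _ (fun a => pos (site n i j a))); last first.
  by move=> a b; exact: ghost_couplingC.
split.
- move=> m; rewrite -sum1_card big_mkcond big_sumType/= big_bool/=.
  rewrite -big_mkcond/= sum1_card.
  have le1 : (#|[pred k | pos k == m]| <= 1)%N.
    apply/card_le1_eqP => a b; rewrite !inE => /eqP <- /eqP /pos_inj; exact.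
  by rewrite (leq_trans (leq_add le1 (leqnn _)))//; do 2 case: ifP.
- by move=> a b; exact: ghost_coupling_ge0.
- move=> a b; rewrite -pE /ghost_coupling -[leRHS]mulrA; apply: ler_pM.
  + by rewrite !mulr_ge0 ?invr_ge0//; case: a b => [?|?] [?|?] /=; rewrite ?ler01// (le_trans ler01 c1).
  + exact: green_ge0.
  + rewrite ler_wpM2l ?invr_ge0//; apply: ler_pM;
      case: a b => [?|?] [?|?] /=; rewrite ?ler01//; exact: le_trans ler01 c1.
  + exact: G.
Qed.

(** * Measures with a density *)

Section density.
Context d (T : measurableType d) (R : realType).
Variables (P : probability T R) (lam : {sigma_finite_measure set T -> \bar R}).
Variable w : T -> R.
Hypothesis w0 : forall x, 0 <= w x.
Hypothesis wi : lam.-integrable setT (EFin \o w).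
Hypothesis Pw : forall A, measurable A -> P A = (\int[lam]_(x in A) (w x)%:E)%E.

Let mw : measurable_fun setT w.
Proof. by apply/measurable_EFinP; exact: measurable_int wi. Qed.

(** The density agrees almost everywhere with the Radon-Nikodym derivative, for
    which the change of variables is known. *)
Lemma ge0_integral_density (f : T -> \bar R) : measurable_fun setT f ->
  (forall x, 0 <= f x)%E -> (\int[P]_x f x = \int[lam]_x (f x * (w x)%:E))%E.
Proof.
move=> mf f0; have Plam : P `<< lam.
  apply/null_content_dominatesP => A mA lA; rewrite Pw// null_set_integral//.
  by apply/measurable_EFinP; exact: measurable_funTS.
rewrite -(Radon_Nikodym_SigmaFinite.change_of_variables Plam f0 measurableT mf).
apply: ae_eq_integral => //.
- apply: emeasurable_funM => //.
  exact: measurable_int (Radon_Nikodym_SigmaFinite.f_integrable Plam).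
- by apply: emeasurable_funM => //; exact/measurable_EFinP.
have : ae_eq lam setT (Radon_Nikodym_SigmaFinite.f P lam) (EFin \o w).
  apply: integral_ae_eq => //.
  - exact: Radon_Nikodym_SigmaFinite.f_integrable.
  - exact/measurable_EFinP.
  - move=> A _ mA; rewrite -Pw//.
    by rewrite -(Radon_Nikodym_SigmaFinite.f_integral Plam).
by apply: filterS => x /(_ I) ->.
Qed.

Lemma integral_density (f : T -> R) : measurable_fun setT f ->
  lam.-integrable setT (EFin \o (fun x => f x * w x)) ->
  P.-integrable setT (EFin \o f) /\
  (\int[P]_x (f x)%:E)%E = (\int[lam]_x (f x * w x))%:E.
Proof.
move=> mf fwi; have mEf : measurable_fun setT (EFin \o f) by exact/measurable_EFinP.
have fP : P.-integrable setT (EFin \o f).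
  apply/integrableP; split=> //.
  rewrite ge0_integral_density//; last exact: measurableT_comp.
  case/integrableP : fwi => _; congr (_ < _)%E; apply: eq_integral => x _ /=.
  by rewrite -EFinM normrM (ger0_norm (w0 x)).
split=> //; rewrite /Rintegral fineK; last exact: integrable_fin_num.
rewrite [LHS]integralE [RHS]integralE; congr (_ - _)%E.
- rewrite ge0_integral_density//; last exact: measurable_funepos.
  apply: eq_integral => x _; rewrite !funeposE /=.
  by rewrite -!EFin_max -EFinM maxr_pMl// mul0r.
- rewrite ge0_integral_density//; last exact: measurable_funeneg.
  apply: eq_integral => x _; rewrite !funenegE /=.
  by rewrite -!EFin_max -EFinM maxr_pMl// mul0r mulNr.
Qed.

End density.

(** * Even perturbations of a Gaussian density *)

Lemma lo_le {R : realType} (s delta b : R) (kap bet : R -> R) z :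
  (forall x y, `|x| <= `|y| -> kap x <= kap y) -> (forall x, `|bet x| <= b) -> 0 < delta ->
  dens_lo (s + delta) kap bet z <= expR (b - kap 0) * expR (- ((s + delta / 2) * z ^+ 2)).
Proof.
move=> kap_mono bet_b delta0; rewrite -expRD ler_expR.
have := kap_mono 0 z; rewrite normr0 normr_ge0 => /(_ isT).
have := bet_b z; rewrite ler_norml => /andP[lo _] km.
have : 0 <= delta / 2 * z ^+ 2 by rewrite mulr_ge0 ?sqr_ge0// divr_ge0// ltW.
by rewrite !mulrDl -[delta / 2 * _]mulrAC; lra.
Qed.

(** The comparison replaces even potentials and couplings of either sign by the
    densities [dens_hi] and ferromagnetic couplings, for which [hi_decay] holds.
    The constant [c] suits all sites at once. *)
Lemma conditional_bound {R : realType} (alpha delta S Kj b : R) :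
  0 < alpha -> 0 < delta -> 0 <= S -> 0 <= Kj -> 0 <= b ->
  exists2 C : R, 0 <= C &
  forall n (J J' : 'I_n -> 'I_n -> R) (pos : 'I_n -> nat) (kap bet : 'I_n -> R -> R),
    injective pos -> (forall k l, `|J' k l| <= J k l) -> (forall k l, J k l = J l k) ->
    (forall k, rowsum n J k <= S) ->
    (forall k l, J k l <= Kj * decay (2 + alpha) (gap (pos k) (pos l))) ->
    (forall k, measurable_fun setT (kap k)) -> (forall k, measurable_fun setT (bet k)) ->
    (forall k x y, `|x| <= `|y| -> kap k x <= kap k y) ->
    (forall k x, `|bet k x| <= b) ->
    (forall k x y, bet k x - bet k y <= b * `| `|x| - `|y| |) ->
    let lo k := dens_lo (rowsum n J k + delta) (kap k) (bet k) in forall i j,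
    `|\int[lebesgue_Rn R n]_x (tnth x i * tnth x j * expR (quad n J' x) * prodw n lo x)| <=
    C * decay (2 + alpha) (gap (pos i) (pos j)) *
      \int[lebesgue_Rn R n]_x (expR (quad n J' x) * prodw n lo x).
Proof.
move=> alpha0 delta0 S0 Kj0 b0.
pose c := 1 + 2 * b + 4 * (S + delta) * (2 * b + 1).
have cp : 0 <= 4 * (S + delta) * (2 * b + 1).
  by rewrite !mulr_ge0// ?addr_ge0 ?mulr_ge0// ltW.
have c1 : 1 <= c by rewrite /c; lra.
have cb : 2 * b <= c by rewrite /c; lra.
have cS : 4 * (S + delta) * (2 * b + 1) <= c ^+ 2.
  by rewrite (@le_trans _ _ c)//; [rewrite /c; lra|rewrite expr2 ler_peMr// (le_trans ler01)].
clearbody c.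
have [C C0 H] := hi_decay alpha delta S Kj c alpha0 delta0 S0 Kj0 c1.
exists C => // n J J' pos kap bet pos_inj JJ' JC JS Jd mkap mbet kap_mono bet_b bet_lip lo i j.
have J0 k l : 0 <= J k l by exact: le_trans (normr_ge0 _) (JJ' k l).
have s0 k : 0 <= rowsum n J k by exact: rowsum_ge0.
have e0 : 0 < delta / 2 by rewrite divr_gt0.
have d0 := hi_gt0 n J delta c i j J0 JC delta0 c1.
pose hi k := dens_hi (rowsum n J k + delta) c.
have := ginibre_comparison n J J' hi lo (delta / 2) (fun=> expR (c ^+ 2 / (2 * delta)))
  (fun k => expR (b - kap k 0)) JJ' JC e0.
have a0 k : 0 < rowsum n J k + delta by rewrite ltr_wpDl.
have cab k : 4 * (rowsum n J k + delta) * (2 * b + 1) <= c ^+ 2.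
  apply: le_trans cS; rewrite ler_wpM2r//; first by lra.
  by rewrite ler_wpM2l// lerD2r.
move=> /(_ (fun k => measurable_dens_hi _ _)).
move=> /(_ (fun k => measurable_dens_lo _ _ _ (mkap k) (mbet k))).
move=> /(_ (fun k => dens_hi_ge0 _ _)) /(_ (fun k => dens_lo_ge0 _ _ _)).
move=> /(_ (fun k z => hi_le delta c delta0 c1 _ z)).
move=> /(_ (fun k z => lo_le _ _ b _ _ z (kap_mono k) (bet_b k) delta0)).
move=> /(_ (fun k => one_site_ge0 _ b c _ _ (a0 k) b0 c1 cb (cab k) (mkap k) (mbet k) (kap_mono k)
  (bet_b k) (bet_lip k)) i j) G.
have {}H := H n J pos pos_inj J0 JC JS Jd i j.
have I0 : 0 <= \int[lebesgue_Rn R n]_x (expR (quad n J' x) * prodw n lo x).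
  by apply: Rintegral_ge0 => x _; rewrite mulr_ge0 ?expR_ge0 ?prodw_ge0// => k z; exact: dens_lo_ge0.
rewrite -(ler_pM2r d0); apply: le_trans G _.
by rewrite mulrAC; apply: ler_wpM2r.
Qed.

(** * Covariances by doubling the system *)

Section sum_difference.
Context {R : realType} (n : nat).
Local Notation lam := (lebesgue_Rn R n).
Local Notation Rn := ('Rn[R]_n).

Definition opp_tuple (x : Rn) : Rn := [tuple - tnth x k | k < n].
Definition half_tuple (x : Rn) : Rn := [tuple tnth x k / 2 | k < n].

Lemma tnth_opp (x : Rn) k : tnth (opp_tuple x) k = - tnth x k.
Proof. exact: tnth_mktuple. Qed.

Lemma tnth_half (x : Rn) k : tnth (half_tuple x) k = tnth x k / 2.
Proof. exact: tnth_mktuple. Qed.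

Lemma measurable_coord_fst d (T : measurableType d) k :
  measurable_fun [set: Rn * T] (fun w => tnth w.1 k : R).
Proof. by apply: (measurableT_comp (measurable_coord n k)); exact: measurable_fst. Qed.

Lemma measurable_coord_snd d (T : measurableType d) k :
  measurable_fun [set: T * Rn] (fun w => tnth w.2 k : R).
Proof. by apply: (measurableT_comp (measurable_coord n k)); exact: measurable_snd. Qed.

Variables (F : Rn * Rn -> R) (K e : R).
Hypothesis e0 : 0 < e.
Hypothesis mF : measurable_fun setT F.
Hypothesis Fdom : forall u v, `|F (u, v)| <= K * (gauss e u * gauss e v).

Let G (w : Rn * Rn) : R := F (w.1, affine 1 (opp_tuple w.1) w.2).

Let mG : measurable_fun setT G.
Proof.
apply: (measurableT_comp mF); apply: measurable_fun_pair; first exact: measurable_fst.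
apply: measurable_tuple => k; under eq_fun do rewrite tnth_affine tnth_opp mul1r.
by apply: measurable_funB; [exact: measurable_coord_snd|exact: measurable_coord_fst].
Qed.

Let K0 : 0 <= K.
Proof.
have := le_trans (normr_ge0 _) (Fdom [tuple 0 | k < n] [tuple 0 | k < n]).
by rewrite pmulr_lge0// mulr_gt0 ?gauss_gt0.
Qed.

Let Gdom u p : `|G (u, p)| <= (K * gauss (e / 4) u) * gauss (e / 4) p.
Proof.
apply: le_trans (Fdom _ _) _; rewrite -mulrA ler_wpM2l// !gaussE -!expRD ler_expR/=.
rewrite -!opprD lerN2 !mulr_sumr -!big_split/=; apply: ler_sum => k _.
rewrite tnth_affine tnth_opp mul1r; move: (tnth u k : R) (tnth p k : R) => x y.
rewrite -subr_ge0 (_ : _ - _ = e * ((x - 2^-1 * y) ^+ 2 + 2^-1 * (x - y) ^+ 2 + 4^-1 * x ^+ 2)); last by field.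
apply: mulr_ge0; first exact: ltW.
by have := sqr_ge0 (x - 2^-1 * y); have := sqr_ge0 (x - y); have := sqr_ge0 x; lra.
Qed.

Let e40 : 0 < e / 4. Proof. by rewrite divr_gt0. Qed.

Let iK : lam.-integrable setT (EFin \o (fun u : Rn => K * gauss (e / 4) u)).
Proof. exact: integrableZ (integrable_gauss n _ e40). Qed.

(** The change of variables [u = p / 2 + z], [v = p / 2 - z]. *)
Lemma sum_difference :
  let f p := \int[lam]_z F (affine 1 (half_tuple p) z, affine (-1) (half_tuple p) z) in
  lam.-integrable setT (EFin \o f) /\
  \int[lam]_u \int[lam]_v F (u, v) = \int[lam]_p f p.
Proof.
move=> f.
have fE p : f p = \int[lam]_u G (u, p).
  rewrite -(integral_affine n 1 (half_tuple p) (fun u => G (u, p)) (mulr1 1)); last first.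
    exact: (measurableT_comp mG (pair2_measurable p)).
  apply: eq_Rintegral => z _; rewrite /G/=; congr (F (_, _)).
  apply: eq_from_tnth => k; rewrite [LHS]tnth_affine [RHS]tnth_affine tnth_opp tnth_affine tnth_half.
  by field.
rewrite (_ : f = fun p => \int[lam]_u G (u, p)); last exact/funext.
pose G' (w : Rn * Rn) := G (w.2, w.1).
have mG' : measurable_fun setT G'.
  by apply: (measurableT_comp mG); apply: measurable_fun_pair; [exact: measurable_snd|exact: measurable_fst].
have G'dom p u : `|G' (p, u)| <= gauss (e / 4) p * (K * gauss (e / 4) u).
  by rewrite mulrC; exact: Gdom.
split; first exact: (dom_outer1 _ _ _ _ _ lam lam G' _ _ mG' (integrable_gauss n _ e40) iK G'dom).
rewrite -(Rfubini _ _ _ _ _ lam lam G _ _ mG iK (integrable_gauss n _ e40) Gdom).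
apply: eq_Rintegral => u _.
rewrite -(integral_affine n 1 (opp_tuple u) (fun v => F (u, v)) (mulr1 1))//.
exact: (measurableT_comp mF (pair1_measurable u)).
Qed.

Lemma difference_integrable (q : Rn) :
  lam.-integrable setT (EFin \o (fun z => F (affine 1 q z, affine (-1) q z))).
Proof.
apply: (gauss_dom n _ K e) => //.
  by apply: (measurableT_comp mF); apply: measurable_fun_pair; exact: measurable_affine.
move=> z; apply: le_trans (Fdom _ _) _; rewrite ler_wpM2l// !gaussE -expRD ler_expR.
rewrite -!opprD lerN2 !mulr_sumr -!big_split/=; apply: ler_sum => k _.
rewrite !tnth_affine mul1r mulN1r; move: (tnth z k : R) (tnth q k : R) => x y.
rewrite -subr_ge0 (_ : _ - _ = e * (x ^+ 2 + 2 * y ^+ 2)); last by ring.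
by apply: mulr_ge0; [exact: ltW|have := sqr_ge0 x; have := sqr_ge0 y; lra].
Qed.

End sum_difference.

Section doubling.
Context {R : realType} (n : nat) (W : 'Rn[R]_n -> R) (K e B : R) (i j : 'I_n).
Local Notation lam := (lebesgue_Rn R n).
Hypothesis e0 : 0 < e.
Hypothesis mW : measurable_fun setT W.
Hypothesis W0 : forall u, 0 <= W u.
Hypothesis Wdom : forall u, expR (`|tnth u i| + `|tnth u j|) * W u <= K * gauss e u.
Hypothesis conditional : forall q,
  `|\int[lam]_z (tnth z i * tnth z j * (W (affine 1 q z) * W (affine (-1) q z)))| <=
  B * \int[lam]_z (W (affine 1 q z) * W (affine (-1) q z)).

Lemma tilted_integrable (f : 'Rn[R]_n -> R) : measurable_fun setT f ->
  (forall u, `|f u| <= expR (`|tnth u i| + `|tnth u j|)) ->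
  lam.-integrable setT (EFin \o (fun u => f u * W u)).
Proof.
move=> mf fb; apply: (gauss_dom n _ K e) => //; first exact: measurable_funM.
move=> u; rewrite normrM [X in _ * X]ger0_norm//.
by apply: le_trans (Wdom u); rewrite ler_wpM2r.
Qed.

Let ge_expR (x y : R) : 0 <= x -> x <= y -> x <= expR y.
Proof. by move=> x0 xy; rewrite (le_trans xy)// (le_trans _ (expR_ge1Dx _))// lerDr. Qed.

Lemma tilted_integrable1 : lam.-integrable setT (EFin \o W).
Proof.
have := tilted_integrable (fun=> 1) (measurable_cst _).
rewrite (_ : (fun u => _) = W); last by apply/funext => u; rewrite mul1r.
by apply=> u; rewrite normr1 -expR0 ler_expR addr_ge0.
Qed.

Lemma tilted_integrable_i : lam.-integrable setT (EFin \o (fun u => tnth u i * W u)).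
Proof.
apply: tilted_integrable; first exact: measurable_coord.
by move=> u; apply: ge_expR => //; rewrite lerDl.
Qed.

Lemma tilted_integrable_j : lam.-integrable setT (EFin \o (fun u => tnth u j * W u)).
Proof.
apply: tilted_integrable; first exact: measurable_coord.
by move=> u; apply: ge_expR => //; rewrite lerDr.
Qed.

Lemma tilted_integrable_ij :
  lam.-integrable setT (EFin \o (fun u => tnth u i * tnth u j * W u)).
Proof.
apply: tilted_integrable; first by apply: measurable_funM; exact: measurable_coord.
by move=> u; rewrite normrM expRD; apply: ler_pM => //; apply: ge_expR.
Qed.

Let Z := \int[lam]_u W u.
Let Ei := \int[lam]_u (tnth u i * W u).
Let Ej := \int[lam]_u (tnth u j * W u).
Let Eij := \int[lam]_u (tnth u i * tnth u j * W u).

Let D (w : 'Rn[R]_n * 'Rn[R]_n) : R :=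
  (tnth w.1 i - tnth w.2 i) * (tnth w.1 j - tnth w.2 j) * (W w.1 * W w.2).
Let WW (w : 'Rn[R]_n * 'Rn[R]_n) : R := W w.1 * W w.2.

Let mWW : measurable_fun setT WW.
Proof.
by apply: measurable_funM; apply: (measurableT_comp mW); [exact: measurable_fst|exact: measurable_snd].
Qed.

Let mD : measurable_fun setT D.
Proof.
apply: measurable_funM => //; apply: measurable_funM; apply: measurable_funB;
  first [exact: measurable_coord_fst|exact: measurable_coord_snd].
Qed.

Let exp2 u : 1 <= expR (`|tnth u i : R| + `|tnth u j : R|).
Proof. by rewrite -expR0 ler_expR addr_ge0. Qed.

Let dom2 f u v : `|f| <= expR (`|tnth u i : R| + `|tnth u j : R|) * expR (`|tnth v i : R| + `|tnth v j : R|) ->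
  `|f * (W u * W v)| <= K * K * (gauss e u * gauss e v).
Proof.
move=> fb; rewrite normrM [X in _ * X]ger0_norm ?mulr_ge0//.
rewrite [leRHS]mulrACA; apply: le_trans (ler_wpM2r _ fb) _; first by rewrite mulr_ge0.
by rewrite [leLHS]mulrACA; apply: ler_pM; [apply: mulr_ge0 => //; exact: expR_ge0|
  apply: mulr_ge0 => //; exact: expR_ge0|exact: Wdom|exact: Wdom].
Qed.

Let Ddom u v : `|D (u, v)| <= K * K * (gauss e u * gauss e v).
Proof.
apply: dom2; rewrite -expRD normrM addrACA expRD /=; apply: ler_pM => //;
  by apply: ge_expR => //; exact: ler_normB.
Qed.

Let WWdom u v : `|WW (u, v)| <= K * K * (gauss e u * gauss e v).
Proof.
rewrite -[WW _]mul1r; apply: dom2; rewrite normr1 -[leLHS]mul1r.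
by apply: ler_pM => //; exact: exp2.
Qed.

Let product_form (F : 'Rn[R]_n * 'Rn[R]_n -> R) : measurable_fun setT F ->
  (forall u v, `|F (u, v)| <= K * K * (gauss e u * gauss e v)) ->
  \int[(lam \x lam)%E]_w F w = \int[lam]_u \int[lam]_v F (u, v).
Proof.
move=> mF Fd; apply: (Rfubini1 _ _ _ _ _ lam lam F (fun u => K * K * gauss e u) (gauss e) mF).
- exact: integrableZ (integrable_gauss n _ e0).
- exact: integrable_gauss.
- by move=> u v; rewrite -mulrA; exact: Fd.
Qed.

Let WWE : \int[lam]_u \int[lam]_v WW (u, v) = Z * Z.
Proof.
rewrite -product_form//.
exact: (Rintegral_prod _ _ _ _ _ lam lam _ _ tilted_integrable1 tilted_integrable1).
Qed.

Let DE : \int[lam]_u \int[lam]_v D (u, v) = 2 * (Z * Eij - Ei * Ej).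
Proof.
rewrite -product_form//.
have I0 := tilted_integrable1; have Ii := tilted_integrable_i.
have Ij := tilted_integrable_j; have Iij := tilted_integrable_ij.
have p1 := prod_integrable _ _ _ _ _ lam lam _ _ Iij I0.
have p2 := prod_integrable _ _ _ _ _ lam lam _ _ I0 Iij.
have p3 := prod_integrable _ _ _ _ _ lam lam _ _ Ii Ij.
have p4 := prod_integrable _ _ _ _ _ lam lam _ _ Ij Ii.
rewrite [RHS](_ : _ = (Eij * Z + Z * Eij) - (Ei * Ej + Ej * Ei)); last by ring.
rewrite /Eij /Z /Ei /Ej.
rewrite -(Rintegral_prod _ _ _ _ _ lam lam _ _ Iij I0).
rewrite -(Rintegral_prod _ _ _ _ _ lam lam _ _ I0 Iij).
rewrite -(Rintegral_prod _ _ _ _ _ lam lam _ _ Ii Ij).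
rewrite -(Rintegral_prod _ _ _ _ _ lam lam _ _ Ij Ii).
rewrite -(RintegralD measurableT p1 p2) -(RintegralD measurableT p3 p4).
rewrite -(RintegralB measurableT (integrableRD _ _ _ _ _ p1 p2) (integrableRD _ _ _ _ _ p3 p4)).
by apply: eq_Rintegral => w _; rewrite /D; ring.
Qed.

(** Twice the left side is the absolute value of the integral of
    [(u_i - v_i) (u_j - v_j)] over two independent copies, which is bounded
    conditionally on [u + v]. *)
Lemma doubling : `|Z * Eij - Ei * Ej| <= 2 * B * (Z * Z).
Proof.
have [iD] := sum_difference n D (K * K) e e0 mD Ddom; rewrite DE => DI.
have [iW] := sum_difference n WW (K * K) e e0 mWW WWdom; rewrite WWE => WI.
set d := fun p => _ in iD DI; set w := fun p => _ in iW WI.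
have dE p : d p = 4 * \int[lam]_z (tnth z i * tnth z j *
    (W (affine 1 (half_tuple n p) z) * W (affine (-1) (half_tuple n p) z))).
  have iz := difference_integrable n D (K * K) e e0 mD Ddom (half_tuple n p).
  set h := fun z => _ * (W _ * W _).
  have E z : D (affine 1 (half_tuple n p) z, affine (-1) (half_tuple n p) z) = 4 * h z.
    by rewrite /D /h /= !tnth_affine; ring.
  have hE z : h z = 4^-1 * D (affine 1 (half_tuple n p) z, affine (-1) (half_tuple n p) z).
    by rewrite E mulKf.
  have ih : lam.-integrable setT (EFin \o h).
    by have := integrableZ _ _ _ _ 4^-1 iz; congr integrable; apply/funext => z /=; rewrite hE.
  by rewrite -(RintegralZl _ measurableT ih); apply: eq_Rintegral => z _; exact: E.
have dw p : `|d p| <= 4 * B * w p.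
  by rewrite dE normrM ger0_norm// -mulrA ler_wpM2l.
have iBw : lam.-integrable setT (EFin \o (fun p => 4 * B * w p)) by exact: integrableZ iW.
have iBw' : lam.-integrable setT (EFin \o (fun p => - (4 * B) * w p)) by exact: integrableZ iW.
have up : \int[lam]_p d p <= 4 * B * (Z * Z).
  rewrite WI -(RintegralZl _ measurableT iW); apply: le_Rintegral => //.
  by move=> p _; exact: le_trans (ler_norm _) (dw p).
have lo : - (4 * B) * (Z * Z) <= \int[lam]_p d p.
  rewrite WI -(RintegralZl _ measurableT iW); apply: le_Rintegral => //.
  by move=> p _; have := dw p; rewrite ler_norml => /andP[+ _]; rewrite mulNr.
by rewrite ler_norml; move: up lo; rewrite -DI; lra.
Qed.


End doubling.

(** * Convex potentials with bounded perturbations *)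

Section one_variable.
Context {R : realType}.
Implicit Types f : R -> R.

Lemma derivable_continuousR f : (forall z, derivable f z 1) -> continuous f.
Proof. by move=> df z; apply/differentiable_continuous/derivable1_diffP. Qed.

Lemma derivable_measurable f : (forall z, derivable f z 1) -> measurable_fun setT f.
Proof. by move=> df; apply: continuous_measurable_fun; exact: derivable_continuousR. Qed.

Lemma mean_value f a b : (forall z, derivable f z 1) -> a <= b ->
  exists2 c, a <= c <= b & f b - f a = f^`()%classic c * (b - a).
Proof.
move=> df ab.
have [||c cab fE] := @MVT_segment R f (f^`()%classic) a b ab.
- by move=> x _; rewrite derive1E; exact: derivableP.
- by apply: derivable_within_continuous => x _.
- by exists c => //; rewrite in_itv/= in cab.
Qed.

Section convex.
Variable f : R -> R.
Hypothesis df : forall z, derivable f z 1.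
Hypothesis ddf : forall z, derivable (f^`()%classic) z 1.
Hypothesis f2 : forall z, 0 <= f^`(2)%classic z.

Lemma derive1_nondecreasing a b : a <= b -> f^`()%classic a <= f^`()%classic b.
Proof.
move=> ab; have [c _ E] := mean_value _ a b ddf ab.
by rewrite -subr_ge0 E mulr_ge0 ?subr_ge0//; exact: f2.
Qed.

Lemma above_tangent x : f 0 + f^`()%classic 0 * x <= f x.
Proof.
have [x0|/ltW x0] := leP 0 x.
  have [c /andP[c0 _]] := mean_value _ 0 x df x0; rewrite subr0 => E.
  have := ler_wpM2r x0 (derive1_nondecreasing _ _ c0); rewrite -E; lra.
have [c /andP[_ c0]] := mean_value _ x 0 df x0; rewrite sub0r => E.
have x0' : 0 <= - x by rewrite oppr_ge0.
have := ler_wpM2r x0' (derive1_nondecreasing _ _ c0); rewrite -E; lra.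
Qed.

Lemma convex_symmetric_mono q x y : `|x| <= `|y| ->
  f (x + q) + f (- x + q) <= f (y + q) + f (- y + q).
Proof.
have absE z : f (z + q) + f (- z + q) = f (`|z| + q) + f (- `|z| + q).
  by case: (ger0P z) => _ //; rewrite opprK addrC.
rewrite (absE x) (absE y); move: `|x| `|y| (normr_ge0 x) => {}x {}y x0 xy.
have r : x + q <= y + q by lra.
have l : - y + q <= - x + q by lra.
have [c /andP[c0 _] E] := mean_value _ _ _ df r.
have [d /andP[_ d0] E'] := mean_value _ _ _ df l.
have cd : d <= c by lra.
have := derive1_nondecreasing _ _ cd; rewrite -subr_ge0 => m.
have yx : 0 <= y - x by lra.
have := mulr_ge0 m yx.
move: E E'; rewrite (_ : y + q - (x + q) = y - x); last by ring.
rewrite (_ : - x + q - (- y + q) = y - x); last by ring.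
by rewrite mulrBl => <- <-; lra.
Qed.

End convex.

Lemma lipschitz f C : (forall z, derivable f z 1) -> (forall z, `|f^`()%classic z| <= C) ->
  forall x y, `|f x - f y| <= C * `|x - y|.
Proof.
move=> df fC x y; wlog yx : x y / y <= x => [H|].
  by have [|/ltW] := leP y x; [exact: H|rewrite distrC (distrC x); exact: H].
by have [c _ ->] := mean_value _ y x df yx; rewrite normrM ler_wpM2r.
Qed.

Lemma lipschitz_symmetric f C q : (forall x y, `|f x - f y| <= C * `|x - y|) ->
  forall x y, (f (x + q) + f (- x + q)) - (f (y + q) + f (- y + q)) <= 2 * C * `| `|x| - `|y| |.
Proof.
move=> lip x y.
have absE z : f (z + q) + f (- z + q) = f (`|z| + q) + f (- `|z| + q).
  by case: (ger0P z) => _ //; rewrite opprK addrC.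
rewrite (absE x) (absE y); move: `|x| `|y| => {}x {}y.
have := lip (x + q) (y + q); have := lip (- x + q) (- y + q).
rewrite (_ : x + q - (y + q) = x - y); last by ring.
rewrite (_ : - x + q - (- y + q) = - (x - y)) ?normrN; last by ring.
by rewrite !ler_norml => /andP[_ h1] /andP[_ h2]; lra.
Qed.

End one_variable.

Section interaction.
Context {R : realType} (n : nat).
Local Notation lam := (lebesgue_Rn R n).
Variables (psic psib : 'I_n -> R -> R) (M : 'I_n -> 'I_n -> R) (h : 'I_n -> R).
Variables (delta C1 : R).
Hypothesis delta0 : 0 < delta.
Hypothesis MC : forall k l, M k l = M l k.
Hypothesis dc : forall k z, derivable (psic k) z 1.
Hypothesis ddc : forall k z, derivable ((psic k)^`()%classic) z 1.
Hypothesis db : forall k z, derivable (psib k) z 1.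
Hypothesis c2 : forall k z, 0 <= (psic k)^`(2)%classic z.
Hypothesis bC : forall k z, `|psib k z| + `|(psib k)^`()%classic z| <= C1.

Definition offdiag (f : R -> R) (k l : 'I_n) : R := if k == l then 0 else f (M k l).

Local Notation J := (offdiag (fun m => `|m|)).
Local Notation J' := (offdiag (fun m => - m)).

Hypothesis dominant : forall k, rowsum n J k + delta <= M k k.

Lemma offdiag_norm_ge0 k l : 0 <= J k l.
Proof. by rewrite /offdiag; case: ifP. Qed.

Lemma offdiag_norm_le k l : `|J' k l| <= J k l.
Proof. by rewrite /offdiag; case: ifP => _; rewrite ?normr0 ?normrN. Qed.

Lemma offdiag_normC k l : J k l = J l k.
Proof. by rewrite /offdiag eq_sym MC. Qed.

Definition finite_hamiltonian (u : 'Rn[R]_n) : R :=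
  \sum_k (psic k (tnth u k) + psib k (tnth u k)) +
  2^-1 * (\sum_k \sum_l M k l * tnth u k * tnth u l) + \sum_k h k * tnth u k.

Definition boltzmann (u : 'Rn[R]_n) : R := expR (- finite_hamiltonian u).

Lemma measurable_boltzmann : measurable_fun setT boltzmann.
Proof.
apply: measurableT_comp => //; apply: measurableT_comp => //; apply: measurable_funD.
  apply: measurable_funD.
    apply: measurable_sum => k.
    by apply: measurable_funD; apply: measurable_comp_coord; exact: derivable_measurable.
  apply: measurable_funM => //; apply: measurable_sum => k; apply: measurable_sum => l.
  by apply: measurable_funM; [apply: measurable_funM => //|]; exact: measurable_coord.
by apply: measurable_sum => k; apply: measurable_funM => //; exact: measurable_coord.
Qed.

Lemma quadratic_form (u : 'Rn[R]_n) : \sum_k \sum_l M k l * tnth u k * tnth u l =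
  \sum_k M k k * tnth u k ^+ 2 - quad n J' u.
Proof.
rewrite /quad -sumrB; apply: eq_bigr => k _.
rewrite (bigD1 k)//= [X in _ - X](bigD1 k)//= {1}/offdiag eqxx mul0r add0r.
rewrite -sumrN; congr (_ + _); first by ring.
by apply: eq_bigr => l lk; rewrite /offdiag eq_sym (negbTE lk); ring.
Qed.

Let normb k z : `|psib k z| <= C1.
Proof. by apply: le_trans (bC k z); rewrite lerDl. Qed.

Let normb' k z : `|(psib k)^`()%classic z| <= C1.
Proof. by apply: le_trans (bC k z); rewrite lerDr. Qed.

(** The convex part lies above its tangent at [0], and linear terms are absorbed by
    half of the quadratic form. *)
Lemma boltzmann_dom i j : exists K : R, forall u,
  expR (`|tnth u i| + `|tnth u j|) * boltzmann u <= K * gauss (delta / 4) u.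
Proof.
pose m k := `|(psic k)^`()%classic 0| + `|h k| + 2.
exists (expR (\sum_k (C1 - psic k 0 + m k ^+ 2 / delta))) => u.
rewrite /boltzmann gaussE -!expRD ler_expR.
have le1 k : `|tnth u k : R| <= \sum_k `|tnth u k : R|.
  by rewrite (bigD1 k)//= lerDl sumr_ge0.
have quadge : delta * \sum_k tnth u k ^+ 2 <= \sum_k \sum_l M k l * tnth u k * tnth u l.
  rewrite quadratic_form.
  have := quad_le n J offdiag_normC J' u offdiag_norm_le; rewrite ler_norml => /andP[_ q].
  suff : delta * \sum_k tnth u k ^+ 2 + \sum_k rowsum n J k * tnth u k ^+ 2 <=
      \sum_k M k k * tnth u k ^+ 2 by move: q; rewrite /rowsum; lra.
  rewrite mulr_sumr -big_split/=; apply: ler_sum => k _.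
  by rewrite -mulrDl ler_wpM2r ?sqr_ge0// addrC.
have site k : - (psic k (tnth u k) + psib k (tnth u k)) - h k * tnth u k +
    2 * `|tnth u k : R| - delta / 2 * tnth u k ^+ 2 <=
    (C1 - psic k 0 + m k ^+ 2 / delta) - delta / 4 * tnth u k ^+ 2.
  move: (tnth u k : R) => x.
  have := above_tangent _ (dc k) (ddc k) (c2 k) x.
  have := normb k x; rewrite ler_norml => /andP[bl _].
  have : - ((psic k)^`()%classic 0 * x) <= `|(psic k)^`()%classic 0| * `|x|.
    by rewrite -normrM (le_trans (ler_norm _))// normrN.
  have : - (h k * x) <= `|h k| * `|x| by rewrite -normrM (le_trans (ler_norm _))// normrN.
  have : m k * `|x| <= m k ^+ 2 / delta + delta / 4 * x ^+ 2.
    rewrite -[x ^+ 2]real_normK ?num_real// -subr_ge0.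
    rewrite (_ : _ - _ = (delta / 2 * `|x| - m k) ^+ 2 / delta).
      by rewrite divr_ge0 ?sqr_ge0// ltW.
    by field; rewrite gt_eqF.
  rewrite {1}/m !mulrDl; lra.
have key : \sum_k - (psic k (tnth u k) + psib k (tnth u k)) + \sum_k - (h k * tnth u k) +
    \sum_k 2 * `|tnth u k : R| + \sum_k - (delta / 2 * tnth u k ^+ 2) <=
    \sum_k (C1 - psic k 0 + m k ^+ 2 / delta) + \sum_k - (delta / 4 * tnth u k ^+ 2).
  by rewrite -!big_split/=; apply: ler_sum => k _; exact: site.
move: key; rewrite !sumrN -!mulr_sumr.
have := le1 i; have := le1 j.
rewrite /finite_hamiltonian; move: quadge.
lra.
Qed.

Section conditional.
Variable q : 'Rn[R]_n.

(** The potential of the half-difference of two copies with midpoint [q]: even and,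
    by convexity, nondecreasing in [|x|]. It includes the part of the diagonal of
    [M] that exceeds [rowsum k + delta]. *)
Definition kappa k x := psic k (x + tnth q k) + psic k (- x + tnth q k) +
  (M k k - (rowsum n J k + delta)) * x ^+ 2.
Definition beta k x := psib k (x + tnth q k) + psib k (- x + tnth q k).

Local Notation lo := (fun k => dens_lo (rowsum n J k + delta) (kappa k) (beta k)).

Lemma measurable_reflect (f : R -> R) (c : R) : measurable_fun setT f ->
  measurable_fun setT (fun x : R => f (x + c) + f (- x + c)).
Proof.
move=> mf; apply: measurable_funD; apply: (measurableT_comp mf); apply: measurable_funD => //.
Qed.

Lemma measurable_beta k : measurable_fun setT (beta k).
Proof. by apply: measurable_reflect; exact: derivable_measurable. Qed.

Lemma measurable_kappa k : measurable_fun setT (kappa k).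
Proof.
apply: measurable_funD; first by apply: measurable_reflect; exact: derivable_measurable.
by apply: measurable_funM => //; exact: measurable_funX.
Qed.

Lemma kappa_mono k x y : `|x| <= `|y| -> kappa k x <= kappa k y.
Proof.
move=> xy; apply: lerD; first exact: convex_symmetric_mono.
rewrite ler_wpM2l ?subr_ge0// -[x ^+ 2]real_normK ?num_real// -[y ^+ 2]real_normK ?num_real//.
by apply: lerXn2r; rewrite ?nnegrE.
Qed.

Lemma beta_bound k x : `|beta k x| <= 2 * C1.
Proof.
apply: le_trans (ler_normD _ _) _.
by have := normb k (x + tnth q k); have := normb k (- x + tnth q k); lra.
Qed.

Lemma beta_lip k x y : beta k x - beta k y <= 2 * C1 * `| `|x| - `|y| |.
Proof. by apply: lipschitz_symmetric; apply: lipschitz. Qed.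

(** In the sum of the two Hamiltonians the terms of odd degree in [z] cancel; the
    midpoint [q] survives in the one-site potentials and in a constant. *)
Lemma boltzmann_reflect z : boltzmann (affine 1 q z) * boltzmann (affine (-1) q z) =
  expR (- (\sum_k \sum_l M k l * tnth q k * tnth q l + 2 * \sum_k h k * tnth q k)) *
  (expR (quad n J' z) * prodw n lo z).
Proof.
rewrite /boltzmann /prodw /dens_lo -expR_sum -!expRD; congr expR.
have ME : \sum_k \sum_l M k l * tnth (affine 1 q z) k * tnth (affine 1 q z) l +
    \sum_k \sum_l M k l * tnth (affine (-1) q z) k * tnth (affine (-1) q z) l =
    2 * (\sum_k \sum_l M k l * tnth z k * tnth z l) +
    2 * (\sum_k \sum_l M k l * tnth q k * tnth q l).
  rewrite -mulrDr -!big_split/= mulr_sumr; apply: eq_bigr => k _.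
  rewrite -!big_split/= mulr_sumr; apply: eq_bigr => l _; rewrite !tnth_affine; ring.
have hE : \sum_k h k * tnth (affine 1 q z) k + \sum_k h k * tnth (affine (-1) q z) k =
    2 * \sum_k h k * tnth q k.
  rewrite -big_split/= mulr_sumr; apply: eq_bigr => k _; rewrite !tnth_affine; ring.
have pE : \sum_k (psic k (tnth (affine 1 q z) k) + psib k (tnth (affine 1 q z) k)) +
    \sum_k (psic k (tnth (affine (-1) q z) k) + psib k (tnth (affine (-1) q z) k)) =
    - \sum_k M k k * tnth z k ^+ 2 -
    \sum_k (- kappa k (tnth z k) - beta k (tnth z k) -
      (rowsum n J k + delta) * tnth z k ^+ 2).
  rewrite -big_split/= -opprD -big_split/= -sumrN; apply: eq_bigr => k _.
  by rewrite !tnth_affine /kappa /beta !mul1r !mulN1r; ring.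
move: ME hE pE; rewrite (quadratic_form z) /finite_hamiltonian; lra.
Qed.

End conditional.

End interaction.

(** * Covariances of Gibbs measures *)

(** [conditional_bound] is uniform in the midpoint because [2 * C1] bounds the
    perturbation [beta] and its Lipschitz constant for every [q]. *)
Lemma boltzmann_covariance {R : realType} (alpha delta S Kj C1 : R) :
  0 < alpha -> 0 < delta -> 0 <= S -> 0 <= Kj -> 0 <= C1 ->
  exists2 C : R, 0 <= C &
  forall n (psic psib : 'I_n -> R -> R) (M : 'I_n -> 'I_n -> R) (h : 'I_n -> R)
    (pos : 'I_n -> nat), injective pos ->
  (forall k l, M k l = M l k) ->
  (forall k z, derivable (psic k) z 1) ->
  (forall k z, derivable ((psic k)^`()%classic) z 1) ->
  (forall k z, derivable (psib k) z 1) ->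
  (forall k z, 0 <= (psic k)^`(2)%classic z) ->
  (forall k z, `|psib k z| + `|(psib k)^`()%classic z| <= C1) ->
  let J := offdiag n M (fun m => `|m|) in
  (forall k, rowsum n J k + delta <= M k k) -> (forall k, M k k <= S) ->
  (forall k l, `|M k l| <= Kj * decay (2 + alpha) (gap (pos k) (pos l))) ->
  forall i j, let W := boltzmann n psic psib M h in
    let E f := \int[lebesgue_Rn R n]_u (f u * W u) in
    `|E (fun=> 1) * E (fun u => tnth u i * tnth u j) -
      E (fun u => tnth u i) * E (fun u => tnth u j)| <=
    C * decay (2 + alpha) (gap (pos i) (pos j)) * (E (fun=> 1) * E (fun=> 1)).
Proof.
move=> alpha0 delta0 S0 Kj0 C10.
have b0 : 0 <= 2 * C1 by rewrite mulr_ge0.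
have [C C0 H] := conditional_bound alpha delta S Kj (2 * C1) alpha0 delta0 S0 Kj0 b0.
exists (2 * C); first by rewrite mulr_ge0.
move=> n psic psib M h pos pos_inj MC dc ddc db c2 bC J dom MS Md i j.
set W := boltzmann n psic psib M h; cbv zeta.
have JC k l : J k l = J l k by exact: offdiag_normC.
have JJ' : forall k l, `|offdiag n M (fun m => - m) k l| <= J k l by exact: offdiag_norm_le.
have J0 k l : 0 <= J k l by exact: offdiag_norm_ge0.
have JS k : rowsum n J k <= S.
  by apply: le_trans (MS k); apply: le_trans (dom k); rewrite lerDl ltW.
have Jd k l : J k l <= Kj * decay (2 + alpha) (gap (pos k) (pos l)).
  rewrite /J /offdiag; case: ifP => // _.
  by rewrite mulr_ge0// decay_ge0.
have [K Kdom] := boltzmann_dom n psic psib M h delta C1 delta0 MC dc ddc c2 bC dom i j.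
have mW : measurable_fun setT W by exact: measurable_boltzmann.
have W0 u : 0 <= W u by exact: expR_ge0.
have e0 : 0 < delta / 4 by rewrite divr_gt0.
set hh := decay _ _.
have cond q : `|\int[lebesgue_Rn R n]_z (tnth z i * tnth z j *
      (W (affine 1 q z) * W (affine (-1) q z)))| <=
    C * hh * \int[lebesgue_Rn R n]_z (W (affine 1 q z) * W (affine (-1) q z)).
  pose lo k := dens_lo (rowsum n J k + delta) (kappa n psic M delta q k) (beta n psib q k).
  pose A := expR (- (\sum_k \sum_l M k l * tnth q k * tnth q l + 2 * \sum_k h k * tnth q k)).
  have WE z : W (affine 1 q z) * W (affine (-1) q z) =
      A * (expR (quad n (offdiag n M (fun m => - m)) z) * prodw n lo z).
    exact: boltzmann_reflect.
  have ml k : measurable_fun setT (lo k).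
    by apply: measurable_dens_lo; [exact: measurable_kappa|exact: measurable_beta].
  have km k x y : `|x| <= `|y| -> kappa n psic M delta q k x <= kappa n psic M delta q k y.
    exact: kappa_mono.
  have bb k x : `|beta n psib q k x| <= 2 * C1 by exact: beta_bound.
  have lo0 k z : 0 <= lo k z by exact: dens_lo_ge0.
  have wi (f : 'Rn[R]_n -> R) : measurable_fun setT f ->
      (forall x : 'Rn[R]_n, `|f x| <= expR (`|tnth x i| + `|tnth x j|)) ->
      (lebesgue_Rn R n).-integrable setT (EFin \o (fun x => f x *
        expR (quad n (offdiag n M (fun m => - m)) x) * prodw n lo x)).
    apply: (weighted_integrable n J (delta / 2) JC _ i j _ lo
      (fun k => expR (2 * C1 - kappa n psic M delta q k 0))); rewrite ?divr_gt0//.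
    by move=> k z; exact: (lo_le _ _ _ _ _ z (km k) (bb k) delta0).
  have i1 : (lebesgue_Rn R n).-integrable setT (EFin \o (fun x =>
      expR (quad n (offdiag n M (fun m => - m)) x) * prodw n lo x)).
    have := wi (fun=> 1) (measurable_cst _).
    rewrite (_ : (fun x => _ * _ * _) = (fun x =>
      expR (quad n (offdiag n M (fun m => - m)) x) * prodw n lo x)); last first.
      by apply/funext => x; rewrite mul1r.
    by apply=> x; rewrite normr1 -expR0 ler_expR addr_ge0.
  have i2 := wi (fun x => tnth x i * tnth x j).
  have E1 : \int[lebesgue_Rn R n]_z (tnth z i * tnth z j *
      (W (affine 1 q z) * W (affine (-1) q z))) = A * \int[lebesgue_Rn R n]_z (tnth z i * tnth z j *
      expR (quad n (offdiag n M (fun m => - m)) z) * prodw n lo z).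
    rewrite -(RintegralZl _ measurableT (i2 _ _)).
    - by apply: eq_Rintegral => z _; rewrite WE; ring.
    - by apply: measurable_funM; exact: measurable_coord.
    - move=> x; rewrite normrM expRD; apply: ler_pM => //;
        by rewrite (le_trans _ (expR_ge1Dx _))// lerDr.
  have E2 : \int[lebesgue_Rn R n]_z (W (affine 1 q z) * W (affine (-1) q z)) =
      A * \int[lebesgue_Rn R n]_z
      (expR (quad n (offdiag n M (fun m => - m)) z) * prodw n lo z).
    by rewrite -(RintegralZl _ measurableT i1); apply: eq_Rintegral => z _; rewrite WE.
  rewrite E1 E2.
  rewrite normrM (ger0_norm (expR_ge0 _)) mulrCA ler_wpM2l ?expR_ge0//.
  apply: (H n J _ pos) => //.
  - by move=> k; exact: measurable_kappa.
  - by move=> k; exact: measurable_beta.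
  - by move=> k x y; exact: beta_lip.
have := doubling n W K (delta / 4) (C * hh) i j e0 mW W0 Kdom cond.
rewrite (_ : \int[lebesgue_Rn R n]_u W u = \int[lebesgue_Rn R n]_u (1 * W u)).
  by rewrite !mulrA.
by apply: eq_Rintegral => u _; rewrite mul1r.
Qed.

(** * The infinite lattice and its boundary conditions *)

Section boundary_sums.
Context {R : realType}.

Lemma esum_scale_le (D : set int) (f : int -> R) (c : R) : 0 <= c -> (forall j, 0 <= f j) ->
  (\esum_(j in D) (c * f j)%:E <= c%:E * \esum_(j in D) (f j)%:E)%E.
Proof.
move=> c0 f0; apply: ge_ereal_sup => _ [X DX <-].
under eq_fsbigr do rewrite EFinM.
rewrite -ge0_mule_fsumr; last by move=> j; rewrite lee_fin.
by rewrite lee_wpmul2l ?lee_fin//; apply: ereal_sup_ubound; exists X.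
Qed.

Lemma esum_scale (D : set int) (f : int -> R) (c : R) : 0 < c -> (forall j, 0 <= f j) ->
  (\esum_(j in D) (c * f j)%:E = c%:E * \esum_(j in D) (f j)%:E)%E.
Proof.
move=> c0 f0; apply/eqP; rewrite eq_le esum_scale_le ?(ltW c0)//=.
rewrite -lee_pdivlMl//.
have cf0 j : 0 <= c * f j by rewrite mulr_ge0// ltW.
have := esum_scale_le D (fun j => c * f j) c^-1 _ cf0.
rewrite invr_ge0 (ltW c0) => /(_ isT); congr (_ <= _)%E.
by apply: eq_esum => j _; rewrite mulKf// gt_eqF.
Qed.

Lemma sum_overN (D : set int) (f : int -> R) :
  sum_over D (fun j => - f j) = - sum_over D f.
Proof.
rewrite /sum_over opprB; by congr (fine _ - fine _); apply: eq_esum => j _;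
  rewrite /funrneg /funrpos ?opprK.
Qed.

Lemma sum_over0 (D : set int) : sum_over D (fun=> 0) = 0 :> R.
Proof.
by rewrite /sum_over !esum1 ?subr0// => j _; rewrite /funrneg /funrpos ?oppr0 maxxx.
Qed.

Lemma sum_over_pos (D : set int) (f : int -> R) c : 0 < c ->
  sum_over D (fun j => c * f j) = c * sum_over D f.
Proof.
move=> c0; have fine_scale (x : \bar R) : fine (c%:E * x)%E = c * fine x.
  case: x => [r| |] //=; first by rewrite gt0_muley ?lte_fin//= mulr0.
  by rewrite gt0_muleNy ?lte_fin//= mulr0.
have p0 j : 0 <= f^\+ j by rewrite /funrpos le_max lexx orbT.
have n0 j : 0 <= f^\- j by rewrite /funrneg le_max lexx orbT.
rewrite /sum_over mulrBr -!fine_scale -(esum_scale D _ c c0 p0) -(esum_scale D _ c c0 n0).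
congr (fine _ - fine _); apply: eq_esum => j _; congr EFin;
  by rewrite ?/funrneg ?/funrpos maxr_pMr ?(ltW c0)// mulr0 ?mulrN.
Qed.

Lemma sum_overZ (D : set int) (f : int -> R) c :
  sum_over D (fun j => c * f j) = c * sum_over D f.
Proof.
have [c0|c0|<-] := ltgtP 0 c; first exact: sum_over_pos.
  rewrite -[c]opprK; under eq_fun do rewrite mulNr.
  by rewrite (sum_overN D (fun j => - c * f j)) (sum_over_pos D f) ?oppr_gt0// -[LHS]mulNr.
by rewrite mul0r -[RHS](sum_over0 D); congr sum_over; apply/funext => j; rewrite mul0r.
Qed.

End boundary_sums.

Section power_laws.
Context {R : realType}.

Lemma inv_powR_le_decay (p : R) (d : nat) : 0 < p ->
  (d%:R `^ p + 1)^-1 <= 2 `^ p * decay p d.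
Proof.
move=> p0; rewrite /decay powRN -[2 `^ p]invrK -invfM lef_pV2 ?posrE; last 2 first.
- by rewrite ltr_wpDl ?powR_ge0.
- by rewrite mulr_gt0 ?invr_gt0 ?powR_gt0.
rewrite mulrC ler_pdivrMr ?powR_gt0//.
case: d => [|d]; first by rewrite powR0 ?gt_eqF// add0r mul1r ge0_ler_powR ?nnegrE ?ler1n// ltW.
rewrite (@le_trans _ _ (d.+1%:R `^ p * 2 `^ p))//; last by rewrite ler_wpM2r ?powR_ge0// lerDl.
rewrite -powRM//; apply: ge0_ler_powR; rewrite ?nnegrE ?(ltW p0)//.
by rewrite -natrM ler_nat; lia.
Qed.

Lemma decay_le_inv_powR (p q : R) (d : nat) : 0 < q -> q <= p ->
  decay p d <= 2 / (d%:R `^ q + 1).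
Proof.
move=> q0 qp; have d0 : 0 < d%:R `^ q + 1 by rewrite ltr_wpDl ?powR_ge0.
rewrite /decay powRN -[2 / _]invrK lef_pV2 ?posrE ?powR_gt0 ?invr_gt0 ?divr_gt0//.
rewrite invfM invrK mulrC ler_pdivrMr//.
have d1 : 1 <= d.+1%:R `^ q.
  rewrite [leLHS](_ : 1 = 1 `^ q :> R); last by rewrite powR1.
  by rewrite ge0_ler_powR ?nnegrE ?ler1n ?(ltW q0).
have dq : d%:R `^ q <= d.+1%:R `^ q.
  by rewrite ge0_ler_powR ?nnegrE ?ler_nat ?(ltW q0).
have qp' : d.+1%:R `^ q <= d.+1%:R `^ p by rewrite ler_powR ?ler1n.
by lra.
Qed.

End power_laws.

Section gibbs_covariance.
Context {R : realType} (psi psic psib : int -> R -> R) (M : int -> int -> R).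
Variables (L : {fset int}) (y : int -> R).
Hypothesis psiE : forall i z, psi i z = psic i z + psib i z.
Local Notation n := (#|{: L}|).

Definition lattice_site (k : 'I_n) : int := val (enum_val k).

Let sum_lattice_site (f : L -> R) : \sum_(i : L) f i = \sum_(k < n) f (enum_val k).
Proof.
rewrite (reindex (fun k : 'I_n => enum_val k))//=.
by apply: onW_bij; exact: enum_val_bij.
Qed.

Lemma hamiltonianE : @hamiltonian R psi M L y =
  finite_hamiltonian n (psic \o lattice_site) (psib \o lattice_site)
    (fun k l => M (lattice_site k) (lattice_site l))
    (fun k => sum_over (~` [set` L]) (fun j => M (lattice_site k) j * y j)).
Proof.
apply/funext => x; rewrite /hamiltonian /finite_hamiltonian /spin !sum_lattice_site.
congr (_ + 2^-1 * _ + _).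
- by apply: eq_bigr => k _; rewrite psiE enum_valK.
- apply: eq_bigr => k _; rewrite sum_lattice_site.
  by apply: eq_bigr => l _; rewrite !enum_valK.
- apply: eq_bigr => k _; rewrite enum_valK mulrC -sum_overZ.
  by congr sum_over; apply/funext => j; rewrite mulrAC mulrC.
Qed.

Lemma offdiag_rowsum_le k :
  ((rowsum n (offdiag n (fun k l => M (lattice_site k) (lattice_site l)) (fun m => `|m|)) k)%:E <=
   \esum_(j in [set j : int | j != lattice_site k]) `|M (lattice_site k) j|%:E)%E.
Proof.
apply: esum_ge; exists [set` (L `\ lattice_site k)%fset].
  by split=> // j /=; rewrite !inE => /andP[].
rewrite fsbig_finite//= set_fsetK sumEFin lee_fin.
have kL : lattice_site k \in L by exact: valP.
have := big_fsetD1 (lattice_site k) (F := fun j => `|M (lattice_site k) j|) (op := +%R) kL.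
rewrite big_seq_fsetE/= sum_lattice_site (bigD1 k)//= => /addrI <-.
rewrite /rowsum (bigD1 k)//= /offdiag eqxx add0r; apply: ler_sum => l lk.
by rewrite eq_sym (negbTE lk).
Qed.

End gibbs_covariance.

(** Finitely many integers can be translated to natural numbers. *)
Lemma nat_positions n (s : 'I_n -> int) : injective s ->
  exists2 pos : 'I_n -> nat, injective pos &
    forall k l, gap (pos k) (pos l) = `|s k - s l|%N.
Proof.
move=> s_inj; pose b := (\max_k `|s k|)%N.
have sb k : (`|s k| <= b)%N by exact: (leq_bigmax k).
exists (fun k => absz (s k + b%:Z)).
- by move=> k l E; apply: s_inj; move: (sb k) (sb l) E; clear; lia.
- by move=> k l; move: (sb k) (sb l); rewrite /gap; clear; lia.
Qed.

Lemma covariance_density d (T : measurableType d) (R : realType) (P : probability T R)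
    (lam : {sigma_finite_measure set T -> \bar R}) (w X Y : T -> R) :
  (forall x, 0 <= w x) -> lam.-integrable setT (EFin \o w) ->
  (forall A, measurable A -> P A = (\int[lam]_(x in A) (w x)%:E)%E) ->
  measurable_fun setT X -> measurable_fun setT Y ->
  lam.-integrable setT (EFin \o (fun x => X x * w x)) ->
  lam.-integrable setT (EFin \o (fun x => Y x * w x)) ->
  lam.-integrable setT (EFin \o (fun x => X x * Y x * w x)) ->
  covariance P X Y = (\int[lam]_x (X x * Y x * w x) -
    (\int[lam]_x (X x * w x)) * \int[lam]_x (Y x * w x))%:E.
Proof.
move=> w0 wi Pw mX mY iX iY iXY.
have [PX EX] := integral_density _ _ _ P lam w w0 wi Pw X mX iX.
have [PY EY] := integral_density _ _ _ P lam w w0 wi Pw Y mY iY.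
have [PXY EXY] := integral_density _ _ _ P lam w w0 wi Pw (fun x => X x * Y x)
  (measurable_funM mX mY) iXY.
rewrite covarianceE; [|exact/Lfun1_integrable..].
by rewrite unlock /= EX EY [X in (X - _)%E]EXY EFinB EFinM.
Qed.

Lemma normalized_covariance d (T : measurableType d) (R : realType) (P : probability T R)
    (lam : {sigma_finite_measure set T -> \bar R}) (W X Y : T -> R) (B : R) :
  let Z := \int[lam]_x W x in
  (forall x, 0 <= W x) -> lam.-integrable setT (EFin \o W) ->
  (forall A, measurable A -> P A = (\int[lam]_(x in A) (W x / Z)%:E)%E) ->
  measurable_fun setT X -> measurable_fun setT Y ->
  lam.-integrable setT (EFin \o (fun x => X x * W x)) ->
  lam.-integrable setT (EFin \o (fun x => Y x * W x)) ->
  lam.-integrable setT (EFin \o (fun x => X x * Y x * W x)) ->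
  `|Z * (\int[lam]_x (X x * Y x * W x)) -
    (\int[lam]_x (X x * W x)) * (\int[lam]_x (Y x * W x))| <= B * (Z * Z) ->
  (`|covariance P X Y| <= B%:E)%E.
Proof.
move=> Z W0 Wi PW mX mY iX iY iXY ineq.
have Z0 : 0 <= Z by exact: Rintegral_ge0.
(* Otherwise the density would vanish. *)
have Zgt0 : 0 < Z.
  rewrite lt_neqAle Z0 andbT; apply/negP => /eqP ZE.
  have := PW _ measurableT; rewrite probability_setT -ZE.
  under eq_integral do rewrite invr0 mulr0.
  by rewrite integral0 => /eqP; rewrite eqe oner_eq0.
have resc (f : T -> R) : (fun x => f x * (W x / Z)) = (fun x => Z^-1 * (f x * W x)).
  by apply/funext => x; rewrite mulrC -mulrA mulrCA [W x * _]mulrC.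
have wE : (fun x => W x / Z) = (fun x => Z^-1 * W x) by apply/funext => x; rewrite mulrC.
have iw : lam.-integrable setT (EFin \o (fun x => W x / Z)) by rewrite wE; exact: integrableZ.
have sc f : lam.-integrable setT (EFin \o (fun x => f x * W x)) ->
    lam.-integrable setT (EFin \o (fun x => f x * (W x / Z))).
  by move=> fi; rewrite resc; exact: integrableZ.
rewrite (covariance_density _ _ _ P lam (fun x => W x / Z))//; last 4 first.
- by move=> x; rewrite divr_ge0.
- exact: sc.
- exact: sc.
- exact: (sc (fun x => X x * Y x)).
rewrite (resc X) (resc Y) (resc (fun x => X x * Y x)).
rewrite (RintegralZl _ measurableT iX) (RintegralZl _ measurableT iY) (RintegralZl _ measurableT iXY).
move: ineq; set EXY := \int[lam]_x _; set EX := \int[lam]_x _; set EY := \int[lam]_x _ => ineq.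
rewrite /= lee_fin [X in `|X|](_ : _ = (Z * EXY - EX * EY) / (Z * Z)); last first.
  by field; rewrite gt_eqF.
by rewrite normrM normfV [X in _ / X]ger0_norm ?mulr_ge0// ler_pdivrMr ?mulr_gt0.
Qed.

Theorem theorem1p4 (R : realType) (delta C1 C0 alpha : R)
    (delta_gt0 : 0 < delta) (alpha_gt0 : 0 < alpha) :
  exists alpha' C : R, [/\ 0 < alpha', alpha' < alpha &
    forall (psi psic psib : int -> R -> R) (M : int -> int -> R),
      (forall (i : int) (z : R), psi i z = psic i z + psib i z) ->
      (forall (i : int) (z : R), derivable (psic i) z 1) ->
      (forall (i : int) (z : R), derivable ((psic i)^`()%classic) z 1) ->
      (forall (i : int) (z : R), derivable (psib i) z 1) ->
      (forall (i : int) (z : R), 0 <= (psic i)^`(2)%classic z) ->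
      (forall (i : int) (z : R), `|psib i z| + `|(psib i)^`()%classic z| <= C1) ->
      (forall i j : int, M i j = M j i) ->
      (forall i : int, (\esum_(j in [set j : int | j != i]) `|M i j|%:E + delta%:E
                    <= (M i i)%:E)%E) ->
      (forall i j : int, `|M i j| <= C0 / (`|i - j|%:~R `^ (2 + alpha) + 1)) ->
    forall (L : {fset int}) (y : int -> R), tempered M L y ->
    forall mu : probability 'Rn[R]_#|{: L}| R, gibbs_measure psi M y mu ->
    forall i j : L,
      (`|covariance mu (spin i) (spin j)|
         <= (C / (`|val i - val j|%:~R `^ (2 + alpha') + 1))%:E)%E].
Proof.
(* The signs of [C0] and [C1] are known only once [M] and [psib] are given. *)
pose Kj := `|C0| * 2 `^ (2 + alpha).
have p0 : 0 < 2 + alpha by lra.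
have Kj0 : 0 <= Kj by rewrite mulr_ge0 ?powR_ge0.
have [C C_ge0 bound] := boltzmann_covariance alpha delta `|C0| Kj `|C1|
  alpha_gt0 delta_gt0 (normr_ge0 _) Kj0 (normr_ge0 _).
(* The proof yields the exponent [2 + alpha]; any smaller one follows. *)
exists (alpha / 2), (2 * C); split; [by rewrite divr_gt0|by rewrite ltr_pdivrMr//; lra|].
move=> psi psic psib M psiE dc ddc db c2 bC MC Mdom Mdec L y _ mu gibbs i j.
pose n := #|{: L}|; pose s k := lattice_site L k.
have s_inj : injective s by move=> k l /val_inj /enum_val_inj.
have [pos pos_inj posE] := nat_positions n s s_inj.
have sE a : s (enum_rank a) = val a by rewrite /s /lattice_site enum_rankK.
have M0 k l : `|M k l| <= `|C0| * (`|k - l|%N%:R `^ (2 + alpha) + 1)^-1.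
  apply: le_trans (Mdec k l) _; by rewrite natr_absz ler_wpM2r ?ler_norm.
pose h k := sum_over (~` [set` L]) (fun m => M (s k) m * y m).
pose W := boltzmann n (psic \o s) (psib \o s) (fun k l => M (s k) (s l)) h.
have WE x : expR (- hamiltonian psi M y x) = W x.
  by rewrite (hamiltonianE psi psic psib).
have dom k : rowsum n (offdiag n (fun k l => M (s k) (s l)) (fun m => `|m|)) k + delta <=
    M (s k) (s k).
  rewrite -lee_fin EFinD; apply: le_trans (Mdom (s k)); rewrite leeD2r//.
  exact: offdiag_rowsum_le.
have diag k : M (s k) (s k) <= `|C0|.
  apply: le_trans (ler_norm _) _; apply: le_trans (M0 _ _) _.
  by rewrite subrr absz0 powR0 ?gt_eqF// add0r invr1 mulr1.
have dec k l : `|M (s k) (s l)| <= Kj * decay (2 + alpha) (gap (pos k) (pos l)).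
  apply: le_trans (M0 _ _) _; rewrite /Kj -mulrA ler_wpM2l// posE.
  exact: inv_powR_le_decay.
have bC1 k z : `|psib k z| + `|(psib k)^`()%classic z| <= `|C1|.
  exact: le_trans (bC k z) (ler_norm _).
have [K Kdom] := boltzmann_dom n (psic \o s) (psib \o s) (fun k l => M (s k) (s l)) h
  delta `|C1| delta_gt0 (fun k l => MC _ _) (fun k => dc _) (fun k => ddc _)
  (fun k => c2 _) (fun k => bC1 _) dom (enum_rank i) (enum_rank j).
have e0 : 0 < delta / 4 by rewrite divr_gt0.
have mW : measurable_fun setT W.
  by apply: measurable_boltzmann => k; [exact: dc|exact: db].
have W0 u : 0 <= W u by exact: expR_ge0.
apply: (@le_trans _ _ (C * decay (2 + alpha) (gap (pos (enum_rank i)) (pos (enum_rank j))))%:E).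
  set B := C * _.
  have muW A : measurable A -> mu A =
      (\int[lebesgue_Rn R n]_(x in A) (W x / \int[lebesgue_Rn R n]_x W x)%:E)%E.
    move=> mA; rewrite (gibbs A mA).
    have ZE : partition_function psi M L y = \int[lebesgue_Rn R n]_x W x.
      rewrite /partition_function /Rintegral; congr fine.
      by apply: eq_integral => x _; rewrite WE.
    by apply: eq_integral => x _; rewrite ZE WE.
  apply: (normalized_covariance _ _ _ mu (lebesgue_Rn R n) W _ _ B W0
    (tilted_integrable1 n W K (delta / 4) _ _ e0 mW W0 Kdom) muW
    (measurable_coord n (enum_rank i)) (measurable_coord n (enum_rank j))
    (tilted_integrable_i n W K (delta / 4) _ _ e0 mW W0 Kdom)
    (tilted_integrable_j n W K (delta / 4) _ _ e0 mW W0 Kdom)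
    (tilted_integrable_ij n W K (delta / 4) _ _ e0 mW W0 Kdom)).
  have := bound n (psic \o s) (psib \o s) (fun k l => M (s k) (s l)) h pos pos_inj
    (fun k l => MC _ _) (fun k => dc _) (fun k => ddc _) (fun k => db _)
    (fun k => c2 _) (fun k => bC1 _) dom diag dec (enum_rank i) (enum_rank j).
  rewrite -/W /=; have -> : \int[lebesgue_Rn R n]_u (1 * W u) = \int[lebesgue_Rn R n]_u W u.
    by apply: eq_Rintegral => u _; rewrite mul1r.
  exact.
rewrite lee_fin -natr_absz posE !sE [2 * C]mulrC -mulrA ler_wpM2l//.
by apply: decay_le_inv_powR; lra.
Qed.
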